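(* Let $f:M\to M$ be a diffeomorphism on a closed manifold $M$ and let $\Lambda\subset M$ be any compact $f$-invariant set. A splitting $T_\Lambda M=E_1\oplus\cdots\oplus E_k$ of the tangent bundle over $\Lambda$ (with $k\ge 2$) is $(n_1,\dots,n_k)$-dominated if and only if there exist continuous real functions $p_i:\Lambda\to\mathbb R^+$, $i=1,\dots,k$, with $\log p_1,\dots,\log p_k$ summably separated with respect to $f$ on $\Lambda$, such that for each $i=1,\dots,k$ the linear cocycle $(f,p_iDf)$ admits a hyperbolicity over $\Lambda$ with stable subspace of dimension $n_1+\cdots+n_i$.
   Context: The tangent bundle of $M$ carries a continuous inner product, with induced norm $\|\cdot\|$ (also used for operator norms). For $n\in\mathbb Z$, $Df^n(x):T_xM\to T_{f^n(x)}M$ is the derivative of $f^n$ at $x$. $T_\Lambda M$ is the restriction of $TM$ to $\Lambda$, and $\mathbb R^+=(0,\infty)$ as the range of the functions $p_i$. Dominated splitting: a $Df$-invariant splitting $T_xM=E_1(x)\oplus\cdots\oplus E_k(x)$, $x\in\Lambda$ (invariant meaning $Df(x)E_i(x)=E_i(f(x))$), is dominated if there are constants $C>1$, $\alpha>0$ such that for every $i<j$, every $x\in\Lambda$, every $u,v\in T_xM$ and all $m,n\in\mathbb Z$ with $m\ge0$, $$\frac{\|Df^{n+m}(x)P_i(x)u\|\,\|Df^n(x)P_j(x)v\|}{\|Df^n(x)P_i(x)u\|\,\|Df^{n+m}(x)P_j(x)v\|}\le Ce^{-m\alpha},$$ whenever the denominator does not vanish, where $P_1,\dots,P_k$ are the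 oblique projectors of the decomposition, i.e. $P_i(x)$ is the projection of $T_xM$ onto $E_i(x)$ along $\bigoplus_{j\neq i}E_j(x)$. The splitting is called $(n_1,\dots,n_k)$-dominated if it is dominated and $n_i=\dim E_i$ for $i=1,\dots,k$. Summably separated: real continuous functions $q_1,\dots,q_k:\Lambda\to\mathbb R$ are summably separated with respect to $f$ on $\Lambda$ if there exist $\beta\ge0$ and $\gamma>0$ such that for $i=1,\dots,k-1$, $$\sum_{j=n}^{n+m-1}\big(q_{i+1}(f^j(x))-q_i(f^j(x))\big)\ge-\beta+\gamma m$$ for all $m,n\in\mathbb Z^+$, $m\ge1$, and all $x\in\Lambda$. Linear cocycle and hyperbolicity: for a continuous $p:\Lambda\to\mathbb R^+$, the linear cocycle $(f,pDf)$ is the automorphism of $T_\Lambda M$ covering $f$ given on fibers by $A(x)=p(x)Df(x):T_xM\to T_{f(x)}M$. For $n\ge1$, $A^n(x)=A(f^{n-1}(x))\cdots A(f(x))A(x)$ and $A^{-n}(f^n(x))=(A^n(x))^{-1}$. The cocycle admits a hyperbolicity over $\Lambda$ if there is a continuous decomposition $T_\Lambda M=E^s\oplus E^u$, invariant under $A$, and constants $C>1$, $\alpha>0$ such that $$\|A^n(x)Q(x)\|\le Ce^{-n\alpha},\qquad \|(I-Q(x))A^{-n}(f^n(x))\|\le Ce^{-n\alpha}$$ for all $n\ge1$ and $x\in\Lambda$, where $Q$ and $I-Q$ are the oblique projectors corresponding to $T_\Lambda M=E^s\oplus E^u$ ($Q(x)$ projecting onto $E^s(x)$ along $E^u(x)$).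 The case where $E^u$ is the zero bundle is not excluded. The stable subspace is $E^s(x)=Q(x)(T_xM)$.
   Formalization: The separation is required of log p_k,...,log p_1 (reversed order), since the printed order fails for a hyperbolic torus automorphism; the claim is read as existence of some (n_1,...,n_k)-dominated splitting, with n_1+...+n_k = dim M. *)

(* Defs.v *)
(* MathComp / MathComp-Analysis *)
From HB Require Import structures.
From mathcomp Require Import all_boot all_order all_algebra.
From mathcomp Require Import all_classical all_reals all_analysis.

Set Implicit Arguments.
Unset Strict Implicit.
Unset Printing Implicit Defensive.

Import Order.TTheory GRing.Theory Num.Theory.
Import numFieldNormedType.Exports.

Local Open Scope classical_set_scope.
Local Open Scope ring_scope.

Definition C1_on (R : realType) (d : nat) (U : set 'rV[R]_d)
    (h : 'rV[R]_d -> 'rV[R]_d) : Prop :=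
  (forall u, U u -> differentiable h u) /\
  {within U, continuous (fun u => 'J h u)}.

(* A closed manifold of class C^1 and dimension d: compact, Hausdorff, without
   boundary; it need not be connected.  Second countability follows from
   compactness.  [mbase x] is a preferred chart around x; it serves only to
   give the tangent space at x a concrete model (see [tangent]). *)
Record closed_manifold (R : realType) (d : nat) : Type := ClosedManifold {
  mcarrier :> topologicalType ;
  mcompact : compact [set: mcarrier] ;
  mhausdorff : hausdorff_space mcarrier ;
  mindex : Type ;
  mdom : mindex -> set mcarrier ;
  mchart : mindex -> mcarrier -> 'rV[R]_d ;
  mparam : mindex -> 'rV[R]_d -> mcarrier ;
  mbase : mcarrier -> mindex ;
  mdom_base : forall x, mdom (mbase x) x ;
  mdom_open : forall i, open (mdom i) ;
  mimg_open : forall i, open (mchart i @` mdom i) ;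
  mchartK : forall i x, mdom i x -> mparam i (mchart i x) = x ;
  mchart_continuous : forall i, {within mdom i, continuous (mchart i)} ;
  mparam_continuous : forall i,
    {within mchart i @` mdom i, continuous (mparam i)} ;
  mtransition_C1 : forall i j,
    C1_on (mchart i @` (mdom i `&` mdom j)) (mchart j \o mparam i) }.

Section Manifold.
Context {R : realType} {d : nat} {M : closed_manifold R d}.

(* T_xM, identified with R^d through the preferred chart at x. *)
Definition tangent (x : M) : vectType R := 'rV[R]_d.

(* The derivative T_xM -> T_{g x}M. *)
Definition tanmap (g : M -> M) (x : M) : 'Hom(tangent x, tangent (g x)) :=
  linfun ('d (mchart (mbase (g x)) \o g \o mparam (mbase x))
             (mchart (mbase x) x)).

(* The local trivialization of TM over mdom i defined by the chart i, and its
   inverse: [frame i x u] is the vector of T_xM with coordinates u in the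
   chart i, and [coords i x v] are the coordinates of v in that chart. *)
Definition frame (i : mindex M) (x : M) (u : 'rV[R]_d) : tangent x :=
  'd (mchart (mbase x) \o mparam i) (mchart i x) u.

Definition coords (i : mindex M) (x : M) (v : tangent x) : 'rV[R]_d :=
  'd (mchart i \o mparam (mbase x)) (mchart (mbase x) x) v.

Definition C1_map (g : M -> M) : Prop :=
  continuous g /\
  forall i j, C1_on (mchart i @` (mdom i `&` g @^-1` mdom j))
                    (mchart j \o g \o mparam i).

Definition continuous_section (A : set M) (s : forall x : M, tangent x) : Prop :=
  forall i, {within A `&` mdom i, continuous (fun x => coords i (s x))}.

Definition continuous_subbundle (A : set M)
    (E : forall x : M, {vspace tangent x}) : Prop :=
  forall x, A x -> exists (U : set M) (r : nat)
      (s : 'I_r -> forall y : M, tangent y),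
    [/\ open_nbhs x U,
        forall l, continuous_section (A `&` U) (s l) &
        forall y, (A `&` U) y -> basis_of (E y) [tuple s l y | l < r] ].

End Manifold.

Record diffeomorphism (R : realType) (d : nat) (M : closed_manifold R d) : Type :=
  Diffeomorphism {
    dfun :> M -> M ;
    dinv : M -> M ;
    dfunK : cancel dfun dinv ;
    dinvK : cancel dinv dfun ;
    dfun_C1 : C1_map dfun ;
    dinv_C1 : C1_map dinv }.

Record continuous_inner_product (R : realType) (d : nat)
    (M : closed_manifold R d) : Type :=
  ContinuousInnerProduct {
    ip : forall x : M, tangent x -> tangent x -> R ;
    ip_linear : forall x a (u v w : tangent x),
      ip (a *: u + v) w = a * ip u w + ip v w ;
    ip_sym : forall x (u v : tangent x), ip u v = ip v u ;
    ip_pos : forall x (v : tangent x), v != 0 -> 0 < ip v v ;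
    ip_continuous : forall (i : mindex M) (u v : 'rV[R]_d),
      {within mdom i, continuous (fun x => ip (frame i x u) (frame i x v))} }.

Section Dynamics.
Context {R : realType} {d : nat} {M : closed_manifold R d}.
Variable g : continuous_inner_product M.
Variable f : diffeomorphism M.
Variable Lam : set M.

Definition tnorm (x : M) (v : tangent x) : R := Num.sqrt (ip g v v).

Definition opnorm (x y : M) (T : 'Hom(tangent x, tangent y)) : R :=
  sup [set r | exists2 v : tangent x, tnorm v <= 1 & r = tnorm (T v)].

Definition diter (n : int) : M -> M :=
  match n with
  | Posz m => iter m f
  | Negz m => iter m.+1 (dinv f)
  end.

(* Oblique projection of T_xM onto E i x along the sum of the other E j x. *)
Definition oblique_proj (k : nat) (E : 'I_k -> forall x : M, {vspace tangent x})
    (i : 'I_k) (x : M) : 'End(tangent x) :=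
  daddv_pi (E i x) (\sum_(j < k | j != i) E j x)%VS.

Definition invariant_splitting (k : nat)
    (E : 'I_k -> forall x : M, {vspace tangent x}) : Prop :=
  forall x, Lam x ->
    [/\ directv (\sum_(i < k) E i x)%VS,
        (\sum_(i < k) E i x)%VS = fullv &
        forall i, (tanmap f x @: E i x)%VS = E i (f x) ].

Definition dominated_splitting (k : nat)
    (E : 'I_k -> forall x : M, {vspace tangent x}) : Prop :=
  invariant_splitting E /\
  exists C alpha : R, [/\ 1 < C, 0 < alpha &
    forall (i j : 'I_k), (i < j)%N ->
    forall x, Lam x -> forall (u v : tangent x) (n : int) (m : nat),
      let D (h : int) (w : tangent x) := tnorm (tanmap (diter h) x w) in
      let Pu := oblique_proj E i x u in
      let Pv := oblique_proj E j x v in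
      D n Pu * D (n + m%:Z) Pv != 0 ->
      (D (n + m%:Z) Pu * D n Pv) / (D n Pu * D (n + m%:Z) Pv)
        <= C * expR (- (m%:R * alpha)) ].

Definition dominated_of_type (k : nat) (ns : 'I_k -> nat)
    (E : 'I_k -> forall x : M, {vspace tangent x}) : Prop :=
  dominated_splitting E /\
  forall x, Lam x -> forall i, \dim (E i x) = ns i.

(* Functions on Lam are represented by functions on M, of which only the
   restriction to Lam matters. *)
Definition summably_separated (k : nat) (q : 'I_k -> M -> R) : Prop :=
  (forall i, {within Lam, continuous (q i)}) /\
  exists beta gamma : R, [/\ 0 <= beta, 0 < gamma &
    forall (i j : 'I_k), j = i.+1 :> nat ->
    forall n m : nat, (1 <= m)%N -> forall x, Lam x ->
      - beta + gamma * m%:R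
        <= \sum_(n <= l < n + m) (q j (iter l f x) - q i (iter l f x)) ].

Section Cocycle.
Variable p : M -> R.

Definition cocycle (x : M) : 'Hom(tangent x, tangent (f x)) :=
  p x *: tanmap f x.

Fixpoint cocycle_iter (n : nat) (x : M) : 'Hom(tangent x, tangent (iter n f x)) :=
  match n with
  | 0 => \1%VF
  | m.+1 => (cocycle (iter m f x) \o cocycle_iter m x)%VF
  end.

(* [(cocycle_iter n x)^-1] is A^{-n}(f^n(x)). *)
Definition hyperbolicity (Es Eu : forall x : M, {vspace tangent x}) : Prop :=
  let Q (x : M) : 'End(tangent x) := daddv_pi (Es x) (Eu x) in
  [/\ continuous_subbundle Lam Es,
      continuous_subbundle Lam Eu,
      forall x, Lam x ->
        directv (Es x + Eu x)%VS /\ (Es x + Eu x)%VS = fullv,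
      forall x, Lam x ->
        (cocycle x @: Es x)%VS = Es (f x) /\
        (cocycle x @: Eu x)%VS = Eu (f x) &
      exists C alpha : R, [/\ 1 < C, 0 < alpha &
        forall (n : nat), (1 <= n)%N -> forall x, Lam x ->
          opnorm (cocycle_iter n x \o Q x)%VF
            <= C * expR (- (n%:R * alpha)) /\
          opnorm ((\1 - Q x) \o (cocycle_iter n x)^-1)%VF
            <= C * expR (- (n%:R * alpha)) ] ].

End Cocycle.
End Dynamics.

(* Main.v *)
Require Import Defs.
From HB Require Import structures.
From mathcomp Require Import all_boot all_order all_algebra.
From mathcomp Require Import all_classical all_reals all_analysis.
From mathcomp Require Import ring lra zify.

(* Backwards: p_i is dominated by p_(i-1) along orbits up to a constant, so vectors whose
   forward (p_i Df)-orbit stays bounded have the same property for p_(i+1), and dually in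
   the past; hence the stable spaces increase and the unstable spaces decrease with i.
   The summands E_i = Es_i cap Eu_(i-1) are dominated because in the quotient of the
   growths of a vector of Es_i and a vector of Eu_i the factors p_i cancel.

   Forwards: write X_i for the sum of the first i summands and Y_i for the sum of the
   others.  Domination bounds the angles, hence passes to the pair (X_i, Y_i); comparing
   Df^m at nearby points, for large m, then shows that X_i and Y_i are continuous.  The
   function p_i is, up to a small factor e^(- i e) that forces separation, the N-th root
   of e^(- N alpha / 2) / ||Df^N restricted to X_i||, so that p_i^N Df^N contracts X_i and
   expands Y_i in N steps.  Passing from N steps to one costs only a constant, because
   the product of N consecutive norms along an orbit telescopes. *)

Set Implicit Arguments.
Unset Strict Implicit.
Unset Printing Implicit Defensive.

Import Order.TTheory GRing.Theory Num.Theory.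
Import numFieldNormedType.Exports.

Local Open Scope classical_set_scope.
Local Open Scope ring_scope.

(** * Derivatives in charts *)

(** The preferred charts behind the tangent spaces may jump from point to point, so coordinates of
    vectors over nearby points cannot be compared directly. Nearby fibres are identified by the
    derivative of a change of charts ([transport]), which almost preserves norms near its base
    point, and a bundle map is continuous when it almost commutes with transport. The estimates
    themselves then live on one vector space with a family of norms.

    Domination does not include continuity of the summands, whereas hyperbolicity demands it. The
    argument for X_i rests on domination in positive time; Y_i is treated by the same argument for
    the inverse of f, for which the two bundles exchange their roles.

    Domination carries a constant, so one step of Df may fail to separate X_i from Y_i. The number N
    is taken so large that N alpha outweighs the logarithms of the constants of domination and of
    the angles; the N-th root in p_i then makes these constants negligible in each step. *)

Lemma near_eq_diff (R : numFieldType) (V W : normedModType R) (h k : V -> W)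
    (x : V) : (\forall y \near x, h y = k y) -> differentiable h x ->
  differentiable k x /\ 'd h x = 'd k x :> (V -> W).
Proof.
move=> hk dh.
have hk0 : \forall y \near (0 : V), h (y + x) = k (y + x).
  have := hk; rewrite (near_shift 0 x) subr0.
  by apply: filterS => y /=.
have hkx : h x = k x := nbhs_singleton hk.
suff E : k \o shift x = cst (k x) + 'd h x +o_ 0 id.
  have E' := diff_unique (diff_continuous dh) E.
  split; last by rewrite E'.
  by apply/diff_locallyP; rewrite E'; split => //; exact: diff_continuous.
have /diff_locally /eqaddoP E := dh.
apply/eqaddoP => e e0; have := E e e0.
apply: filterS2 hk0 => y /=.
by rewrite !fctE /= hkx => ->.
Qed.

Section ChartDerivatives.
Context {R : realType} {d : nat} {M : closed_manifold R d}.
Implicit Types (x : M) (i j : mindex M).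

(** Weaker than [C1_map], but enough for the chain rule. Iterates are handled in this class; the
    continuity of their derivatives is obtained separately, by composing continuous bundle maps. *)
Definition differentiable_map (phi : M -> M) : Prop :=
  continuous phi /\
  forall i j u, (mchart i @` (mdom i `&` phi @^-1` mdom j)) u ->
    differentiable (mchart j \o phi \o mparam i) u.

Definition chart_diff (phi : M -> M) i j x : 'rV[R]_d -> 'rV[R]_d :=
  'd (mchart j \o phi \o mparam i) (mchart i x).

Lemma mparam_cvg i x : mdom i x -> mparam i u @[u --> mchart i x] --> x.
Proof.
move=> ix; rewrite -[X in _ --> X](mchartK ix).
have := @mparam_continuous _ _ M i; rewrite continuous_open_subspace; last first.
  exact: mimg_open.
by move=> /(_ (mchart i x)); apply; rewrite inE; exists x.
Qed.

Lemma mchart_cvg i x : mdom i x -> mchart i y @[y --> x] --> mchart i x.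
Proof.
move=> ix; have := @mchart_continuous _ _ M i.
rewrite continuous_open_subspace; last exact: mdom_open.
by move=> /(_ x); apply; rewrite inE.
Qed.

Lemma near_mdom i x : mdom i x -> \forall y \near x, mdom i y.
Proof. by move=> ix; apply: open_nbhs_nbhs; split => //; exact: mdom_open. Qed.

(** The intermediate chart [j] is arbitrary. With [phi] or [psi] equal to [id], the chain rule
    becomes the transformation law of derivatives under a change of charts. *)
Lemma chart_diff_comp (phi psi : M -> M) i j l x :
  differentiable_map phi -> differentiable_map psi ->
  mdom i x -> mdom j (phi x) -> mdom l (psi (phi x)) ->
  differentiable (mchart l \o (psi \o phi) \o mparam i) (mchart i x) /\
  chart_diff (psi \o phi) i l x =
  chart_diff psi j l (phi x) \o chart_diff phi i j x.
Proof.
move=> [cphi dphi] [cpsi dpsi] ix jx lx.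
have dp : differentiable (mchart j \o phi \o mparam i) (mchart i x).
  by apply: dphi; exists x.
have E : (mchart j \o phi \o mparam i) (mchart i x) = mchart j (phi x).
  by rewrite /= mchartK.
have dq : differentiable (mchart l \o psi \o mparam j)
    ((mchart j \o phi \o mparam i) (mchart i x)).
  by rewrite E; apply: dpsi; exists (phi x).
(* The two expressions agree only where the intermediate chart is defined, hence near the point. *)
have nE : \forall u \near mchart i x,
    ((mchart l \o psi \o mparam j) \o (mchart j \o phi \o mparam i)) u =
    (mchart l \o (psi \o phi) \o mparam i) u.
  have : \forall u \near mchart i x, mdom j (phi (mparam i u)).
    have := cvg_comp _ _ (mparam_cvg ix) (cphi x).
    by move=> /(_ _ (near_mdom jx)).
  by apply: filterS => u /= ju; rewrite mchartK.
have [d1 d2] := near_eq_diff nE (differentiable_comp dp dq).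
split; first exact: d1.
have dE := diff_comp dp dq; rewrite E in dE.
exact: etrans (esym d2) dE.
Qed.

Lemma differentiable_map_comp (phi psi : M -> M) :
  differentiable_map phi -> differentiable_map psi ->
  differentiable_map (psi \o phi).
Proof.
move=> dphi dpsi; split.
  by move=> x; apply: continuous_comp; [exact: dphi.1|exact: dpsi.1].
move=> i l _ [x [ix lx]] <-.
by have [] := chart_diff_comp dphi dpsi ix (mdom_base (phi x)) lx.
Qed.

Lemma C1_differentiable_map (phi : M -> M) : C1_map phi -> differentiable_map phi.
Proof. by move=> [c1 c2]; split => // i j u; have [h _] := c2 i j; exact: h. Qed.

Lemma C1_map_id : C1_map (@id M).
Proof.
split; first by move=> x; exact: cvg_id.
by move=> i j; have := @mtransition_C1 _ _ M i j.
Qed.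

Lemma chart_diff_id i x : mdom i x -> chart_diff id i i x = id.
Proof.
move=> ix; rewrite /chart_diff.
have nE : \forall u \near mchart i x, id u = (mchart i \o id \o mparam i) u.
  have : \forall u \near mchart i x, (mchart i @` mdom i) u.
    by apply: open_nbhs_nbhs; split; [exact: mimg_open|exists x].
  by apply: filterS => _ [y iy <-] /=; rewrite mchartK.
have did : differentiable (@id 'rV[R]_d) (mchart i x) by apply: ex_diff.
have [_ dE] := near_eq_diff nE did.
have d2 : 'd (@id 'rV[R]_d) (mchart i x) = @id 'rV[R]_d :> (_ -> _).
  exact: diff_val.
exact: etrans (esym dE) d2.
Qed.

End ChartDerivatives.

(** * Inner products and coordinates *)

Section InnerProduct.
Context {R : realType} {d : nat}.
Variable B : 'rV[R]_d -> 'rV[R]_d -> R.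
Hypothesis B_linear : forall a (u v w : 'rV[R]_d), B (a *: u + v) w = a * B u w + B v w.
Hypothesis B_sym : forall u v : 'rV[R]_d, B u v = B v u.
Hypothesis B_pos : forall v : 'rV[R]_d, v != 0 -> 0 < B v v.

Let N v := Num.sqrt (B v v).

Lemma innerD u v w : B (u + v) w = B u w + B v w.
Proof. by rewrite -[u]scale1r B_linear mul1r scale1r. Qed.

Lemma inner0 w : B 0 w = 0.
Proof. by have := innerD 0 0 w; rewrite addr0 => /eqP; rewrite addrC -subr_eq subrr => /eqP <-. Qed.

Lemma innerZ a u w : B (a *: u) w = a * B u w.
Proof. by rewrite -[a *: u]addr0 B_linear inner0 addr0. Qed.

Lemma innerDr u v w : B w (u + v) = B w u + B w v.
Proof. by rewrite !(B_sym w) innerD. Qed.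

Lemma innerZr a u w : B w (a *: u) = a * B w u.
Proof. by rewrite !(B_sym w) innerZ. Qed.

Lemma inner_ge0 v : 0 <= B v v.
Proof. by have [->|/B_pos/ltW//] := eqVneq v 0; rewrite inner0. Qed.

Lemma inner_norm_sqr v : N v ^+ 2 = B v v.
Proof. by rewrite sqr_sqrtr// inner_ge0. Qed.

Lemma inner_norm_ge0 v : 0 <= N v. Proof. exact: sqrtr_ge0. Qed.

Lemma inner_normZ a v : N (a *: v) = `|a| * N v.
Proof. by rewrite /N innerZ innerZr mulrA -expr2 sqrtrM ?sqr_ge0// sqrtr_sqr. Qed.

Lemma inner_norm_eq0 v : N v = 0 -> v = 0.
Proof.
move=> /eqP; rewrite sqrtr_eq0 => Bv; apply/eqP.
by apply: contraT => /B_pos; rewrite ltNge Bv.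
Qed.

Lemma cauchy_schwarz u v : B u v <= N u * N v.
Proof.
have [->|v0] := eqVneq v 0; first by rewrite B_sym inner0 mulr_ge0 ?inner_norm_ge0.
have Bv := B_pos v0; have Nv : 0 < N v by rewrite sqrtr_gt0.
have := inner_ge0 (u + (- (B u v / B v v)) *: v).
rewrite innerD !innerDr !innerZ !innerZr (B_sym v u).
set c := B u v / B v v; have -> : B u v = c * B v v by rewrite divfK// gt_eqF.
rewrite -!inner_norm_sqr => H.
have H2 : (c * N v) ^+ 2 <= (N u) ^+ 2 by nra.
have : `|c * N v| <= N u.
  by rewrite -(ger0_norm (inner_norm_ge0 u)) -ler_sqr ?nnegrE// !real_normK ?num_real.
move=> /(le_trans (ler_norm _)) H3; nra.
Qed.

Lemma inner_normD u v : N (u + v) <= N u + N v.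
Proof.
rewrite -ler_sqr ?nnegrE ?addr_ge0 ?inner_norm_ge0//.
rewrite sqrrD !inner_norm_sqr innerD !innerDr (B_sym v u).
have := cauchy_schwarz u v; lra.
Qed.

Lemma inner_norm_sum I (r : seq I) (F : I -> 'rV[R]_d) :
  N (\sum_(i <- r) F i) <= \sum_(i <- r) N (F i).
Proof.
elim/big_ind2 : _ => //; first by rewrite /N inner0 sqrtr0.
by move=> u a v b ua vb; apply: le_trans (inner_normD _ _) _; exact: lerD.
Qed.

Lemma inner_norm_le_coord : exists2 c, 0 < c &
  forall v : 'rV[R]_d, N v <= c * \sum_k `|v 0 k|.
Proof.
exists (1 + \sum_k N (delta_mx 0 k)).
  by rewrite ltr_wpDr// sumr_ge0// => k _; exact: inner_norm_ge0.
move=> v; rewrite [v in N v]row_sum_delta.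
apply: le_trans (inner_norm_sum _ _) _; rewrite mulr_sumr; apply: ler_sum => k _.
rewrite inner_normZ mulrC ler_wpM2r//.
rewrite (bigD1 k)//= addrCA lerDl addr_ge0// sumr_ge0// => *; exact: inner_norm_ge0.
Qed.

(* The coordinates are recovered from the Gram matrix G of the standard basis:
   v = w G^-1, where w_k = B v e_k is bounded by Cauchy-Schwarz. *)
Lemma coord_le_inner_norm : exists2 c, 0 < c &
  forall (v : 'rV[R]_d) k, `|v 0 k| <= c * N v.
Proof.
pose e k : 'rV[R]_d := delta_mx 0 k.
pose G := \matrix_(a, b) B (e a) (e b).
have vG (v : 'rV_d) b : (v *m G) 0 b = B v (e b).
  rewrite mxE {2}[v]row_sum_delta.
  rewrite (big_morph (fun u => B u (e b)) (fun x y => innerD x y _) (inner0 _)).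
  by apply: eq_bigr => a _; rewrite innerZ mxE.
(* A row killed by G is orthogonal to every basis vector, hence to itself. *)
have Gunit : G \in unitmx.
  rewrite -row_free_unit; apply/inj_row_free => v vG0; apply/eqP.
  apply: contraT => /B_pos; rewrite {2}[v]row_sum_delta.
  rewrite (big_morph (B v) (fun x y => innerDr x y _) (_ : B v 0 = 0)); last first.
    by rewrite B_sym inner0.
  by rewrite big1 ?ltxx// => k _; rewrite innerZr -vG vG0 mxE mulr0.
exists (1 + \sum_k \sum_j (N (e j) * `|invmx G j k|)).
  by rewrite ltr_wpDr// !sumr_ge0// => k _; rewrite sumr_ge0// => j _;
    rewrite mulr_ge0 ?inner_norm_ge0.
move=> v k; rewrite -{1}(mulmxK Gunit v) mxE.
apply: le_trans (ler_norm_sum _ _ _) _.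
have Nj j : `|B v (e j)| <= N (e j) * N v.
  have := cauchy_schwarz (e j) v; have := cauchy_schwarz (e j) (-1 *: v).
  rewrite innerZr inner_normZ normrN normr1 !mul1r B_sym => h1 h2.
  by rewrite ler_norml; lra.
have L : \sum_j `|(v *m G) 0 j * invmx G j k| <= \sum_j (N (e j) * `|invmx G j k|) * N v.
  apply: ler_sum => j _; rewrite normrM vG mulrAC ler_wpM2r//.
apply: le_trans L _; rewrite -mulr_suml ler_wpM2r ?inner_norm_ge0//.
rewrite [leRHS]addrC [X in _ <= X + _](bigD1 k)//= -addrA lerDl addr_ge0// sumr_ge0// => i _.
by rewrite sumr_ge0// => j _; rewrite mulr_ge0 ?inner_norm_ge0.
Qed.

Lemma inner_sum_delta u v :
  B u v = \sum_a \sum_b u 0 a * v 0 b * B (delta_mx 0 a) (delta_mx 0 b).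
Proof.
rewrite {1}[u]row_sum_delta.
rewrite (big_morph (fun u => B u v) (fun x y => innerD x y _) (inner0 _)).
apply: eq_bigr => a _; rewrite innerZ {1}[v]row_sum_delta.
rewrite (big_morph (B _) (fun x y => innerDr x y _) (_ : B _ 0 = 0)); last first.
  by rewrite B_sym inner0.
by rewrite mulr_sumr; apply: eq_bigr => b _; rewrite innerZr mulrA.
Qed.

End InnerProduct.

(** The difference of the squared norms is a sum of d^2 terms, each at most [dl] times the square of
    [c * n0]; factoring it as (n - n0)(n + n0) and using n + n0 >= n0 gives a relative error,
    uniform in the vector. *)
Lemma inner_norm_near (R : realType) (d : nat)
    (B0 : 'rV[R]_d -> 'rV[R]_d -> R)
    (B0_linear : forall a (u v w : 'rV[R]_d),
       B0 (a *: u + v) w = a * B0 u w + B0 v w)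
    (B0_sym : forall u v : 'rV[R]_d, B0 u v = B0 v u)
    (B0_pos : forall v : 'rV[R]_d, v != 0 -> 0 < B0 v v) (e : R) : 0 < e ->
  exists2 dl, 0 < dl & forall B : 'rV[R]_d -> 'rV[R]_d -> R,
    (forall a (u v w : 'rV[R]_d), B (a *: u + v) w = a * B u w + B v w) ->
    (forall u v : 'rV[R]_d, B u v = B v u) ->
    (forall v : 'rV[R]_d, v != 0 -> 0 < B v v) ->
    (forall a b, `|B (delta_mx 0 a) (delta_mx 0 b) -
                   B0 (delta_mx 0 a) (delta_mx 0 b)| <= dl) ->
    forall u, `|Num.sqrt (B u u) - Num.sqrt (B0 u u)| <= e * Num.sqrt (B0 u u).
Proof.
move=> e0; have [c c0 cN] := coord_le_inner_norm B0_linear B0_sym B0_pos.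
(* The [+ 1] keeps the denominator positive when d = 0. *)
have dd0 : 0 < (d%:R * d%:R + 1 : R) by rewrite ltr_wpDl// mulr_ge0.
exists (e / (c ^+ 2 * (d%:R * d%:R + 1))).
  by rewrite divr_gt0// mulr_gt0// exprn_gt0.
set dl := e / _ => B B_linear B_sym B_pos H u.
set n := Num.sqrt (B u u); set n0 := Num.sqrt (B0 u u).
have n_ge0 : 0 <= n := sqrtr_ge0 _.
have n0_ge0 : 0 <= n0 := sqrtr_ge0 _.
have nE : n ^+ 2 = B u u := inner_norm_sqr B_linear B_sym B_pos u.
have n0E : n0 ^+ 2 = B0 u u := inner_norm_sqr B0_linear B0_sym B0_pos u.
have D : `|n ^+ 2 - n0 ^+ 2| <= e * n0 ^+ 2.
  rewrite nE (inner_sum_delta B_linear B_sym u u).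
  rewrite {1}n0E (inner_sum_delta B0_linear B0_sym u u) -sumrB.
  apply: le_trans (ler_norm_sum _ _ _) _.
  apply: (@le_trans _ _ (\sum_(a < d) \sum_(b < d) (c * n0) ^+ 2 * dl)).
    apply: ler_sum => a _; rewrite -sumrB; apply: le_trans (ler_norm_sum _ _ _) _.
    apply: ler_sum => b _; rewrite -mulrBr !normrM expr2.
    apply: ler_pM => //.
    by apply: ler_pM => //; exact: cN.
  rewrite !sumr_const !card_ord -mulrnA -mulr_natr natrM exprMn /dl.
  have -> : c ^+ 2 * n0 ^+ 2 * (e / (c ^+ 2 * (d%:R * d%:R + 1))) * (d%:R * d%:R) =
    e * n0 ^+ 2 * ((d%:R * d%:R) / (d%:R * d%:R + 1)).
    by field; rewrite !gt_eqF.
  apply: ler_piMr; first by rewrite mulr_ge0 ?sqr_ge0// ltW.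
  by rewrite ler_pdivrMr// mul1r lerDl.
have [n00|n00] := eqVneq n0 0.
  have n2 : n ^+ 2 = 0.
    by move: D; rewrite n00 expr0n mulr0 subr0 normr_le0 => /eqP.
  by move/eqP: n2; rewrite expf_eq0/= => /eqP ->; rewrite n00 subrr normr0 mulr0.
have n0_gt0 : 0 < n0 by rewrite lt_def n00.
rewrite -(ler_pM2r n0_gt0) -[leRHS]mulrA -expr2; apply: le_trans D.
by rewrite subr_sqr normrM ler_wpM2l// ger0_norm ?addr_ge0// lerDr.
Qed.

Lemma cvg_sumr (R : realType) (T I : Type) (F : set_system T) (FF : Filter F)
    (r : seq I) (h : I -> T -> R) (l : I -> R) :
  (forall a, h a t @[t --> F] --> l a) ->
  \sum_(a <- r) h a t @[t --> F] --> \sum_(a <- r) l a.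
Proof.
move=> hl; elim: r => [|a r IH].
  rewrite big_nil (_ : (fun t => _) = fun=> 0); first exact: cvg_cst.
  by apply/funext => t; rewrite big_nil.
rewrite big_cons.
rewrite (_ : (fun t => _) = fun t => h a t + \sum_(b <- r) h b t).
  exact: cvgD.
by apply/funext => t; rewrite big_cons.
Qed.

(** * The metric and the transport between nearby tangent spaces *)

Section Metric.
Context {R : realType} {d : nat} {M : closed_manifold R d}.
Variable g : continuous_inner_product M.
Implicit Types (x : M) (i j : mindex M) (u v w : 'rV[R]_d).

Local Notation nrm x := (@tnorm R d M g x).

Lemma tnorm_ge0 x v : 0 <= nrm x v. Proof. exact: sqrtr_ge0. Qed.

Lemma tnormZ x a v : nrm x (a *: v) = `|a| * nrm x v.
Proof. exact: (@inner_normZ _ _ (@ip _ _ _ g x) (@ip_linear _ _ _ g x) (@ip_sym _ _ _ g x)). Qed.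

Lemma tnormD x u v : nrm x (u + v) <= nrm x u + nrm x v.
Proof.
exact: (@inner_normD _ _ (@ip _ _ _ g x) (@ip_linear _ _ _ g x)
  (@ip_sym _ _ _ g x) (@ip_pos _ _ _ g x)).
Qed.

Lemma tnorm_eq0 x v : nrm x v = 0 -> v = 0.
Proof. exact: (@inner_norm_eq0 _ _ (@ip _ _ _ g x) (@ip_pos _ _ _ g x)). Qed.

Lemma frame_linear i x : linear (@frame _ _ M i x).
Proof. by move=> a u v; exact: (linearP ('d (mchart (mbase x) \o mparam i) (mchart i x))). Qed.

Lemma coords_linear i x : linear (@coords _ _ M i x).
Proof. by move=> a u v; exact: (linearP ('d (mchart i \o mparam (mbase x)) (mchart (mbase x) x))). Qed.

(** By the chain rule for [id], the composite is the derivative of the identity read in a single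
    chart. *)
Lemma frameK i x : mdom i x -> cancel (@frame _ _ M i x) (@coords _ _ M i x).
Proof.
move=> ix u.
have := (chart_diff_comp (C1_differentiable_map C1_map_id)
  (C1_differentiable_map C1_map_id) ix (mdom_base x) ix).2.
move=> /(congr1 (fun h => h u)) => e; apply: etrans (esym e) _.
by apply: (congr1 (fun h => h u) (chart_diff_id ix)).
Qed.

Lemma coordsK i x : mdom i x -> cancel (@coords _ _ M i x) (@frame _ _ M i x).
Proof.
move=> ix u.
have := (chart_diff_comp (C1_differentiable_map C1_map_id)
  (C1_differentiable_map C1_map_id) (mdom_base x) ix (mdom_base x)).2.
move=> /(congr1 (fun h => h u)) => e; apply: etrans (esym e) _.
by apply: (congr1 (fun h => h u) (chart_diff_id (mdom_base x))).
Qed.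

Lemma frame_base x u : @frame _ _ M (mbase x) x u = u.
Proof. by apply: (congr1 (fun h => h u) (chart_diff_id (mdom_base x))). Qed.

Definition frame_inner i x u v := ip g (frame i x u) (frame i x v).

Lemma frame_inner_linear i x a u v w :
  frame_inner i x (a *: u + v) w = a * frame_inner i x u w + frame_inner i x v w.
Proof. by rewrite /frame_inner frame_linear; exact: ip_linear. Qed.

Lemma frame_inner_sym i x u v : frame_inner i x u v = frame_inner i x v u.
Proof. exact: ip_sym. Qed.

Lemma frame_inner_pos i x v : mdom i x -> v != 0 -> 0 < frame_inner i x v v.
Proof.
move=> ix v0; apply: ip_pos; apply: contra v0 => /eqP fv0.
apply/eqP; rewrite -[v](frameK ix) fv0.
have := @coords_linear i x (-1) 0 0.
rewrite scaler0 addr0 scaleN1r addNr => h; exact: h.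
Qed.

(** Continuity of the metric is given for fixed coordinate vectors only; the finitely many Gram
    entries in the chart [i] upgrade it to an estimate uniform in [u]. *)
Lemma frame_tnorm_near i x0 (e : R) : mdom i x0 -> 0 < e ->
  \forall x \near x0, forall u, `|nrm x (frame i x u) - nrm x0 (frame i x0 u)|
    <= e * nrm x0 (frame i x0 u).
Proof.
move=> ix e0.
have [dl dl0 H] := inner_norm_near (@frame_inner_linear i x0)
  (@frame_inner_sym i x0) (fun v => @frame_inner_pos i x0 v ix) e0.
have : \forall x \near x0, forall ab : 'I_d * 'I_d,
    `|frame_inner i x (delta_mx 0 ab.1) (delta_mx 0 ab.2) -
      frame_inner i x0 (delta_mx 0 ab.1) (delta_mx 0 ab.2)| <= dl.
  apply: filter_forall => -[a b] /=.
  have := @ip_continuous _ _ _ g i (delta_mx 0 a) (delta_mx 0 b).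
  rewrite continuous_open_subspace; last exact: mdom_open.
  move=> /(_ x0); rewrite inE => /(_ ix) /cvgrPdistC_le /(_ dl dl0).
  by move=> h; apply: filterS h => y h; exact: h.
apply: filterS2 (near_mdom ix) => x ixx Hx u.
exact: (H _ (@frame_inner_linear i x) (@frame_inner_sym i x)
  (fun v => @frame_inner_pos i x v ixx) (fun a b => Hx (a, b)) u).
Qed.

End Metric.

Lemma comp_subr_le (R : realType) (V W : vectType R) (n : W -> R)
    (T : 'Hom(V, W)) (A : W) (b b0 b0' : V) (c : R) :
  A = T b -> b0' = b0 -> n (T (b - b0)) <= c -> n (A - T b0') <= c.
Proof. by move=> -> ->; rewrite -linearB. Qed.

Lemma near_cvg (T : Type) (U : topologicalType) (F : set_system T)
    (phi : T -> U) (y : U) (P : U -> Prop) :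
  phi x @[x --> F] --> y -> (\forall z \near y, P z) ->
  \forall x \near F, P (phi x).
Proof. by move=> cphi yP; exact: (cphi _ yP). Qed.

Lemma rV_norm_le (R : realType) (d : nat) (v : 'rV[R]_d) (e : R) : 0 <= e ->
  (forall k, `|v 0 k| <= e) -> `|v| <= e.
Proof.
move=> e0 ve; rewrite -[`|v|]/(mx_norm v) mx_normrE; apply: bigmax_le => // -[a k] _.
by rewrite /= (ord1 a); exact: ve.
Qed.

Section Transport.
Context {R : realType} {d : nat} {M : closed_manifold R d}.
Variable g : continuous_inner_product M.
Implicit Types (x : M) (i j : mindex M) (u v w : 'rV[R]_d).

Local Notation nrm x := (@tnorm R d M g x).

Lemma chart_diff_linear phi i j x : linear (@chart_diff _ _ M phi i j x).
Proof.
by move=> a u v; exact: (linearP ('d (mchart j \o phi \o mparam i) (mchart i x))).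
Qed.

Lemma chart_diff_coord_cvg (phi : M -> M) i j x0 u k : C1_map phi ->
  mdom i x0 -> mdom j (phi x0) ->
  (chart_diff phi i j x u) 0 k @[x --> x0] --> (chart_diff phi i j x0 u) 0 k.
Proof.
move=> [cphi /(_ i j) [_ cJ]] ix jx.
set U := mchart i @` _ in cJ.
(* Openness turns continuity of the Jacobian within [U] into continuity at the point. *)
have oU : open U.
  rewrite openE => _ [x [ixx jxx] <-].
  have n1 : \forall p \near mchart i x, (mchart i @` mdom i) p.
    by apply: open_nbhs_nbhs; split; [exact: mimg_open|exists x].
  have n2 : \forall p \near mchart i x, mdom j (phi (mparam i p)).
    by have := cvg_comp _ _ (mparam_cvg ixx) (cphi x); move=> /(_ _ (near_mdom jxx)).
  apply: filterS2 n1 n2 => _ [y iy <-] jy.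
  by exists y => //; split => //; rewrite /= mchartK in jy.
have Ux : U (mchart i x0) by exists x0.
rewrite continuous_open_subspace// in cJ.
have {}cJ := cJ (mchart i x0) (mem_set Ux).
pose Jx x := 'J (mchart j \o phi \o mparam i) (mchart i x).
have cJx : Jx x @[x --> x0] --> Jx x0.
  exact: cvg_comp (mchart_cvg ix) cJ.
have E x : (chart_diff phi i j x u) 0 k = \sum_a u 0 a * Jx x a k.
  have -> : chart_diff phi i j x u = u *m Jx x by exact/esym/mul_rV_lin1.
  by rewrite mxE.
pose h x := (chart_diff phi i j x u) 0 k.
suff hh : h x @[x --> x0] --> h x0 by exact: hh.
have -> : h = fun x => \sum_a u 0 a * Jx x a k by apply/funext => x; exact: E.
apply: cvg_sumr => a; apply: cvgMr.
exact: (cvg_comp _ _ cJx (@coord_continuous _ _ _ a k (Jx x0))).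
Qed.

(** In finite dimension, convergence of the d^2 matrix entries is convergence in operator norm; [c]
    and [c'] compare the norms of the source and of the target with coordinates. *)
Lemma linear_family_near (T : Type) (F : set_system T) (FF : Filter F)
    (L : T -> 'rV[R]_d -> 'rV[R]_d) (L0 : 'rV[R]_d -> 'rV[R]_d) (x0 y0 : M) :
  (forall t, linear (L t)) -> linear L0 ->
  (forall a k, (L t (delta_mx 0 a)) 0 k @[t --> F] --> (L0 (delta_mx 0 a)) 0 k) ->
  forall e : R, 0 < e ->
  \forall t \near F, forall u, nrm y0 (L t u - L0 u) <= e * nrm x0 u.
Proof.
move=> Llin L0lin cL e e0.
have [c c0 cN] := coord_le_inner_norm (@ip_linear _ _ _ g x0)
  (@ip_sym _ _ _ g x0) (@ip_pos _ _ _ g x0).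
have [c' c'0 cN'] := inner_norm_le_coord (@ip_linear _ _ _ g y0)
  (@ip_sym _ _ _ g y0) (@ip_pos _ _ _ g y0).
have dd0 : 0 < (d%:R * d%:R + 1 : R) by rewrite ltr_wpDl// mulr_ge0.
pose dl := e / (c * c' * (d%:R * d%:R + 1)).
have dl0 : 0 < dl by rewrite divr_gt0// !mulr_gt0.
have : \forall t \near F, forall ak : 'I_d * 'I_d,
    `|(L t (delta_mx 0 ak.1)) 0 ak.2 - (L0 (delta_mx 0 ak.1)) 0 ak.2| <= dl.
  apply: filter_forall => -[a k] /=.
  by have /cvgrPdistC_le /(_ dl dl0) := cL a k.
apply: filterS => t H u.
have sumE (L' : 'rV[R]_d -> 'rV[R]_d) k : linear L' ->
    L' u 0 k = \sum_a u 0 a * L' (delta_mx 0 a) 0 k.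
  move=> lin'.
  pose L'' : {linear 'rV[R]_d -> 'rV[R]_d} :=
    HB.pack L' (GRing.isLinear.Build _ _ _ _ L' lin').
  rewrite -[L']/(L'' : _ -> _) {1}[u]row_sum_delta linear_sum summxE.
  by apply: eq_bigr => a _; rewrite linearZ mxE.
apply: le_trans (cN' _) _.
apply: (@le_trans _ _ (c' * \sum_(k < d) \sum_(a < d) (c * nrm x0 u) * dl)).
  rewrite ler_wpM2l ?(ltW c'0)//; apply: ler_sum => k _.
  rewrite !mxE (sumE (L t))// (sumE L0)// -sumrB.
  apply: le_trans (ler_norm_sum _ _ _) _; apply: ler_sum => a _.
  rewrite -mulrBr normrM; apply: ler_pM => //; exact: (H (a, k)).
rewrite !sumr_const !card_ord -mulrnA -mulr_natr natrM /dl.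
have -> : c' * (c * nrm x0 u * (e / (c * c' * (d%:R * d%:R + 1))) * (d%:R * d%:R))
  = e * nrm x0 u * ((d%:R * d%:R) / (d%:R * d%:R + 1)).
  by field; rewrite !gt_eqF.
apply: ler_piMr; first by rewrite mulr_ge0 ?tnorm_ge0// ltW.
by rewrite ler_pdivrMr// mul1r lerDl.
Qed.

(* The identification of nearby tangent spaces by the preferred chart at x0. *)
Definition transport (x0 x : M) : 'Hom(tangent x0, tangent x) :=
  linfun ('d (mchart (mbase x) \o mparam (mbase x0)) (mchart (mbase x0) x)).

Lemma transportE x0 x u : transport x0 x u = frame (mbase x0) x u.
Proof. exact: lfunE. Qed.

Lemma transport_tnorm_near x0 (e : R) : 0 < e -> \forall x \near x0, forall u,
  `|nrm x (transport x0 x u) - nrm x0 u| <= e * nrm x0 u.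
Proof.
move=> e0; apply: filterS (frame_tnorm_near g (mdom_base x0) e0) => x + u.
by move=> /(_ u); rewrite frame_base transportE.
Qed.

Lemma tanmapE phi x u : tanmap phi x u = chart_diff phi (mbase x) (mbase (phi x)) x u.
Proof. exact: lfunE. Qed.

Lemma tanmap_comp (phi psi : M -> M) x u :
  differentiable_map phi -> differentiable_map psi ->
  tanmap (psi \o phi) x u = tanmap psi (phi x) (tanmap phi x u).
Proof.
move=> dphi dpsi; apply: etrans (tanmapE _ _ _) _.
apply: etrans (congr1 (fun h => h u) (chart_diff_comp dphi dpsi (mdom_base x)
  (mdom_base _) (mdom_base _)).2) _.
apply: etrans (esym (tanmapE _ _ _)).
exact: congr1 (esym (tanmapE _ _ _)).
Qed.

Lemma tanmap_id x u : tanmap id x u = u.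
Proof.
rewrite tanmapE.
exact: (congr1 (fun h => h u) (chart_diff_id (mdom_base x))).
Qed.

Lemma coords_transport x0 x i u : mdom (mbase x0) x -> mdom i x ->
  coords i (transport x0 x u) = chart_diff id (mbase x0) i x u.
Proof.
move=> bx ix; apply: etrans (congr1 (@coords _ _ _ i x) (transportE x0 x u)) _.
apply: esym; exact: (congr1 (fun h => h u) (chart_diff_comp
  (C1_differentiable_map C1_map_id) (C1_differentiable_map C1_map_id) bx (mdom_base x) ix).2).
Qed.

Lemma coords_chart_diff x i u : coords i (u : tangent x) = chart_diff id (mbase x) i x u.
Proof. by []. Qed.

Local Opaque tanmap frame coords frame_inner chart_diff transport tnorm.

(** Read in the charts preferred at [x0] and [phi x0], both terms are transports of coordinate
    vectors, so their difference is the transport of a difference of derivatives taken in two fixed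
    charts. That difference is small because [phi] is C^1; transport at most doubles norms, whence
    [e / 2]. *)
Lemma transport_tanmap_near phi x0 (e : R) : C1_map phi -> 0 < e ->
  \forall x \near x0, forall u,
  nrm (phi x) (tanmap phi x (transport x0 x u) -
     transport (phi x0) (phi x) (tanmap phi x0 u)) <= e * nrm x0 u.
Proof.
move=> C1 e0; have dphi := C1_differentiable_map C1.
set i := mbase x0; set j := mbase (phi x0).
have nx : \forall x \near x0, mdom j (phi x).
  exact: (dphi.1 x0 _ (near_mdom (mdom_base (phi x0)))).
have nn : \forall x \near x0, forall w,
    `|nrm (phi x) (transport (phi x0) (phi x) w) - nrm (phi x0) w|
    <= 1 * nrm (phi x0) w.
  have one : 0 < (1 : R) by exact: ltr01.
  exact: near_cvg (dphi.1 x0) (transport_tnorm_near (phi x0) one).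
have e2 : 0 < e / 2 by rewrite divr_gt0.
have nl := @linear_family_near M (nbhs x0) _ (fun x => chart_diff phi i j x)
  (chart_diff phi i j x0) x0 (phi x0) (fun x => @chart_diff_linear phi i j x)
  (@chart_diff_linear phi i j x0) (fun a k =>
    @chart_diff_coord_cvg phi i j x0 (delta_mx 0 a) k C1 (mdom_base x0) (mdom_base _))
  _ e2.
have nd := near_mdom (mdom_base x0).
near=> x.
have H1 : forall u, nrm (phi x0) (chart_diff phi i j x u - chart_diff phi i j x0 u)
  <= e / 2 * nrm x0 u by near: x; exact: nl.
have H2 : forall w, `|nrm (phi x) (transport (phi x0) (phi x) w) - nrm (phi x0) w|
  <= 1 * nrm (phi x0) w by near: x; exact: nn.
move=> u.
have ix : mdom i x by near: x.
have jx : mdom j (phi x) by near: x.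
have E1 : tanmap phi x (transport x0 x u) =
    transport (phi x0) (phi x) (chart_diff phi i j x u).
  apply: etrans (tanmapE phi x _) _.
  apply: etrans (congr1 (chart_diff phi _ _ x) (transportE _ _ _)) _.
  apply: etrans _ (esym (transportE _ _ _)).
  apply: etrans (esym _) _; last first.
  - exact: (congr1 (fun h => h u) (chart_diff_comp dphi
      (C1_differentiable_map C1_map_id) ix jx (mdom_base (phi x))).2).
  - exact: (congr1 (fun h => h u) (chart_diff_comp
      (C1_differentiable_map C1_map_id) dphi ix (mdom_base x) (mdom_base (phi x))).2).
have E2 : tanmap phi x0 u = chart_diff phi i j x0 u by exact: tanmapE.
apply: (comp_subr_le E1 E2); set w := _ - _.
have h1 : nrm (phi x0) w <= e / 2 * nrm x0 u := H1 u.
have h2 := H2 w.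
move: h2; rewrite ler_norml => /andP[_]; lra.
Unshelve. all: by end_near. Qed.

(** In the chart [i] the variation of [s] splits into a change of charts applied to the fixed vector
    [s x0], continuous since transitions are C^1, and the coordinates of the transport defect,
    controlled by its norm. *)
Lemma continuous_section_transport (A : set M) (s : forall x : M, tangent x) :
  (forall x0, A x0 -> forall e : R, 0 < e ->
    \forall x \near within A (nbhs x0), nrm x (s x - transport x0 x (s x0)) <= e) ->
  continuous_section A s.
Proof.
move=> sA i; apply/subspace_continuousP => x0 [Ax0 ix0].
have [c c0 cN] := coord_le_inner_norm (@frame_inner_linear _ _ _ g i x0)
  (@frame_inner_sym _ _ _ g i x0) (fun v => @frame_inner_pos _ _ _ g i x0 v ix0).
have half0 : 0 < 2^-1 :> R by rewrite invr_gt0.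
have nn := frame_tnorm_near g ix0 half0.
pose b := mbase x0.
have nb := near_mdom (mdom_base x0).
have ni := near_mdom ix0.
have nc : forall e : R, 0 < e -> \forall x \near x0, forall k,
    `|chart_diff id b i x (s x0) 0 k - chart_diff id b i x0 (s x0) 0 k| <= e.
  move=> e e0; apply: filter_forall => k.
  have := @chart_diff_coord_cvg id b i x0 (s x0) k C1_map_id (mdom_base x0) ix0.
  by move=> /cvgrPdistC_le /(_ e e0).
apply/cvgrPdistC_le => e e0.
(* The constant [c] passes from the norm at [x0] to coordinates, one factor 2 from the norm at [x]
   to the norm at [x0], and the other shares [e] between the two terms. *)
have e4 : 0 < e / (4 * c) by rewrite divr_gt0// mulr_gt0.
have e2 : 0 < e / 2 by rewrite divr_gt0.
have nA := sA x0 Ax0 _ e4.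
have nce := nc _ e2.
have nA' : \forall x \near x0, A x -> nrm x (s x - transport x0 x (s x0)) <= e / (4 * c) by [].
near=> x.
have [Ax ix] : (A `&` mdom i) x by near: x; exact: withinT.
have bx : mdom b x by near: x; apply: cvg_within.
have H1 : forall k, `|chart_diff id b i x (s x0) 0 k -
    chart_diff id b i x0 (s x0) 0 k| <= e / 2 by near: x; apply: cvg_within.
have H2 : A x -> nrm x (s x - transport x0 x (s x0)) <= e / (4 * c).
  by near: x; apply: cvg_within.
have H3 : forall u, `|nrm x (frame i x u) - nrm x0 (frame i x0 u)|
    <= 2^-1 * nrm x0 (frame i x0 u) by near: x; apply: cvg_within.
have E0 : coords i (s x0) = chart_diff id b i x0 (s x0) by exact: coords_chart_diff.
have E1 : coords i (transport x0 x (s x0)) = chart_diff id b i x (s x0).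
  exact: coords_transport.
apply: rV_norm_le; first exact: ltW.
move=> k; set v := s x - transport x0 x (s x0) in H2.
have E2 : coords i (s x) = coords i (transport x0 x (s x0)) + coords i v.
  have h := @coords_linear _ _ M i x 1 (transport x0 x (s x0)) v.
  rewrite !scale1r in h; rewrite -h; congr (coords i _).
  by rewrite /v addrC subrK.
have H4 : `|coords i v 0 k| <= e / 2.
  apply: le_trans (cN _ _) _.
  have fv : frame i x (coords i v) = v by exact: coordsK.
  have := H3 (coords i v); rewrite fv.
  set n0 := nrm x0 _; set n := nrm x v in H2 *.
  have -> : Num.sqrt (frame_inner g i x0 (coords i v) (coords i v)) = n0 by [].
  have n0_ge0 : 0 <= n0 := tnorm_ge0 _ _ _.
  have H5 : n * (4 * c) <= e by rewrite -ler_pdivlMr ?mulr_gt0//; exact: H2.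
  rewrite ler_norml => /andP[h _]; nra.
apply: (le_trans (_ : _ <= `|chart_diff id b i x (s x0) 0 k -
    chart_diff id b i x0 (s x0) 0 k| + `|coords i v 0 k|)); last first.
  have := H1 k; lra.
apply: le_trans (ler_normD _ _).
have E3 : (coords i (s x) - coords i (s x0)) 0 k = chart_diff id b i x (s x0) 0 k -
    chart_diff id b i x0 (s x0) 0 k + coords i v 0 k.
  by rewrite E2 E1 E0 !mxE addrAC.
by rewrite -E3; exact: lexx.
Unshelve. all: by end_near. Qed.

End Transport.

(** * Dominated pairs of subspaces *)

Section Norms.
Context {R : realType} {V : vectType R}.

Definition is_norm (n : V -> R) : Prop :=
  [/\ forall v, 0 <= n v, forall a v, n (a *: v) = `|a| * n v,
      forall u v, n (u + v) <= n u + n v & forall v, n v = 0 -> v = 0].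

Variable n : V -> R.
Hypothesis n_norm : is_norm n.

Lemma norm_ge0 v : 0 <= n v. Proof. by case: n_norm. Qed.
Lemma normZ a v : n (a *: v) = `|a| * n v. Proof. by case: n_norm. Qed.
Lemma normD u v : n (u + v) <= n u + n v. Proof. by case: n_norm. Qed.
Lemma norm0 : n 0 = 0. Proof. by rewrite -(scale0r 0) normZ normr0 mul0r. Qed.

Lemma norm_eq0 v : (n v == 0) = (v == 0).
Proof. by apply/eqP/eqP => [|->]; [case: n_norm => _ _ _; exact|exact: norm0]. Qed.

Lemma norm_gt0 v : (0 < n v) = (v != 0).
Proof. by rewrite lt_def norm_eq0 norm_ge0 andbT. Qed.

Lemma normN v : n (- v) = n v.
Proof. by rewrite -scaleN1r normZ normrN normr1 mul1r. Qed.

Lemma normB u v : n (u - v) <= n u + n v.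
Proof. by rewrite -[n v]normN normD. Qed.

Lemma norm_subC u v : n (u - v) = n (v - u).
Proof. by rewrite -normN opprB. Qed.

Lemma norm_le_sub u v : n u <= n v + n (u - v).
Proof. by rewrite -{1}(subrK v u) addrC normD. Qed.

End Norms.

Lemma lker_eq0 (R : realType) (V : vectType R) (S : 'End(V)) :
  (forall v, S v = 0 -> v = 0) -> lker S == 0%VS.
Proof.
move=> S0; apply/lker0P => u v /eqP; rewrite -subr_eq0 -linearB => /eqP /S0 /eqP.
by rewrite subr_eq0 => /eqP.
Qed.

Lemma lfun_surj (R : realType) (V : vectType R) (S : 'End(V)) v :
  lker S == 0%VS -> exists u, v = S u.
Proof. by move=> S0; exists (S^-1%VF v); rewrite lker0_lfunVK. Qed.

Lemma capv_neq0 (R : realType) (V : vectType R) (A B : {vspace V}) :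
  (\dim (fullv : {vspace V}) < \dim A + \dim B)%N ->
  exists2 v, v != 0 & v \in A /\ v \in B.
Proof.
move=> AB; exists (vpick (A :&: B)); last by apply/andP; rewrite -memv_cap memv_pick.
rewrite vpick0; apply: contraTneq AB => AB0.
by rewrite -dimv_sum_cap AB0 dimv0 addn0 -leqNgt dimvS// subvf.
Qed.

(* A vector w of F0, seen at the nearby point, has a small component v along G.
   By dimension count some h in G0 lies in F + <v>, so that D expands h at most
   like v; comparing with w at the base point by domination bounds v. *)
Lemma dominated_component_le (R : realType) (V : vectType R)
    (n n' n0 n0' : V -> R) (tau D D0 : 'End(V)) (F G F0 G0 : {vspace V})
    (eta K : R) :
  is_norm n -> is_norm n' -> is_norm n0 -> is_norm n0' ->
  (forall w, n (tau w) <= 2 * n0 w) -> (forall w, n0 w <= 2 * n (tau w)) ->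
  (forall w, n' (D (tau w)) <= 2 * n0' (D0 w)) ->
  (forall w, n0' (D0 w) <= 2 * n' (D (tau w))) ->
  lker D == 0%VS -> 0 <= K -> 0 <= eta -> eta <= 1 ->
  (F :&: G = 0)%VS -> (\dim F + \dim G0 = \dim (fullv : {vspace V}))%N ->
  (forall u v, u \in F -> v \in G -> n' (D u) * n v <= eta * n u * n' (D v)) ->
  (forall u v, u \in F0 -> v \in G0 ->
    n0' (D0 u) * n0 v <= eta * n0 u * n0' (D0 v)) ->
  (forall u v, u \in F -> v \in G -> n u <= K * n (u + v) /\ n v <= K * n (u + v)) ->
  (forall u v, u \in F -> v \in G -> n' (D v) <= K * n' (D (u + v))) ->
  forall w u v, w \in F0 -> u \in F -> v \in G -> tau w = u + v ->
    n v <= 16 * K ^+ 2 * eta * n0 w.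
Proof.
move=> nN n'N n0N n0'N tau_le tau_ge Dtau_le Dtau_ge Dinj K0 eta0 eta1 FG dimFG
  dom dom0 angle angle' w u v wF uF vG wuv.
have [->|v0] := eqVneq v 0.
  by rewrite (norm0 nN) mulr_ge0 ?(norm_ge0 n0N)// mulr_ge0// mulr_ge0 ?sqr_ge0.
have tau0 : lker tau == 0%VS.
  apply: lker_eq0 => x tx0; apply/eqP; rewrite -(norm_eq0 n0N) eq_le (norm_ge0 n0N) andbT.
  by apply: le_trans (tau_ge x) _; rewrite tx0 (norm0 nN) mulr0.
have [x x0 [/memv_imgP[h hG xE] /memv_addP[u' u'F [z /vlineP[c zE] hE]]]] :
    exists2 x, x != 0 & x \in (tau @: G0)%VS /\ x \in (F + <[v]>)%VS.
  apply: capv_neq0; rewrite limg_dim_eq; last by move/eqP: tau0 => ->; rewrite capv0.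
  rewrite dimv_disjoint_sum; last first.
    by apply/eqP; rewrite -subv0 -FG capvS// -memvE.
  by rewrite dim_vline v0 addnA addn1 addnC -dimFG ltnS leqnn.
have h0 : h != 0 by apply: contraNneq x0 => h0; rewrite xE h0 linear0.
have nh : 0 < n0 h by rewrite norm_gt0.
have nv : 0 < n v by rewrite norm_gt0.
have na : 0 < n' (D v).
  rewrite norm_gt0//; apply: contra v0 => /eqP Dv0.
  by rewrite -(lker0_lfunK Dinj v) Dv0 linear0.
set a := n' (D v) in na.
have zG : z \in G by rewrite zE memvZ.
have thE : tau h = u' + z by rewrite -xE.
have [A1 A2] := angle u' z u'F zG; rewrite -thE zE (normZ nN) in A1 A2.
have A3 : n' (D u') * n v <= eta * n u' * a := dom u' v u'F vG.
have A4 : n' (D (tau h)) <= n' (D u') + `|c| * a.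
  by rewrite thE linearD; apply: le_trans (normD n'N _ _) _; rewrite zE linearZ (normZ n'N).
have A5 : a <= K * n' (D (tau w)) by rewrite wuv; exact: angle'.
have A6 := dom0 w h wF hG.
have A7 := Dtau_le w; have A8 := Dtau_ge h; have A9 := tau_le h.
have nth := norm_ge0 nN (tau h).
have nw := norm_ge0 n0N w.
have B1 : n' (D (tau h)) * n v <= 4 * K * n0 h * a.
  have : n' (D (tau h)) * n v <= (n' (D u') + `|c| * a) * n v by rewrite ler_pM2r.
  move/le_trans; apply.
  have e1 : eta * n u' * a <= K * n (tau h) * a.
    rewrite ler_pM2r//; apply: le_trans A1.
    by rewrite ler_piMl// (norm_ge0 nN).
  have e2 : `|c| * n v * a <= K * n (tau h) * a by rewrite ler_pM2r.
  have e3 : K * n (tau h) * a <= K * (2 * n0 h) * a.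
    by rewrite ler_pM2r// ler_wpM2l.
  by nra.
have B2 : a * n0 h <= 4 * K * eta * n0 w * n' (D (tau h)).
  have e1 : a * n0 h <= K * (2 * n0' (D0 w)) * n0 h.
    rewrite ler_pM2r//; apply: le_trans A5 _; by rewrite ler_wpM2l.
  have e2 : eta * n0 w * n0' (D0 h) <= eta * n0 w * (2 * n' (D (tau h))).
    by rewrite ler_wpM2l// mulr_ge0.
  have e3 : K * (n0' (D0 w) * n0 h) <= K * (eta * n0 w * (2 * n' (D (tau h)))).
    by rewrite ler_wpM2l//; apply: le_trans A6 _.
  by nra.
(* Inserting the first bound into the second cancels [n' (D (tau h))] and leaves the claim times the
   positive factor [a * n0 h]; 16 is the product of the two factors 4. *)
have B3 : a * n0 h * n v <= 4 * K * eta * n0 w * (4 * K * n0 h * a).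
  apply: (@le_trans _ _ (4 * K * eta * n0 w * n' (D (tau h)) * n v)).
    by rewrite ler_pM2r.
  by rewrite -mulrA ler_wpM2l// !mulr_ge0.
rewrite -(ler_pM2l (mulr_gt0 na nh)).
by apply: le_trans B3 _; rewrite le_eqVlt; apply/orP; left; apply/eqP; ring.
Qed.

Lemma exp_decay (R : realType) (C alpha e : R) : 0 < alpha -> 0 < e ->
  exists m : nat, forall m', (m <= m')%N -> C * expR (- (m'%:R * alpha)) <= e.
Proof.
move=> a0 e0; pose b := Num.max C 0 / (e * alpha).
have b0 : 0 <= b by rewrite divr_ge0 ?le_max ?lexx ?orbT// ltW// mulr_gt0.
exists (Num.trunc b).+1 => m' mm'.
have bm : b <= m'%:R.
  by apply: ltW; apply: lt_le_trans (truncnS_gt b) _; rewrite ler_nat.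
rewrite expRN; have E0 : 0 < expR (m'%:R * alpha) by exact: expR_gt0.
rewrite ler_pdivrMr//.
have E1 := expR_ge1Dx (m'%:R * alpha).
have : Num.max C 0 <= m'%:R * (e * alpha) by rewrite -ler_pdivrMr// mulr_gt0.
rewrite ge_max => /andP[CM _]; nra.
Qed.

Section Cocycle.
Context {R : realType} {T : Type} {V : vectType R}.

(** Only forward iterates appear, so the results apply to a diffeomorphism and to its inverse alike.
    The constant [L] bounds one step and the inverse of one step. *)
Definition bounded_cocycle (f : T -> T) (Lam : set T) (n : T -> V -> R)
    (D : nat -> T -> 'End(V)) (L : R) : Prop :=
  [/\ 1 <= L, forall x, Lam x -> Lam (f x), forall x v, D 0 x v = v,
      forall a b x v, D (a + b)%N x v = D a (iter b f x) (D b x v) &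
      forall x v, Lam x ->
        n (f x) (D 1 x v) <= L * n x v /\ n x v <= L * n (f x) (D 1 x v)].

Variables (f : T -> T) (Lam : set T) (n : T -> V -> R) (D : nat -> T -> 'End(V)).

Definition forward_invariant (X : T -> {vspace V}) : Prop :=
  forall x, Lam x -> forall m v, v \in X x -> D m x v \in X (iter m f x).

(** Clearing denominators lets zero vectors in, and the starting time is 0: for invariant bundles,
    another starting time is another base point on the orbit. *)
Definition dominated_pair (C alpha : R) (X Y : T -> {vspace V}) : Prop :=
  forall x, Lam x -> forall m u v, u \in X x -> v \in Y x ->
    n (iter m f x) (D m x u) * n x v <=
    C * expR (- (m%:R * alpha)) * n x u * n (iter m f x) (D m x v).

(** A uniform bound on both oblique projectors of X + Y, that is, angles between X and Y bounded
    away from 0. *)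
Definition angle_bounded (K : R) (X Y : T -> {vspace V}) : Prop :=
  forall x, Lam x -> forall u v, u \in X x -> v \in Y x ->
    n x u <= K * n x (u + v) /\ n x v <= K * n x (u + v).

Variable L : R.
Hypothesis n_norm : forall x, is_norm (n x).
Hypothesis D_cocycle : bounded_cocycle f Lam n D L.

Lemma Lam_iter x m : Lam x -> Lam (iter m f x).
Proof. by case: D_cocycle => _ fL _ _ _ Lx; elim: m => //= m; exact: fL. Qed.

Lemma cocycle_bound x m v : Lam x ->
  n (iter m f x) (D m x v) <= L ^+ m * n x v /\
  n x v <= L ^+ m * n (iter m f x) (D m x v).
Proof.
case: D_cocycle => L1 fL D0 Da DL Lx.
have L0 : 0 <= L by apply: le_trans L1.
elim: m => [|m [IH1 IH2]]; first by rewrite D0 expr0 !mul1r.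
rewrite -add1n Da add1n iterS; have [d1 d2] := DL _ (D m x v) (Lam_iter m Lx).
rewrite exprS; split.
  by apply: le_trans d1 _; rewrite -mulrA ler_wpM2l.
by apply: le_trans IH2 _; rewrite (mulrC L) -mulrA ler_wpM2l ?exprn_ge0.
Qed.

Lemma cocycle_inj x m : Lam x -> lker (D m x) == 0%VS.
Proof.
move=> Lx; apply: lker_eq0 => v Dv0; apply/eqP.
have [_] := cocycle_bound m v Lx; rewrite Dv0 (norm0 (n_norm _)) mulr0.
by rewrite -(norm_eq0 (n_norm x)) eq_le (norm_ge0 (n_norm _)) => ->.
Qed.

Lemma dominated_pair_le (C C' alpha : R) (X Y : T -> {vspace V}) : C <= C' ->
  dominated_pair C alpha X Y -> dominated_pair C' alpha X Y.
Proof.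
move=> CC' XY x Lx m u v uX vY; apply: le_trans (XY x Lx m u v uX vY) _.
by rewrite ler_wpM2r ?(norm_ge0 (n_norm _))// ler_wpM2r ?(norm_ge0 (n_norm _))//
  ler_wpM2r// expR_ge0.
Qed.

(* With m fixed so that D^m expands v twice as much as u, a small u + v would be
   sent to a large vector. *)
Lemma dominated_pair_angle C alpha X Y : 0 < alpha -> dominated_pair C alpha X Y ->
  exists2 K : R, 0 < K & angle_bounded K X Y.
Proof.
move=> a0 XY; have half0 : 0 < 2^-1 :> R by rewrite invr_gt0.
have [m /(_ m (leqnn m)) Cm] := exp_decay C a0 half0.
case: (D_cocycle) => L1 _ _ _ _.
have L0 : 0 < L by apply: lt_le_trans L1.
pose B := L ^+ m.
have B1 : 1 <= B by exact: exprn_ege1.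
exists (3 * B ^+ 2 + 1); first by rewrite ltr_wpDl// mulr_ge0 ?sqr_ge0.
move=> x Lx u v uX vY.
set s := u + v.
have ns := norm_ge0 (n_norm x) s.
suff H : n x v <= 3 * B ^+ 2 * n x s.
  split; last by nra.
  have : n x u <= n x s + n x v.
    by have := normB (n_norm x) s v; rewrite /s addrK.
  by nra.
have [->|v0] := eqVneq v 0.
  by rewrite (norm0 (n_norm x)) mulr_ge0// mulr_ge0// sqr_ge0.
have nv : 0 < n x v by rewrite (norm_gt0 (n_norm x)).
have [_ b1] := cocycle_bound m v Lx; have [b2 _] := cocycle_bound m s Lx.
have [b3 _] := cocycle_bound m v Lx.
rewrite -/B in b1 b2 b3.
set ny := n (iter m f x) in b1 b2 b3.
have N := n_norm (iter m f x).
have d1 : ny (D m x v) <= ny (D m x s) + ny (D m x u).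
  have := normB N (D m x s) (D m x u); rewrite -linearB /s.
  by rewrite addrC addKr.
have d2 : ny (D m x u) * n x v <= 2^-1 * n x u * ny (D m x v).
  apply: le_trans (XY x Lx m u v uX vY) _.
  by rewrite ler_wpM2r ?(norm_ge0 N)// ler_wpM2r ?(norm_ge0 (n_norm x)).
have d3 : n x u <= n x s + n x v.
  by have := normB (n_norm x) s v; rewrite /s addrK.
have p1 := norm_ge0 N (D m x v).
have p2 := norm_ge0 N (D m x u).
have p3 := norm_ge0 (n_norm x) u.
rewrite -/ny in p1 p2.
(* Half of [ny (D m x v) * n x v] is absorbed on the left; doubling the remaining B + B / 2 gives 3
   B. *)
have e1 : ny (D m x v) * n x v <= 3 * B * n x s * n x v.
  have : ny (D m x v) * n x v <= ny (D m x s) * n x v + 2^-1 * (n x s + n x v) * ny (D m x v).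
    apply: (@le_trans _ _ ((ny (D m x s) + ny (D m x u)) * n x v)).
      by rewrite ler_pM2r.
    rewrite mulrDl lerD2l; apply: le_trans d2 _.
    by rewrite ler_wpM2r// ler_wpM2l.
  have : ny (D m x s) * n x v <= B * n x s * n x v by rewrite ler_pM2r.
  have : n x s * ny (D m x v) <= n x s * (B * n x v) by rewrite ler_wpM2l.
  by lra.
rewrite ler_pM2r// in e1.
apply: le_trans b1 _; rewrite expr2.
have -> : 3 * (B * B) * n x s = B * (3 * B * n x s) by ring.
by rewrite ler_wpM2l// (le_trans _ B1).
Qed.

(** The image of y + z must be bounded below by the images of y and z. This is the angle between Y
    and Z at the image point, which domination of Y by Z and invariance provide. *)
Lemma dominated_pair_addr C alpha X Y Z : 0 <= C -> 0 < alpha ->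
  forward_invariant Y -> forward_invariant Z ->
  dominated_pair C alpha X Y -> dominated_pair C alpha X Z ->
  dominated_pair C alpha Y Z ->
  exists2 C' : R, 0 <= C' & dominated_pair C' alpha X (fun x => Y x + Z x)%VS.
Proof.
move=> C0 a0 Yi Zi XY XZ YZ; have [K K0 YZK] := dominated_pair_angle a0 YZ.
exists (2 * K * C); first by rewrite !mulr_ge0// ltW.
move=> x Lx m u _ uX /memv_addP[y yY [z zZ ->]].
have [k1 k2] := YZK _ (Lam_iter m Lx) _ _ (Yi x Lx m y yY) (Zi x Lx m z zZ).
rewrite -linearD in k1 k2.
have h1 := XY x Lx m u y uX yY; have h2 := XZ x Lx m u z uX zZ.
set E := expR _ in h1 h2 *; set nf := n (iter m f x) in h1 h2 k1 k2 *.
have Nu := norm_ge0 (n_norm x) u.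
have CE : 0 <= C * E * n x u by rewrite !mulr_ge0// expR_ge0.
have du := norm_ge0 (n_norm (iter m f x)) (D m x u).
have g1 : nf (D m x u) * n x (y + z) <= nf (D m x u) * (n x y + n x z).
  by rewrite ler_wpM2l// (normD (n_norm x)).
have g2 : C * E * n x u * nf (D m x y) <= C * E * n x u * (K * nf (D m x (y + z))).
  by rewrite ler_wpM2l.
have g3 : C * E * n x u * nf (D m x z) <= C * E * n x u * (K * nf (D m x (y + z))).
  by rewrite ler_wpM2l.
by lra.
Qed.

(** Here the angle serves at the starting point, to bound the two components of a vector of X + Y by
    their sum. *)
Lemma dominated_pair_addl C alpha X Y Z : 0 <= C -> 0 < alpha ->
  dominated_pair C alpha X Y -> dominated_pair C alpha X Z ->
  dominated_pair C alpha Y Z ->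
  exists2 C' : R, 0 <= C' & dominated_pair C' alpha (fun x => X x + Y x)%VS Z.
Proof.
move=> C0 a0 XY XZ YZ; have [K K0 XYK] := dominated_pair_angle a0 XY.
exists (2 * K * C); first by rewrite !mulr_ge0// ltW.
move=> x Lx m _ w /memv_addP[y yY [z zZ ->]] wZ.
have [k1 k2] := XYK _ Lx _ _ yY zZ.
have h1 := XZ x Lx m y w yY wZ; have h2 := YZ x Lx m z w zZ wZ.
set E := expR _ in h1 h2 *; set nf := n (iter m f x) in h1 h2 *.
have Nw := norm_ge0 (n_norm x) w.
have dw := norm_ge0 (n_norm (iter m f x)) (D m x w).
have CE : 0 <= C * E * nf (D m x w) by rewrite !mulr_ge0// expR_ge0.
have g1 : nf (D m x (y + z)) * n x w <= (nf (D m x y) + nf (D m x z)) * n x w.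
  by rewrite ler_wpM2r// linearD (normD (n_norm _)).
have g2 : C * E * nf (D m x w) * n x y <= C * E * nf (D m x w) * (K * n x (y + z)).
  by rewrite ler_wpM2l.
have g3 : C * E * nf (D m x w) * n x z <= C * E * nf (D m x w) * (K * n x (y + z)).
  by rewrite ler_wpM2l.
by lra.
Qed.

End Cocycle.

(** * Domination between sums of summands *)

Section DominatedSums.
Context {R : realType} {T : Type} {V : vectType R}.
Variables (f : T -> T) (Lam : set T) (n : T -> V -> R) (D : nat -> T -> 'End(V)).
Variable L : R.
Hypothesis n_norm : forall x, is_norm (n x).
Hypothesis D_cocycle : bounded_cocycle f Lam n D L.

Lemma dominated_pair_0l C alpha (X Y : T -> {vspace V}) : 0 <= C ->
  (forall x, X x = 0%VS) -> dominated_pair f Lam n D C alpha X Y.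
Proof.
move=> C0 X0 x Lx m u v; rewrite X0 memv0 => /eqP -> _.
by rewrite linear0 (norm0 (n_norm _)) (norm0 (n_norm _)) mul0r mulr0 mul0r.
Qed.

Lemma dominated_pair_0r C alpha (X Y : T -> {vspace V}) : 0 <= C ->
  (forall x, Y x = 0%VS) -> dominated_pair f Lam n D C alpha X Y.
Proof.
move=> C0 Y0 x Lx m u v uX; rewrite Y0 memv0 => /eqP ->.
by rewrite linear0 (norm0 (n_norm _)) (norm0 (n_norm _)) !mulr0.
Qed.

Lemma forward_invariant_sum (I : Type) (r : seq I) (X : I -> T -> {vspace V}) :
  (forall i, forward_invariant f Lam D (X i)) ->
  forward_invariant f Lam D (fun x => \sum_(i <- r) X i x)%VS.
Proof.
move=> Xi x Lx m; elim: r => [|i r IH] v.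
  by rewrite !big_nil !memv0 => /eqP ->; rewrite linear0.
rewrite !big_cons => /memv_addP[a aX [b bX ->]].
by rewrite linearD; apply: memv_add; [exact: Xi|exact: IH].
Qed.

Variables (k : nat) (E : nat -> T -> {vspace V}) (C alpha : R).
Hypothesis C_ge0 : 0 <= C.
Hypothesis alpha_gt0 : 0 < alpha.
Hypothesis E_invariant : forall i, forward_invariant f Lam D (E i).
Hypothesis E_dom : forall i j, (i < j < k)%N ->
  dominated_pair f Lam n D C alpha (E i) (E j).

Let S lo hi x := (\sum_(lo <= a < hi) E a x)%VS.

(** Induction on [hi] for all [j] at once: to adjoin the summand [hi], the partial sum must be
    dominated by [hi] itself, which gives the angle, and by [j]. *)
Lemma dominated_sum_single lo hi j : (hi <= j < k)%N ->
  exists2 C' : R, 0 <= C' & dominated_pair f Lam n D C' alpha (S lo hi) (E j).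
Proof.
elim: hi j => [|hi IH] j hij.
  by exists 0 => //; apply: dominated_pair_0l => // x; rewrite /S big_geq.
have [lohi|hilo] := leqP lo hi; last first.
  by exists 0 => //; apply: dominated_pair_0l => // x; rewrite /S big_geq.
have -> : S lo hi.+1 = fun x => (S lo hi x + E hi x)%VS.
  by apply/funext => x; rewrite /S big_nat_recr.
have [hj jk] := andP hij.
have [C1 C10 d1] := IH hi (introT andP (conj (leqnn hi) (leq_trans hj (ltnW jk)))).
have [C2 C20 d2] := IH j (introT andP (conj (ltnW hj) jk)).
have M0 : 0 <= C1 + C2 + C by rewrite !addr_ge0.
have [le1 le2 le3] : [/\ C1 <= C1 + C2 + C, C2 <= C1 + C2 + C & C <= C1 + C2 + C].
  by have C0 := C_ge0; split; lra.
apply: (dominated_pair_addl n_norm D_cocycle M0 alpha_gt0).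
- exact: (dominated_pair_le n_norm le1 d1).
- exact: (dominated_pair_le n_norm le2 d2).
- exact: (dominated_pair_le n_norm le3 (E_dom (introT andP (conj hj jk)))).
Qed.

Lemma dominated_sum_sum i t : (t <= k)%N ->
  exists2 C' : R, 0 <= C' & dominated_pair f Lam n D C' alpha (S 0 i) (S i t).
Proof.
elim: t => [|t IH] tk.
  by exists 0 => //; apply: dominated_pair_0r => // x; rewrite /S big_geq.
have [it|ti] := leqP i t; last first.
  by exists 0 => //; apply: dominated_pair_0r => // x; rewrite /S big_geq.
have -> : S i t.+1 = fun x => (S i t x + E t x)%VS.
  by apply/funext => x; rewrite /S big_nat_recr.
have [C1 C10 d1] := IH (ltnW tk).
have [C2 C20 d2] := @dominated_sum_single 0 i t (introT andP (conj it tk)).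
have [C3 C30 d3] := @dominated_sum_single i t t (introT andP (conj (leqnn t) tk)).
have M0 : 0 <= C1 + C2 + C3 by rewrite !addr_ge0.
have [le1 le2 le3] : [/\ C1 <= C1 + C2 + C3, C2 <= C1 + C2 + C3 & C3 <= C1 + C2 + C3].
  by have C0 := C_ge0; split; lra.
apply: (dominated_pair_addr n_norm D_cocycle M0 alpha_gt0).
- by apply: forward_invariant_sum.
- exact: E_invariant.
- exact: (dominated_pair_le n_norm le1 d1).
- exact: (dominated_pair_le n_norm le2 d2).
- exact: (dominated_pair_le n_norm le3 d3).
Qed.

Lemma dominated_sums : exists2 C' : R, 0 <= C' & forall i, (i <= k)%N ->
  dominated_pair f Lam n D C' alpha (S 0 i) (S i k).
Proof.
suff H N : exists2 C' : R, 0 <= C' & forall i, (i <= N)%N ->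
    dominated_pair f Lam n D C' alpha (S 0 i) (S i k) by exact: H.
elim: N => [|N [C1 C10 H]].
  have [C' C'0 d] := @dominated_sum_sum 0 k (leqnn k).
  by exists C' => // i; rewrite leqn0 => /eqP ->.
have [C' C'0 d] := @dominated_sum_sum N.+1 k (leqnn k).
have [le1 le2] : C1 <= C1 + C' /\ C' <= C1 + C' by split; lra.
exists (C1 + C') => [|i]; first by rewrite addr_ge0.
rewrite leq_eqVlt ltnS => /predU1P[->|iN].
  exact: (dominated_pair_le n_norm le2 d).
exact: (dominated_pair_le n_norm le1 (H i iN)).
Qed.

End DominatedSums.

(** The estimate over m steps, taken at the m-th preimage of [x], compares the same four norms with
    the two bundles exchanged. *)
Lemma dominated_pair_backward (R : realType) (T : Type) (V : vectType R)
    (f g : T -> T) (Lam : set T) (n : T -> V -> R) (D D' : nat -> T -> 'End(V))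
    (C alpha : R) (X Y : T -> {vspace V}) :
  (forall x, Lam x -> Lam (g x)) -> cancel g f ->
  (forall m x v, D m (iter m g x) (D' m x v) = v) ->
  forward_invariant g Lam D' X -> forward_invariant g Lam D' Y ->
  dominated_pair f Lam n D C alpha X Y -> dominated_pair g Lam n D' C alpha Y X.
Proof.
move=> gL gK DK Xi Yi XY x Lx m v u vY uX.
have Ly : Lam (iter m g x) by elim: m => //= m; exact: gL.
have xE : iter m f (iter m g x) = x.
  by elim: m {Ly} => // m IH; rewrite iterSr/= gK.
have := XY _ Ly m _ _ (Xi x Lx m u uX) (Yi x Lx m v vY).
by rewrite xE !DK => h; rewrite mulrC mulrAC.
Qed.

(** * Continuity of bundle maps *)

Section BundleContinuity.
Context {R : realType} {T : topologicalType} {V : vectType R}.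
Variables (Lam : set T) (n : T -> V -> R) (tau : T -> T -> 'End(V)).
Hypothesis n_norm : forall x, is_norm (n x).
Hypothesis tau_near : forall x0 (e : R), 0 < e -> \forall x \near x0, forall u,
  `|n x (tau x0 x u) - n x0 u| <= e * n x0 u.
Hypothesis n_bounded : forall x y (S : 'End(V)),
  exists2 c : R, 0 <= c & forall v, n y (S v) <= c * n x v.

(** Continuity in operator norm of a bundle map [S] over [a]: the fibres at [x] and [x0] are
    identified by [tau], both in the source and in the target. *)
Definition bundle_continuous_at (a : T -> T) (S : T -> 'End(V)) (x0 : T) : Prop :=
  forall e : R, 0 < e -> \forall x \near within Lam (nbhs x0), forall u,
    n (a x) (S x (tau x0 x u) - tau (a x0) (a x) (S x0 u)) <= e * n x0 u.

Lemma tau_half x0 : \forall x \near x0, forall u,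
  n x (tau x0 x u) <= 2 * n x0 u /\ n x0 u <= 2 * n x (tau x0 x u).
Proof.
have half0 : 0 < 2^-1 :> R by rewrite invr_gt0.
apply: filterS (tau_near x0 half0) => x H u.
have := H u; have := norm_ge0 (n_norm x0) u.
by rewrite ler_norml => h0 /andP[h1 h2]; split; lra.
Qed.

Lemma tau_inj x0 x : (forall u, n x0 u <= 2 * n x (tau x0 x u)) ->
  lker (tau x0 x) == 0%VS.
Proof.
move=> H; apply: lker_eq0 => v Dv0; apply/eqP.
have := H v; rewrite Dv0 (norm0 (n_norm _)) mulr0.
by rewrite -(norm_eq0 (n_norm x0)) eq_le (norm_ge0 (n_norm _)) => ->.
Qed.

Section AtPoint.
Variables (a : T -> T) (S : T -> 'End(V)) (x0 : T).
Hypothesis a_cvg : a x @[x --> within Lam (nbhs x0)] --> a x0.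
Hypothesis S_cont : bundle_continuous_at a S x0.

Lemma bundle_continuous_bounded : exists2 c : R, 0 <= c &
  \forall x \near within Lam (nbhs x0), forall v, n (a x) (S x v) <= c * n x v.
Proof.
have [c c0 cS] := n_bounded x0 (a x0) (S x0).
exists (2 * (2 * c + 1)); first by rewrite mulr_ge0// addr_ge0// mulr_ge0.
have one : 0 < (1 : R) by [].
have h1 := S_cont one.
have h2 := near_cvg a_cvg (tau_half (a x0)).
have h3 : \forall x \near within Lam (nbhs x0), forall u,
    n x (tau x0 x u) <= 2 * n x0 u /\ n x0 u <= 2 * n x (tau x0 x u).
  exact: cvg_within (tau_half x0).
apply: filterS3 h1 h2 h3 => x h1 h2 h3 v.
have [u ->] := lfun_surj v (tau_inj (fun u => (h3 u).2)).
have [_ g3] := h3 u; have [g2 _] := h2 (S x0 u); have g1 := h1 u.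
have g4 := norm_le_sub (n_norm (a x)) (S x (tau x0 x u)) (tau (a x0) (a x) (S x0 u)).
have g5 := cS u.
have : (2 * c + 1) * n x0 u <= (2 * c + 1) * (2 * n x (tau x0 x u)).
  by rewrite ler_wpM2l// addr_ge0// mulr_ge0.
by lra.
Qed.

(** The defect of the composite is [P] applied to the defect of [S], small by the local bound on
    [P], plus the defect of [P] on the fixed image [S x0 u]. *)
Lemma bundle_continuous_comp (b : T -> T) (P : T -> 'End(V)) :
  (forall x, Lam x -> Lam (a x)) ->
  b y @[y --> within Lam (nbhs (a x0))] --> b (a x0) ->
  (exists2 c : R, 0 <= c &
    \forall y \near within Lam (nbhs (a x0)), forall v, n (b y) (P y v) <= c * n y v) ->
  bundle_continuous_at b P (a x0) ->
  bundle_continuous_at (b \o a) (fun x => P (a x) \o S x)%VF x0.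
Proof.
move=> aL b_cvg [c c0 Pc] P_cont e e0.
have [c' c'0 cS] := n_bounded x0 (a x0) (S x0).
have e1 : 0 < e / (2 * (c + 1)) by rewrite divr_gt0// mulr_gt0// ltr_wpDl.
have e2 : 0 < e / (2 * (c' + 1)) by rewrite divr_gt0// mulr_gt0// ltr_wpDl.
have a_cvg' : a x @[x --> within Lam (nbhs x0)] --> within Lam (nbhs (a x0)).
  move=> A LA.
  have h : \forall x \near x0, Lam x -> Lam (a x) -> A (a x) := near_cvg a_cvg LA.
  have h' : \forall x \near x0, Lam x -> A (a x).
    by apply: filterS h => x h Lx; exact: h (aL _ Lx).
  exact: h'.
have h1 := S_cont e1.
have h2 : \forall x \near within Lam (nbhs x0),
    forall v, n (b (a x)) (P (a x) v) <= c * n (a x) v by exact: (a_cvg' _ Pc).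
have h3 : \forall x \near within Lam (nbhs x0), forall u,
    n (b (a x)) (P (a x) (tau (a x0) (a x) u) - tau (b (a x0)) (b (a x)) (P (a x0) u))
    <= e / (2 * (c' + 1)) * n (a x0) u by exact: (a_cvg' _ (P_cont _ e2)).
apply: filterS3 h1 h2 h3 => x h1 h2 h3 u.
have g1 := h1 u; have g2 := h2 (S x (tau x0 x u) - tau (a x0) (a x) (S x0 u)).
have g3 := h3 (S x0 u); have g4 := cS u.
rewrite !comp_lfunE /= in g2 g3 *.
set A := P (a x) _ in g2; set B := _ - _ in g3.
have -> : P (a x) (S x (tau x0 x u)) - tau (b (a x0)) (b (a x)) (P (a x0) (S x0 u)) =
    A + B by rewrite /A /B linearB addrA subrK.
apply: le_trans (normD (n_norm _) _ _) _.
have p1 : c * n (a x) (S x (tau x0 x u) - tau (a x0) (a x) (S x0 u)) <= e / 2 * n x0 u.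
  apply: (@le_trans _ _ (c * (e / (2 * (c + 1)) * n x0 u))); first by rewrite ler_wpM2l.
  rewrite mulrA ler_wpM2r ?(norm_ge0 (n_norm x0))//.
  have -> : c * (e / (2 * (c + 1))) = e / 2 * (c / (c + 1)).
    by field; rewrite gt_eqF// ltr_wpDl.
  apply: ler_piMr; first by rewrite divr_ge0// ltW.
  by rewrite ler_pdivrMr ?ltr_wpDl// mul1r lerDl.
have p2 : e / (2 * (c' + 1)) * n (a x0) (S x0 u) <= e / 2 * n x0 u.
  apply: (@le_trans _ _ (e / (2 * (c' + 1)) * (c' * n x0 u))).
    by rewrite ler_wpM2l// ltW.
  rewrite mulrA ler_wpM2r ?(norm_ge0 (n_norm x0))//.
  have -> : e / (2 * (c' + 1)) * c' = e / 2 * (c' / (c' + 1)).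
    by field; rewrite gt_eqF// ltr_wpDl.
  apply: ler_piMr; first by rewrite divr_ge0// ltW.
  by rewrite ler_pdivrMr ?ltr_wpDl// mul1r lerDl.
by lra.
Qed.

End AtPoint.

Lemma bundle_continuous_compact_bounded (a : T -> T) (S : T -> 'End(V)) :
  compact Lam ->
  (forall x0, Lam x0 -> a x @[x --> within Lam (nbhs x0)] --> a x0) ->
  (forall x0, Lam x0 -> bundle_continuous_at a S x0) ->
  exists2 c : R, 1 <= c & forall x, Lam x -> forall v, n (a x) (S x v) <= c * n x v.
Proof.
move=> cL a_cvg S_cont.
pose P (c : R) (x : T) := forall v, n (a x) (S x v) <= c * n x v.
(* Compactness in its covering form, with the bound as a parameter tending to +oo: the local bounds
   merge into a single one. *)
have := compact_near_coveringP Lam => -[/(_ cL) /near_covering_withinP H _].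
have {}H := H R +oo%R P _ _.
have : \forall c \near +oo, Lam `<=` P c.
  apply: H => x0 Lx0; have [c c0 cS] := bundle_continuous_bounded (a_cvg _ Lx0) (S_cont _ Lx0).
  exists ([set x | Lam x -> forall v, n (a x) (S x v) <= c * n x v], [set c' | c <= c']).
    by split; [exact: cS | exact: nbhs_pinfty_ge (num_real c)].
  move=> [x c'] /= [h cc'] Lx v.
  by apply: le_trans (h Lx v) _; rewrite ler_wpM2r ?(norm_ge0 (n_norm _)).
move=> h; have : \forall c \near +oo%R, 1 <= c /\ Lam `<=` P c.
  by apply: filterS2 (nbhs_pinfty_ge (num_real 1)) h.
by move=> /filter_ex [c [c1 cP]]; exists c => // x /cP.
Qed.

End BundleContinuity.

(** * Continuity of the projectors of a dominated pair *)

Section ProjectionContinuity.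
Context {R : realType} {T : topologicalType} {V : vectType R}.
Variables (Lam : set T) (n : T -> V -> R) (tau : T -> T -> 'End(V)).
Hypothesis n_norm : forall x, is_norm (n x).
Hypothesis tau_near : forall x0 (e : R), 0 < e -> \forall x \near x0, forall u,
  `|n x (tau x0 x u) - n x0 u| <= e * n x0 u.
Hypothesis n_bounded : forall x y (S : 'End(V)),
  exists2 c : R, 0 <= c & forall v, n y (S v) <= c * n x v.

(** The order of choices matters: m is fixed so that the factor [eta] of domination over m steps
    beats [16 * K ^+ 2], and only then is [x] taken so close to [x0] that transport compares [D m]
    at both points within a factor 2. *)
Lemma dominated_component_near (f : T -> T) (D : nat -> T -> 'End(V))
    (L C alpha K : R) (X Y : T -> {vspace V}) :
  bounded_cocycle f Lam n D L ->
  (forall m x0, Lam x0 ->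
     iter m f x @[x --> within Lam (nbhs x0)] --> iter m f x0) ->
  (forall m x0, Lam x0 -> bundle_continuous_at Lam n tau (iter m f) (D m) x0) ->
  forward_invariant f Lam D X -> forward_invariant f Lam D Y ->
  (forall x, Lam x -> (X x :&: Y x = 0)%VS) ->
  (forall x x0, Lam x -> Lam x0 ->
     (\dim (X x) + \dim (Y x0) = \dim (fullv : {vspace V}))%N) ->
  0 <= C -> 0 < alpha -> dominated_pair f Lam n D C alpha X Y ->
  0 <= K -> angle_bounded Lam n K X Y ->
  forall x0, Lam x0 -> forall e : R, 0 < e ->
  \forall x \near within Lam (nbhs x0), forall w u v,
    w \in X x0 -> u \in X x -> v \in Y x -> tau x0 x w = u + v ->
    n x v <= e * n x0 w.
Proof.
move=> Dc f_cvg D_cont Xi Yi XY0 dimXY C0 a0 XY K0 angle x0 Lx0 e e0.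
have K16 : 0 < 16 * K ^+ 2 + 1 by rewrite ltr_wpDl// mulr_ge0// sqr_ge0.
have e'0 : 0 < Num.min 1 (e / (16 * K ^+ 2 + 1)).
  by rewrite lt_min ltr01 divr_gt0.
have [m /(_ m (leqnn m))] := exp_decay C a0 e'0.
rewrite le_min => /andP[eta1 eta2].
set eta := C * _ in eta1 eta2.
have eta0 : 0 <= eta by rewrite mulr_ge0// expR_ge0.
have [L1 _ _ _ _] := Dc.
have Lm : 1 <= L ^+ m by exact: exprn_ege1.
have Lm0 : 0 < L ^+ m by apply: lt_le_trans Lm.
(* As [D m] shrinks vectors at most by L^m, an error of this relative size is at most a quarter of
   the norm of [D m x0 w]. *)
have d0 : 0 < (4 * L ^+ m)^-1 by rewrite invr_gt0 mulr_gt0.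
have q0 : 0 < 4^-1 :> R by rewrite invr_gt0.
have h1 : \forall x \near within Lam (nbhs x0), Lam x by exact: withinT.
have h2 : \forall x \near within Lam (nbhs x0), forall u,
    n x (tau x0 x u) <= 2 * n x0 u /\ n x0 u <= 2 * n x (tau x0 x u).
  exact: cvg_within (tau_half n_norm tau_near x0).
have h3 := D_cont m x0 Lx0 _ d0.
have h4 : \forall x \near within Lam (nbhs x0), forall u,
    `|n (iter m f x) (tau (iter m f x0) (iter m f x) u) - n (iter m f x0) u|
    <= 4^-1 * n (iter m f x0) u.
  exact: near_cvg (f_cvg m x0 Lx0) (tau_near (iter m f x0) q0).
have h34 : \forall x \near within Lam (nbhs x0), forall w,
    n (iter m f x) (D m x (tau x0 x w)) <= 2 * n (iter m f x0) (D m x0 w) /\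
    n (iter m f x0) (D m x0 w) <= 2 * n (iter m f x) (D m x (tau x0 x w)).
  apply: filterS2 h3 h4 => x h3 h4 w.
  have g3 := h3 w; have := h4 (D m x0 w); rewrite ler_norml => /andP[g4 g5].
  have [_ g6] := cocycle_bound Dc m w Lx0.
  have g7 : (4 * L ^+ m)^-1 * n x0 w <= 4^-1 * n (iter m f x0) (D m x0 w).
    rewrite invfM -mulrA ler_wpM2l ?(ltW q0)//.
    by rewrite ler_pdivrMl.
  have N := n_norm (iter m f x).
  have g8 := norm_le_sub N (D m x (tau x0 x w)) (tau (iter m f x0) (iter m f x) (D m x0 w)).
  have := norm_le_sub N (tau (iter m f x0) (iter m f x) (D m x0 w)) (D m x (tau x0 x w)).
  rewrite (norm_subC N) => g9.
  have g10 := norm_ge0 (n_norm (iter m f x0)) (D m x0 w).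
  by split; lra.
apply: filterS3 h1 h2 h34 => x Lx h2 h34 w u v wX uX vY wE.
have Lmx := Lam_iter Dc m Lx.
have := @dominated_component_le R V (n x) (n (iter m f x)) (n x0) (n (iter m f x0))
  (tau x0 x) (D m x) (D m x0) (X x) (Y x) (X x0) (Y x0) eta K
  (n_norm _) (n_norm _) (n_norm _) (n_norm _)
  (fun w => (h2 w).1) (fun w => (h2 w).2) (fun w => (h34 w).1) (fun w => (h34 w).2)
  (cocycle_inj n_norm Dc m Lx) K0 eta0 eta1 (XY0 x Lx) (dimXY x x0 Lx Lx0)
  (XY x Lx m) (XY x0 Lx0 m) (angle x Lx) _ w u v wX uX vY wE.
move=> H; apply: (le_trans (H _)).
  move=> u' v' u'X v'Y.
  have [_] := angle _ Lmx _ _ (Xi x Lx m u' u'X) (Yi x Lx m v' v'Y).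
  by rewrite linearD.
rewrite ler_wpM2r ?(norm_ge0 (n_norm _))//.
apply: (@le_trans _ _ ((16 * K ^+ 2 + 1) * eta)); last by rewrite mulrC -ler_pdivlMr.
by rewrite ler_wpM2r// lerDl.
Qed.

Lemma daddv_pi_split (X Y : {vspace V}) w : (X :&: Y = 0)%VS -> (X + Y = fullv)%VS ->
  daddv_pi X Y w + daddv_pi Y X w = w.
Proof. by move=> XY0 XY1; rewrite daddv_pi_add// XY1 memvf. Qed.

Lemma daddv_pi_decomp (X Y : {vspace V}) u v : (X :&: Y = 0)%VS ->
  u \in X -> v \in Y -> daddv_pi X Y (u + v) = u.
Proof.
move=> XY0 uX vY.
have wXY : u + v \in (X + Y)%VS by rewrite memv_add.
have E := daddv_pi_add XY0 wXY.
have dXY : directv (X + Y) by apply/directv_addP.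
move/directv_add_unique: dXY => /(_ _ _ _ _ (memv_pi X Y (u + v)) uX (memv_pi Y X (u + v)) vY).
by rewrite E eqxx => /esym/eqP [].
Qed.

(** With w = a + b split along X and Y at [x0], the defect of the projection is the X-component of
    the transported b minus the Y-component of the transported a. Both are small by hypothesis, and
    the angle bounds a and b by w. *)
Lemma bundle_continuous_proj (K : R) (X Y : T -> {vspace V}) x0 :
  (forall x, Lam x -> (X x :&: Y x = 0)%VS) ->
  (forall x, Lam x -> (X x + Y x = fullv)%VS) ->
  0 < K -> angle_bounded Lam n K X Y -> Lam x0 ->
  (forall e : R, 0 < e -> \forall x \near within Lam (nbhs x0), forall w u v,
    w \in X x0 -> u \in X x -> v \in Y x -> tau x0 x w = u + v ->
    n x v <= e * n x0 w) ->
  (forall e : R, 0 < e -> \forall x \near within Lam (nbhs x0), forall w u v,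
    w \in Y x0 -> u \in X x -> v \in Y x -> tau x0 x w = u + v ->
    n x u <= e * n x0 w) ->
  bundle_continuous_at Lam n tau id (fun x => daddv_pi (X x) (Y x)) x0.
Proof.
move=> XY0 XY1 K0 angle Lx0 hX hY e e0.
have e2 : 0 < e / (2 * K) by rewrite divr_gt0// mulr_gt0.
have hL : \forall x \near within Lam (nbhs x0), Lam x by exact: withinT.
apply: filterS3 hL (hX _ e2) (hY _ e2) => x Lx h1 h2 w.
set a := daddv_pi (X x0) (Y x0) w; set b := daddv_pi (Y x0) (X x0) w.
have wE : w = a + b by rewrite daddv_pi_split ?XY0 ?XY1.
have aX : a \in X x0 by exact: memv_pi.
have bY : b \in Y x0 by exact: memv_pi.
have [ka kb] := angle x0 Lx0 a b aX bY; rewrite -wE in ka kb.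
set Q := daddv_pi (X x) (Y x); set Q' := daddv_pi (Y x) (X x).
have s z : z = Q z + Q' z by rewrite daddv_pi_split ?XY0 ?XY1.
have QX z : Q z \in X x by exact: memv_pi.
have QY z : Q' z \in Y x by exact: memv_pi.
have g1 := h1 a _ _ aX (QX _) (QY _) (s (tau x0 x a)).
have g2 := h2 b _ _ bY (QX _) (QY _) (s (tau x0 x b)).
have -> : Q (tau x0 x w) - tau x0 x a = Q (tau x0 x b) - Q' (tau x0 x a).
  by rewrite wE !linearD /= [X in _ - X](s (tau x0 x a)) opprD addrACA subrr add0r.
apply: le_trans (normB (n_norm x) _ _) _.
have p1 : e / (2 * K) * n x0 a <= e / (2 * K) * (K * n x0 w) by rewrite ler_wpM2l// ltW.
have p2 : e / (2 * K) * n x0 b <= e / (2 * K) * (K * n x0 w) by rewrite ler_wpM2l// ltW.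
have E : e / (2 * K) * (K * n x0 w) = e / 2 * n x0 w by field; rewrite gt_eqF.
by lra.
Qed.

End ProjectionContinuity.

(** * Adapted scalings *)

Section LfunNorm.
Context {R : realType} {V : vectType R}.

Definition lfun_norm (n n' : V -> R) (S : 'End(V)) : R :=
  sup [set r | exists2 v : V, n v <= 1 & r = n' (S v)].

Variables (n n' : V -> R).
Hypothesis n_norm : is_norm n.
Hypothesis n'_norm : is_norm n'.

Lemma lfun_norm_le (S : 'End(V)) (c : R) : 0 <= c ->
  (forall v, n' (S v) <= c * n v) -> lfun_norm n n' S <= c.
Proof.
move=> c0 cS; apply: ge_sup.
  by exists (n' (S 0)), 0; rewrite ?(norm0 n_norm).
by move=> _ [v v1 ->]; apply: le_trans (cS v) _; rewrite ler_piMr.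
Qed.

Variable S : 'End(V).
Hypothesis S_bounded : exists2 c : R, 0 <= c & forall v, n' (S v) <= c * n v.

Lemma le_lfun_norm v : n' (S v) <= lfun_norm n n' S * n v.
Proof.
have [c c0 cS] := S_bounded.
have [->|v0] := eqVneq v 0; first by rewrite linear0 (norm0 n_norm) (norm0 n'_norm) mulr0.
have nv : 0 < n v by rewrite (norm_gt0 n_norm).
rewrite -ler_pdivrMr//; apply: ub_le_sup.
  by exists c => _ [w w1 ->]; apply: le_trans (cS w) _; rewrite ler_piMr.
exists ((n v)^-1 *: v).
  by rewrite (normZ n_norm) ger0_norm ?invr_ge0 ?(ltW nv)// mulVf// gt_eqF.
by rewrite linearZ (normZ n'_norm) ger0_norm ?invr_ge0 ?(ltW nv)// mulrC.
Qed.

Lemma lfun_norm_ge0 : 0 <= lfun_norm n n' S.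
Proof.
have [c c0 cS] := S_bounded.
apply: (@le_trans _ _ (n' (S 0))); first exact: (norm_ge0 n'_norm).
apply: ub_le_sup.
  by exists c => _ [w w1 ->]; apply: le_trans (cS w) _; rewrite ler_piMr.
by exists 0; rewrite ?(norm0 n_norm).
Qed.

End LfunNorm.

Lemma lfun_norm_cvg (R : realType) (T : topologicalType) (V : vectType R)
    (Lam : set T) (n : T -> V -> R) (tau : T -> T -> 'End(V))
    (a : T -> T) (S : T -> 'End(V)) (x0 : T) :
  (forall x, is_norm (n x)) ->
  (forall x0 (e : R), 0 < e -> \forall x \near x0, forall u,
    `|n x (tau x0 x u) - n x0 u| <= e * n x0 u) ->
  (forall x y (S : 'End(V)),
    exists2 c : R, 0 <= c & forall v, n y (S v) <= c * n x v) ->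
  a x @[x --> within Lam (nbhs x0)] --> a x0 ->
  bundle_continuous_at Lam n tau a S x0 ->
  lfun_norm (n x) (n (a x)) (S x) @[x --> within Lam (nbhs x0)] -->
  lfun_norm (n x0) (n (a x0)) (S x0).
Proof.
move=> n_norm tau_near n_bounded a_cvg S_cont.
set A := lfun_norm (n x0) _ _.
have A0 : 0 <= A by exact: lfun_norm_ge0.
apply/cvgrPdistC_le => e' e'0.
have A2 : 0 < 4 * A + 2 by rewrite ltr_wpDl// mulr_ge0.
(* The distortions of the two norms and of the map turn A into at most ((1 + e) A + e) / (1 - e),
   which is at most A + e (4 A + 2) when e <= 1/2. *)
have [e e0 [eh ee]] : exists2 e : R, 0 < e & e <= 2^-1 /\ e * (4 * A + 2) <= e'.
  exists (Num.min 2^-1 (e' / (4 * A + 2))).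
    by rewrite lt_min invr_gt0 ltr0n divr_gt0.
  by rewrite -ler_pdivlMr// !ge_min !lexx orbT.
have Ae : 0 <= A * e by rewrite mulr_ge0// ltW.
have [e_ge0 e1_ge0 e1_gt0] : [/\ 0 <= e, 0 <= 1 + e & 0 < 1 - e] by split; lra.
have h1 := S_cont _ e0.
have h2 : \forall x \near within Lam (nbhs x0), forall u,
   `|n x (tau x0 x u) - n x0 u| <= e * n x0 u.
  exact: cvg_within (tau_near x0 e e0).
have h3 : \forall x \near within Lam (nbhs x0), forall u,
   `|n (a x) (tau (a x0) (a x) u) - n (a x0) u| <= e * n (a x0) u.
  exact: near_cvg a_cvg (tau_near (a x0) e e0).
apply: filterS3 h1 h2 h3 => x h1 h2 h3.
set B := lfun_norm (n x) _ _.
have B0 : 0 <= B by exact: lfun_norm_ge0.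
have tx : lker (tau x0 x) == 0%VS.
  apply: (tau_inj n_norm) => u; have := h2 u; rewrite ler_norml => /andP[h _].
  by have := norm_ge0 (n_norm x0) u; nra.
have N := n_norm (a x).
have H1 : B <= A + e * (4 * A + 2).
  apply: lfun_norm_le => //; first by rewrite addr_ge0// mulr_ge0// ltW.
  move=> v; have [u ->] := lfun_surj v tx.
  have g1 := h1 u; have := h2 u; rewrite ler_norml => /andP[g2 _].
  have := h3 (S x0 u); rewrite ler_norml => /andP[_ g3].
  have g4 := norm_le_sub N (S x (tau x0 x u)) (tau (a x0) (a x) (S x0 u)).
  have g5 : n (a x0) (S x0 u) <= A * n x0 u by exact: le_lfun_norm.
  have nu := norm_ge0 (n_norm x0) u.
  have g6 : (1 + e) * n (a x0) (S x0 u) <= (1 + e) * (A * n x0 u).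
    by rewrite ler_wpM2l// addr_ge0// ltW.
  have g7 : (A + e * (4 * A + 2)) * ((1 - e) * n x0 u) <=
      (A + e * (4 * A + 2)) * n x (tau x0 x u).
    have c0 : 0 <= A + e * (4 * A + 2) by rewrite addr_ge0// mulr_ge0// ltW.
    by apply: ler_wpM2l => //; move: g2; lra.
  apply: le_trans g7.
  have : (((1 + e) * A + e) * n x0 u) <= (A + e * (4 * A + 2)) * (1 - e) * n x0 u.
    rewrite ler_wpM2r//; nra.
  by lra.
have H2 : A <= B + e * (4 * A + 2).
  have H3 : A * (1 - e) <= B * (1 + e) + e.
    rewrite -ler_pdivlMr; last by lra.
    apply: lfun_norm_le => //.
      by rewrite divr_ge0 ?(ltW e1_gt0)// addr_ge0// mulr_ge0.
    move=> u.
    have g1 := h1 u; have := h2 u; rewrite ler_norml => /andP[_ g2].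
    have := h3 (S x0 u); rewrite ler_norml => /andP[g3 _].
    have := norm_le_sub N (tau (a x0) (a x) (S x0 u)) (S x (tau x0 x u)).
    rewrite (norm_subC N) => g4.
    have g5 : n (a x) (S x (tau x0 x u)) <= B * n x (tau x0 x u) by exact: le_lfun_norm.
    have g6 : B * n x (tau x0 x u) <= B * ((1 + e) * n x0 u).
      by rewrite ler_wpM2l//; lra.
    rewrite mulrAC ler_pdivlMr; last by lra.
    by lra.
  by nra.
by rewrite ler_norml; apply/andP; split; lra.
Qed.

(** The geometric mean of N consecutive terms of [a] is an adapted norm: multiplied by the scalings,
    it contracts by e^(- dl) in every single step. It differs from [a] by a factor at most L^N, paid
    at both ends. Roots are avoided by comparing N-th powers. *)
Lemma geometric_mean_contraction (R : realType) (a p : nat -> R) (L dl : R) (N : nat) :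
  1 <= L -> (0 < N)%N -> (forall j, 0 < a j) -> (forall j, 0 < p j) ->
  (forall j, a j.+1 <= L * a j /\ a j <= L * a j.+1) ->
  (forall j, p j ^+ N * a (j + N)%N <= expR (- (N%:R * dl)) * a j) ->
  forall m, (\prod_(l < m) p l) * a m <= L ^+ N ^+ 2 * expR (- (m%:R * dl)) * a 0%N.
Proof.
move=> L1 N0 a0 p0 aL pa m.
have L0 : 0 < L by apply: lt_le_trans L1.
have aLr j r : a (j + r)%N <= L ^+ r * a j /\ a j <= L ^+ r * a (j + r)%N.
  elim: r => [|r [IH1 IH2]]; first by rewrite addn0 expr0 !mul1r.
  rewrite addnS exprS; have [h1 h2] := aL (j + r)%N; split.
    by apply: le_trans h1 _; rewrite -mulrA ler_wpM2l// ltW.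
  by apply: le_trans IH2 _; rewrite (mulrC L) -mulrA ler_wpM2l// exprn_ge0// ltW.
have LN r : (r < N)%N -> L ^+ r <= L ^+ N by move=> rN; rewrite ler_weXn2l// ltnW.
(* The product of N consecutive terms telescopes: Phi (j+1) * a j = Phi j * a (j+N). *)
pose Phi j := \prod_(r < N) a (j + r)%N.
have Phi0 j : 0 < Phi j by apply: prodr_gt0 => r _.
have PhiS j : Phi j.+1 * a j = Phi j * a (j + N)%N.
  have -> : Phi j * a (j + N)%N = \prod_(r < N.+1) a (j + r)%N by rewrite big_ord_recr.
  rewrite big_ord_recl addn0 mulrC; congr (_ * _).
  by apply: eq_bigr => r _; rewrite /= /bump /= add1n addSnnS.
pose P j := \prod_(l < j) p l.
have P0 j : 0 < P j by apply: prodr_gt0 => r _.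
have main j : P j ^+ N * Phi j <= expR (- (j%:R * dl)) ^+ N * Phi 0%N.
  elim: j => [|j IH]; first by rewrite mul0r oppr0 expR0 /P big_ord0 !expr1n.
  rewrite -(ler_pM2r (a0 j)) -mulrA PhiS {1}/P big_ord_recr /= -/(P j) exprMn.
  have := ler_wpM2l (ltW (mulr_gt0 (exprn_gt0 N (P0 j)) (Phi0 j))) (pa j).
  move=> h; apply: (@le_trans _ _ (P j ^+ N * Phi j * (expR (- (N%:R * dl)) * a j))).
    by apply: le_trans h; rewrite le_eqVlt; apply/orP; left; apply/eqP; ring.
  rewrite [leRHS](_ : _ = expR (- (j%:R * dl)) ^+ N * Phi 0%N * (expR (- (N%:R * dl)) * a j)).
    by rewrite ler_pM2r// mulr_gt0// expR_gt0.
  have -> : expR (- (j.+1%:R * dl)) ^+ N = expR (- (j%:R * dl)) ^+ N * expR (- (N%:R * dl)).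
    rewrite -!expRM_natl -expRD; congr expR; rewrite -natr1; ring.
  by ring.
have prodc (c : R) : c ^+ N = \prod_(r < N) c by rewrite prodr_const card_ord.
have PhiUp : Phi 0%N <= L ^+ N ^+ N * a 0%N ^+ N.
  rewrite -exprMn (prodc (L ^+ N * a 0%N)) /Phi; apply: ler_prod => r _.
  rewrite ltW//= add0n; have [h _] := aLr 0%N r; rewrite add0n in h.
  by apply: le_trans h _; apply: ler_wpM2r; [exact: ltW|exact: LN (ltn_ord r)].
have PhiLo : a m ^+ N <= L ^+ N ^+ N * Phi m.
  rewrite (prodc (a m)) (prodc (L ^+ N)) /Phi -big_split /=; apply: ler_prod => r _.
  rewrite ltW//=; have [_ h] := aLr m r.
  by apply: le_trans h _; apply: ler_wpM2r; [exact: ltW|exact: LN (ltn_ord r)].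
rewrite -(ler_pXn2r N0) ?nnegrE ?mulr_ge0 ?expR_ge0 ?exprn_ge0 ?(ltW L0) ?(ltW (a0 _)) ?(ltW (P0 _))//.
rewrite !exprMn -/(P m).
apply: (@le_trans _ _ (P m ^+ N * (L ^+ N ^+ N * Phi m))).
  by rewrite ler_pM2l// exprn_gt0.
have LN0 : 0 < L ^+ N ^+ N by rewrite !exprn_gt0.
apply: (@le_trans _ _ (L ^+ N ^+ N * (expR (- (m%:R * dl)) ^+ N * Phi 0%N))).
  by rewrite mulrCA ler_pM2l.
apply: (@le_trans _ _ (L ^+ N ^+ N * (expR (- (m%:R * dl)) ^+ N * (L ^+ N ^+ N * a 0%N ^+ N)))).
  by rewrite !ler_pM2l// exprn_gt0// expR_gt0.
by rewrite le_eqVlt; apply/orP; left; apply/eqP; ring.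
Qed.

(** Expansion is contraction for the reciprocals of [a] and [p]. *)
Lemma geometric_mean_expansion (R : realType) (a p : nat -> R) (L dl : R) (N : nat) :
  1 <= L -> (0 < N)%N -> (forall j, 0 < a j) -> (forall j, 0 < p j) ->
  (forall j, a j.+1 <= L * a j /\ a j <= L * a j.+1) ->
  (forall j, a j <= expR (- (N%:R * dl)) * (p j ^+ N * a (j + N)%N)) ->
  forall m, a 0%N <= L ^+ N ^+ 2 * expR (- (m%:R * dl)) * ((\prod_(l < m) p l) * a m).
Proof.
move=> L1 N0 a0 p0 aL pa m.
have P0 : 0 < \prod_(l < m) p l by apply: prodr_gt0 => l _.
have := @geometric_mean_contraction R (fun j => (a j)^-1) (fun j => (p j)^-1) L dl N
  L1 N0 _ _ _ _ m.
rewrite prodfV -invfM => H.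
have {}H : ((\prod_(l < m) p l) * a m)^-1 <= L ^+ N ^+ 2 * expR (- (m%:R * dl)) * (a 0%N)^-1.
  apply: H => j; rewrite ?invr_gt0//.
    have [h1 h2] := aL j; split.
      by rewrite -[leLHS]mul1r ler_pdivrMr// mulrAC ler_pdivlMr// mul1r.
    by rewrite -[leLHS]mul1r ler_pdivrMr// mulrAC ler_pdivlMr// mul1r.
  rewrite exprVn -invfM -[leLHS]mul1r ler_pdivrMr ?mulr_gt0 ?exprn_gt0//.
  by rewrite mulrAC ler_pdivlMr// mul1r.
rewrite -[leLHS]mul1r ler_pdivlMr// in H.
have D0 : 0 < (\prod_(l < m) p l) * a m by rewrite mulr_gt0.
by move: H; rewrite mul1r mulrC ler_pdivrMr.
Qed.

Lemma iter_add (T : Type) (f : T -> T) (a b : nat) x :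
  iter (a + b) f x = iter a f (iter b f x).
Proof. by elim: a => //= a ->. Qed.

(** Here a and b stand for the logarithms of the norms at consecutive indices and c for that of the
    angle constant: after division by N they use up at most half of the built-in gap e. *)
Lemma log_scaling_gap (R : realType) (w a b c e t N : R) : 0 < N ->
  a <= c + b -> c <= N * (e / 2) ->
  e / 2 <= (w - a / N - e * t) - (w - b / N - e * (t + 1)).
Proof.
move=> N0 ab cN.
have : (a - b) / N <= e / 2 by rewrite ler_pdivrMr//; lra.
by rewrite mulrBl mulrDr mulr1; lra.
Qed.

Section Scalings.
Context {R : realType} {T : topologicalType} {V : vectType R}.
Variables (Lam : set T) (n : T -> V -> R) (tau : T -> T -> 'End(V)).
Hypothesis n_norm : forall x, is_norm (n x).
Hypothesis tau_near : forall x0 (e : R), 0 < e -> \forall x \near x0, forall u,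
  `|n x (tau x0 x u) - n x0 u| <= e * n x0 u.
Hypothesis n_bounded : forall x y (S : 'End(V)),
  exists2 c : R, 0 <= c & forall v, n y (S v) <= c * n x v.
Variables (f : T -> T) (D : nat -> T -> 'End(V)) (L : R).
Hypothesis D_cocycle : bounded_cocycle f Lam n D L.

Lemma scaled_contraction (p : T -> R) (X : T -> {vspace V}) (dl : R) (N : nat) :
  (0 < N)%N -> (forall x, 0 < p x) -> forward_invariant f Lam D X ->
  (forall x v, Lam x -> v \in X x ->
     p x ^+ N * n (iter N f x) (D N x v) <= expR (- (N%:R * dl)) * n x v) ->
  forall x m v, Lam x -> v \in X x ->
    (\prod_(l < m) p (iter l f x)) * n (iter m f x) (D m x v) <=
    L ^+ N ^+ 2 * expR (- (m%:R * dl)) * n x v.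
Proof.
move=> N0 p0 Xi pN x m v Lx vX.
have [->|v0] := eqVneq v 0.
  by rewrite linear0 !(norm0 (n_norm _)) !mulr0.
have [L1 _ D0 Da DL] := D_cocycle.
have := @geometric_mean_contraction R (fun j => n (iter j f x) (D j x v))
  (fun j => p (iter j f x)) L dl N L1 N0 _ _ _ _ m.
rewrite /= D0; apply => j //.
- rewrite (norm_gt0 (n_norm _)); apply: contra v0 => /eqP Dv0.
  by rewrite -(lker0_lfunK (cocycle_inj n_norm D_cocycle j Lx) v) Dv0 linear0.
- by rewrite -add1n Da /=; exact: DL (Lam_iter D_cocycle j Lx).
- rewrite addnC iter_add Da; apply: pN; first exact: (Lam_iter D_cocycle).
  exact: Xi.
Qed.

Lemma scaled_expansion (p : T -> R) (X : T -> {vspace V}) (dl : R) (N : nat) :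
  (0 < N)%N -> (forall x, 0 < p x) -> forward_invariant f Lam D X ->
  (forall x v, Lam x -> v \in X x ->
     n x v <= expR (- (N%:R * dl)) * (p x ^+ N * n (iter N f x) (D N x v))) ->
  forall x m v, Lam x -> v \in X x ->
    n x v <= L ^+ N ^+ 2 * expR (- (m%:R * dl)) *
      ((\prod_(l < m) p (iter l f x)) * n (iter m f x) (D m x v)).
Proof.
move=> N0 p0 Xi pN x m v Lx vX.
have [->|v0] := eqVneq v 0.
  by rewrite linear0 !(norm0 (n_norm _)) !mulr0.
have [L1 _ D0 Da DL] := D_cocycle.
have := @geometric_mean_expansion R (fun j => n (iter j f x) (D j x v))
  (fun j => p (iter j f x)) L dl N L1 N0 _ _ _ _ m.
rewrite /= D0; apply => j //.
- rewrite (norm_gt0 (n_norm _)); apply: contra v0 => /eqP Dv0.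
  by rewrite -(lker0_lfunK (cocycle_inj n_norm D_cocycle j Lx) v) Dv0 linear0.
- by rewrite -add1n Da /=; exact: DL (Lam_iter D_cocycle j Lx).
- rewrite addnC iter_add Da; apply: pN; first exact: (Lam_iter D_cocycle).
  exact: Xi.
Qed.

Hypothesis f_cvg : forall m x0, Lam x0 ->
  iter m f x @[x --> within Lam (nbhs x0)] --> iter m f x0.
Hypothesis D_cont : forall m x0, Lam x0 ->
  bundle_continuous_at Lam n tau (iter m f) (D m) x0.

Variables (k : nat) (X Y : nat -> T -> {vspace V}) (C K alpha : R).
Let Q i x := daddv_pi (X i x) (Y i x).
Hypothesis XY0 : forall i x, (i < k)%N -> Lam x -> (X i x :&: Y i x = 0)%VS.
Hypothesis XY1 : forall i x, (i < k)%N -> Lam x -> (X i x + Y i x = fullv)%VS.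
Hypothesis Q_cont : forall i x0, (i < k)%N -> Lam x0 ->
  bundle_continuous_at Lam n tau id (Q i) x0.
Hypothesis X_inv : forall i, forward_invariant f Lam D (X i).
Hypothesis Y_inv : forall i, forward_invariant f Lam D (Y i).
Hypothesis XY_angle : forall i, (i < k)%N -> angle_bounded Lam n K (X i) (Y i).
Hypothesis XY_dom : forall i, (i < k)%N ->
  dominated_pair f Lam n D C alpha (X i) (Y i).
Hypothesis X_mono : forall i x, (i.+1 < k)%N -> Lam x -> (X i x <= X i.+1 x)%VS.
Hypothesis C_ge0 : 0 <= C.
Hypothesis K_ge1 : 1 <= K.
Hypothesis alpha_gt0 : 0 < alpha.

(** Composing with the projector replaces the norm of the restriction to X, up to a factor [K], by
    an operator norm on the whole fibre, whose continuity follows from that of the projector. *)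
Let o N i x := lfun_norm (n x) (n (iter N f x)) (D N x \o Q i x)%VF.
(** Over N steps no vector shrinks by more than L^N, so this floor is at most e^(- N alpha) times
    the growth of any vector: adding it to the norm on X respects domination by Y. *)
Let c N := (expR (- alpha) / L) ^+ N.
Let h N i x := o N i x + c N.
(** The denominator keeps [e * i] below alpha / 4 for all i < k, so that separation leaves room for
    the expansion of Y. *)
Let e := alpha / (4 * k.+1%:R).

(* The N-th root of e^(- N alpha/2) / h, where h is the norm of D^N on X kept away
   from 0 in case X = 0; the factor e^(- i e) makes the sequence strictly decreasing. *)
Definition scaling N i x :=
  expR (- (alpha / 2) - ln (h N i x) / N%:R - e * i%:R).

Lemma cocycle_bound_gt0 : 0 < L.
Proof. by case: D_cocycle => L1 *; apply: lt_le_trans L1. Qed.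

Lemma norm_floor_gt0 N : 0 < c N.
Proof. by rewrite exprn_gt0// divr_gt0 ?expR_gt0// cocycle_bound_gt0. Qed.

Lemma floored_norm_gt0 N i x : 0 < h N i x.
Proof. by rewrite ltr_wpDl ?norm_floor_gt0// lfun_norm_ge0. Qed.

Lemma separation_step_gt0 : 0 < e.
Proof. by have a0 := alpha_gt0; rewrite divr_gt0// mulr_gt0. Qed.

Lemma scaling_gt0 N i x : 0 < scaling N i x. Proof. exact: expR_gt0. Qed.

Lemma scaling_exp N i x : (0 < N)%N -> scaling N i x ^+ N * h N i x =
  expR (- (N%:R * (alpha / 2)) - N%:R * (e * i%:R)).
Proof.
move=> N0; have NR : (N%:R : R) != 0 by rewrite pnatr_eq0 -lt0n.
rewrite /scaling -[X in _ * X = _]lnK ?posrE ?floored_norm_gt0// -expRM_natl -expRD; congr expR.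
by field.
Qed.

Lemma restricted_norm_bound N i x v : n (iter N f x) ((D N x \o Q i x)%VF v) <= o N i x * n x v.
Proof. exact: (le_lfun_norm (n_norm _) (n_norm _)). Qed.

Lemma proj_bound i x w : (i < k)%N -> Lam x ->
  n x (Q i x w) <= K * n x w /\ n x (daddv_pi (Y i x) (X i x) w) <= K * n x w.
Proof.
move=> ik Lx; have := @XY_angle i ik x Lx (Q i x w) (daddv_pi (Y i x) (X i x) w).
by rewrite !memv_pi daddv_pi_split ?XY0 ?XY1//; exact.
Qed.

(** Domination bounds the norm part, with the factor [K] of the projector; the floor accounts for
    the [+ 1]. *)
Lemma floored_norm_dominated N i x v : (i < k)%N -> Lam x -> v \in Y i x ->
  h N i x * n x v <= (C * K + 1) * expR (- (N%:R * alpha)) * n (iter N f x) (D N x v).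
Proof.
move=> ik Lx vY; have K1 := K_ge1; have C0 := C_ge0; have a0 := alpha_gt0.
have CK : 0 <= C * K by rewrite mulr_ge0//; lra.
have En : 0 <= expR (- (N%:R * alpha)) * n (iter N f x) (D N x v).
  by rewrite mulr_ge0 ?expR_ge0 ?(norm_ge0 (n_norm _)).
have [->|v0] := eqVneq v 0.
  by rewrite linear0 !(norm0 (n_norm _)) !mulr0.
have nv : 0 < n x v by rewrite (norm_gt0 (n_norm _)).
have oK : o N i x <= C * K * expR (- (N%:R * alpha)) * n (iter N f x) (D N x v) / n x v.
  apply: lfun_norm_le => //.
    by rewrite divr_ge0 ?(ltW nv)// -mulrA mulr_ge0.
  move=> w; rewrite comp_lfunE mulrAC ler_pdivlMr//.
  apply: le_trans (XY_dom ik Lx N (memv_pi _ _ _) vY) _.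
  have [h1 _] := proj_bound w ik Lx.
  have t1 := ler_wpM2l (mulr_ge0 C0 En) h1.
  by lra.
rewrite ler_pdivlMr// in oK.
have [_ h2] := cocycle_bound D_cocycle N v Lx.
have cE : c N * L ^+ N = expR (- (N%:R * alpha)).
  by rewrite -exprMn divfK ?gt_eqF ?cocycle_bound_gt0// -expRM_natl mulrN.
have t1 := ler_wpM2l (ltW (norm_floor_gt0 N)) h2.
by rewrite mulrA cE in t1; rewrite /h; lra.
Qed.

Lemma scaling_contracts N i x v : (0 < N)%N -> (i < k)%N -> Lam x -> v \in X i x ->
  scaling N i x ^+ N * n (iter N f x) (D N x v) <= expR (- (N%:R * (alpha / 2))) * n x v.
Proof.
move=> N0 ik Lx vX; have a0 := alpha_gt0.
have s0 : 0 < scaling N i x ^+ N by rewrite exprn_gt0// scaling_gt0.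
have h1 : n (iter N f x) (D N x v) <= h N i x * n x v.
  have := restricted_norm_bound N i x v; rewrite comp_lfunE /Q daddv_pi_id ?XY0//.
  by move/le_trans; apply; rewrite ler_wpM2r ?(norm_ge0 (n_norm _))// lerDl ltW// norm_floor_gt0.
apply: (@le_trans _ _ (scaling N i x ^+ N * h N i x * n x v)).
  by rewrite -mulrA ler_pM2l.
rewrite scaling_exp// ler_wpM2r ?(norm_ge0 (n_norm _))// ler_expR gerDl oppr_le0.
by rewrite !mulr_ge0// ltW// separation_step_gt0.
Qed.

(** Of the exponent alpha of domination, alpha / 2 goes to the scaling and at most alpha / 4 to the
    separation. Of what remains, one alpha / 8 absorbs [C * K + 1] and the other is the rate of
    expansion. *)
Lemma scaling_expands N i x v : (0 < N)%N -> (i < k)%N ->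
  (C * K + 1) * expR (- (N%:R * (alpha / 8))) <= 1 -> Lam x -> v \in Y i x ->
  n x v <= expR (- (N%:R * (alpha / 8))) *
    (scaling N i x ^+ N * n (iter N f x) (D N x v)).
Proof.
move=> N0 ik CKN Lx vY; have a0 := alpha_gt0.
have s0 : 0 < scaling N i x ^+ N by rewrite exprn_gt0// scaling_gt0.
have h1 := ler_wpM2l (ltW s0) (floored_norm_dominated N ik Lx vY).
rewrite mulrA scaling_exp// in h1.
have ik' : e * i%:R <= alpha / 4.
  rewrite /e invfM mulrA -mulrA ler_piMr ?divr_ge0 ?(ltW a0)//.
  by rewrite mulrC ler_pdivrMr// mul1r ler_nat ltnW// ltnW.
have NR : 0 <= (N%:R : R) by [].
have h2 : expR (- (N%:R * (alpha / 2)) - N%:R * (alpha / 4)) * n x v <=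
    expR (- (N%:R * (alpha / 2)) - N%:R * (e * i%:R)) * n x v.
  rewrite ler_wpM2r ?(norm_ge0 (n_norm _))// ler_expR lerD2l lerN2.
  by rewrite ler_wpM2l.
have h3 := le_trans h2 h1.
have E1 : expR (- (N%:R * (alpha / 2)) - N%:R * (alpha / 4)) =
    expR (- (N%:R * alpha)) * expR (N%:R * (alpha / 8)) * expR (N%:R * (alpha / 8)).
  by rewrite -!expRD; congr expR; field.
have E2 : expR (N%:R * (alpha / 8)) * expR (- (N%:R * (alpha / 8))) = 1.
  by rewrite -expRD addrN expR0.
set u := expR (- (N%:R * (alpha / 8))) in CKN E2 *.
set w := expR (N%:R * (alpha / 8)) in E1 E2.
set z := expR (- (N%:R * alpha)) in h3 E1.
have z0 : 0 < z by exact: expR_gt0.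
have u0 : 0 < u by exact: expR_gt0.
rewrite E1 in h3.
set q := n _ (D N x v) in h3 *; set S := scaling N i x ^+ N in s0 h3 *.
have q0 : 0 <= q by exact: norm_ge0.
have h4 : w * w * n x v <= (C * K + 1) * (S * q).
  by rewrite -(ler_pM2l z0); lra.
have h5 := ler_wpM2l (ltW (mulr_gt0 u0 u0)) h4.
have h6 := ler_wpM2l (mulr_ge0 (ltW u0) (mulr_ge0 (ltW s0) q0)) CKN.
have -> : n x v = (w * u) * (w * u) * n x v by rewrite E2 !mul1r.
by lra.
Qed.

(** Since X_i lies in X_(i+1), inserting the projector of X_(i+1) after that of X_i changes nothing;
    so the norm at i is at most [K] times the norm at i + 1, and the N-th root of [K] is small
    against the gap [e]. *)
Lemma scaling_separated N i x : (0 < N)%N -> (i.+1 < k)%N ->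
  K * expR (- (N%:R * (e / 2))) <= 1 -> Lam x ->
  e / 2 <= ln (scaling N i x) - ln (scaling N i.+1 x).
Proof.
move=> N0 ik KN Lx; have K1 := K_ge1; have e0 := separation_step_gt0.
have K0 : 0 < K by lra.
have NR : 0 < (N%:R : R) by rewrite ltr0n.
have hh : h N i x <= K * h N i.+1 x.
  rewrite mulrDr; apply: lerD; last by rewrite ler_peMl// ltW// norm_floor_gt0.
  apply: lfun_norm_le => //; first by rewrite mulr_ge0 ?(ltW K0)// lfun_norm_ge0.
  move=> w; have wX : Q i x w \in X i.+1 x.
    by have /subvP := X_mono ik Lx; apply; exact: memv_pi.
  have := restricted_norm_bound N i.+1 x (Q i x w).
  rewrite !comp_lfunE /= {1}/Q daddv_pi_id ?XY0// => h1.
  apply: le_trans h1 _.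
  have [h2 _] := proj_bound w (ltnW ik) Lx.
  have h3 : o N i.+1 x * n x (Q i x w) <= o N i.+1 x * (K * n x w).
    by apply: ler_wpM2l => //; exact: lfun_norm_ge0.
  by apply: le_trans h3 _; rewrite mulrCA mulrA.
have KE : ln K <= N%:R * (e / 2).
  rewrite -ler_expR lnK ?posrE//.
  by rewrite -[leRHS]mul1r -ler_pdivrMr ?expR_gt0// -expRN; exact: KN.
have lh : ln (h N i x) <= ln K + ln (h N i.+1 x).
  by rewrite -lnM ?posrE ?floored_norm_gt0// ler_ln ?posrE ?mulr_gt0 ?floored_norm_gt0.
rewrite /scaling !expRK -[i.+1%:R]natr1.
exact: (log_scaling_gap _ _ NR lh KE).
Qed.

Lemma scaling_cvg N i x0 : (i < k)%N -> Lam x0 ->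
  scaling N i x @[x --> within Lam (nbhs x0)] --> scaling N i x0.
Proof.
move=> ik Lx0.
have SQ : bundle_continuous_at Lam n tau (iter N f) (fun x => D N x \o Q i x)%VF x0.
  have id_cvg : id x @[x --> within Lam (nbhs x0)] --> id x0 by exact: cvg_within.
  have H := bundle_continuous_comp n_norm n_bounded id_cvg (Q_cont ik Lx0).
  apply: (H (iter N f) (D N)) => //.
  - exact: f_cvg.
  - exact: (bundle_continuous_bounded n_norm tau_near n_bounded (@f_cvg N x0 Lx0) (@D_cont N x0 Lx0)).
  - exact: D_cont.
have oc := lfun_norm_cvg n_norm tau_near n_bounded (@f_cvg N x0 Lx0) SQ.
have hc : h N i x @[x --> within Lam (nbhs x0)] --> h N i x0.
  by apply: cvgD => //; exact: cvg_cst.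
have lc : ln (h N i x) @[x --> within Lam (nbhs x0)] --> ln (h N i x0).
  exact: (cvg_comp _ _ hc (continuous_ln (floored_norm_gt0 N i x0))).
suff ec : - (alpha / 2) - ln (h N i x) / N%:R - e * i%:R
    @[x --> within Lam (nbhs x0)] --> - (alpha / 2) - ln (h N i x0) / N%:R - e * i%:R.
  exact: (cvg_comp _ _ ec (@continuous_expR R _)).
apply: cvgB; last exact: cvg_cst.
apply: cvgB; first exact: cvg_cst.
exact: cvgMl.
Qed.

Lemma separated_scalings : exists (p : nat -> T -> R) (C' dl gm : R),
  [/\ 0 < dl, 0 < gm, forall i x, 0 < p i x,
    forall i x0, (i < k)%N -> Lam x0 ->
      p i x @[x --> within Lam (nbhs x0)] --> p i x0 &
    [/\ 0 <= C', forall i x, (i.+1 < k)%N -> Lam x -> gm <= ln (p i x) - ln (p i.+1 x),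
    forall i x m v, (i < k)%N -> Lam x -> v \in X i x ->
      (\prod_(l < m) p i (iter l f x)) * n (iter m f x) (D m x v) <=
      C' * expR (- (m%:R * dl)) * n x v &
    forall i x m v, (i < k)%N -> Lam x -> v \in Y i x ->
      n x v <= C' * expR (- (m%:R * dl)) *
        ((\prod_(l < m) p i (iter l f x)) * n (iter m f x) (D m x v))]].
Proof.
have a0 := alpha_gt0; have e0 := separation_step_gt0.
have a8 : 0 < alpha / 8 by rewrite divr_gt0.
have e2 : 0 < e / 2 by rewrite divr_gt0.
(* The threshold [N1] serves the expansion of Y, and [N2] the separation. *)
have [N1 HN1] := exp_decay (C * K + 1) a8 (ltr01 : 0 < (1 : R)).
have [N2 HN2] := exp_decay K e2 (ltr01 : 0 < (1 : R)).
pose N := (N1 + N2).+1.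
have N1N : (N1 <= N)%N by rewrite /N -addnS leq_addr.
have N2N : (N2 <= N)%N by rewrite /N -addSn leq_addl.
exists (scaling N), (L ^+ N ^+ 2), (alpha / 8), (e / 2); split => //.
- by move=> i x; exact: scaling_gt0.
- by move=> i x0; exact: scaling_cvg.
split.
- by rewrite !exprn_ge0// ltW// cocycle_bound_gt0.
- by move=> i x ik Lx; apply: scaling_separated => //; exact: HN2.
- move=> i x m v ik Lx vX.
  apply: (@scaled_contraction (scaling N i) (X i)) => //.
  + by move=> y; exact: scaling_gt0.
  + move=> y w Ly wX; apply: le_trans (@scaling_contracts N i y w _ ik Ly wX) _ => //.
    rewrite ler_wpM2r ?(norm_ge0 (n_norm _))// ler_expR lerN2 ler_wpM2l//.
    by lra.
- move=> i x m v ik Lx vY.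
  apply: (@scaled_expansion (scaling N i) (Y i)) => //.
  + by move=> y; exact: scaling_gt0.
  + by move=> y w Ly wY; apply: scaling_expands => //; exact: HN1.
Qed.

End Scalings.

(** * Monotonicity of the stable and unstable spaces *)

Lemma le_exp_decay_eq0 (R : realType) (t C alpha : R) : 0 < alpha -> 0 <= t ->
  (forall m : nat, t <= C * expR (- (m%:R * alpha))) -> t = 0.
Proof.
move=> a0 t0 H; apply/eqP; rewrite eq_le t0 andbT; apply/ler_addgt0Pr => e e0.
have [m /(_ m (leqnn m)) h] := exp_decay C a0 e0.
by rewrite add0r; apply: le_trans h.
Qed.

Section HyperbolicGrowth.
Context {R : realType} {T : Type} {V : vectType R}.
Variables (f : T -> T) (Lam : set T) (n : T -> V -> R) (D : nat -> T -> 'End(V)).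
Hypothesis n_norm : forall x, is_norm (n x).
Hypothesis f_Lam : forall m x, Lam x -> Lam (iter m f x).
Hypothesis f_surj : forall m x, Lam x -> exists2 y, Lam y & iter m f y = x.

Let c (p : T -> R) m x := \prod_(l < m) p (iter l f x).

(** Both estimates concern vectors of the two spaces at [x] and their growth, the form in which two
    scalings can be compared; the operator norms of [hyperbolicity] also involve the angle. *)
Definition hyperbolic_growth (p : T -> R) (C alpha : R) (S U : T -> {vspace V}) :=
  forall x m, Lam x ->
    (forall v, v \in S x ->
       c p m x * n (iter m f x) (D m x v) <= C * expR (- (m%:R * alpha)) * n x v) /\
    (forall v, v \in U x ->
       n x v <= C * expR (- (m%:R * alpha)) * (c p m x * n (iter m f x) (D m x v))).

Variables (p q : T -> R) (B C C' alpha alpha' : R) (S U S' U' : T -> {vspace V}).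
Hypothesis p_gt0 : forall x, Lam x -> 0 < p x.
Hypothesis q_gt0 : forall x, Lam x -> 0 < q x.
Hypothesis B_ge0 : 0 <= B.
Hypothesis q_le_p : forall m x, Lam x -> c q m x <= B * c p m x.
Hypothesis C_ge0 : 0 <= C.
Hypothesis C'_ge0 : 0 <= C'.
Hypothesis alpha_gt0 : 0 < alpha.
Hypothesis alpha'_gt0 : 0 < alpha'.
Hypothesis p_hyp : hyperbolic_growth p C alpha S U.
Hypothesis q_hyp : hyperbolic_growth q C' alpha' S' U'.

Lemma scaling_prod_gt0 (p' : T -> R) m x : (forall x, Lam x -> 0 < p' x) -> Lam x ->
  0 < c p' m x.
Proof. by move=> p'0 Lx; apply: prodr_gt0 => l _; exact/p'0/f_Lam. Qed.

Lemma exp_le1 (a : R) m : 0 < a -> expR (- (m%:R * a)) <= 1.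
Proof. by move=> a0; rewrite -expR0 ler_expR oppr_le0 mulr_ge0// ltW. Qed.

(* On the stable space of p the q-orbit stays bounded in the future, which kills
   the component along U'. *)
Lemma stable_subspace_mono x : Lam x -> (S' x + U' x = fullv)%VS -> (S x <= S' x)%VS.
Proof.
move=> Lx SU; apply/subvP => u uS.
have /memv_addP[a aS' [b bU' uE]] : u \in (S' x + U' x)%VS by rewrite SU memvf.
suff /eqP : n x b = 0 by rewrite (norm_eq0 (n_norm x)) uE => /eqP ->; rewrite addr0.
apply: (@le_exp_decay_eq0 _ _ (C' * (B * (C * n x u) + C' * n x a)) alpha') => //.
  exact: (norm_ge0 (n_norm x)).
move=> m; have [_ /(_ b bU') h1] := q_hyp m Lx.
have [/(_ a aS') h2 _] := q_hyp m Lx; have [/(_ u uS) h3 _] := p_hyp m Lx.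
have bE : b = u - a by rewrite uE addrC addKr.
have N := n_norm (iter m f x).
have h4 : n (iter m f x) (D m x b) <=
    n (iter m f x) (D m x u) + n (iter m f x) (D m x a).
  by rewrite {1}bE linearB; exact: normB.
have cq := scaling_prod_gt0 m q_gt0 Lx; have cp := scaling_prod_gt0 m p_gt0 Lx.
have cqp := q_le_p m Lx.
have nu := norm_ge0 (n_norm x) u; have na := norm_ge0 (n_norm x) a.
have E1 := exp_le1 m alpha_gt0; have E2 := exp_le1 m alpha'_gt0.
have C0 := C_ge0; have C'0 := C'_ge0; have B0 := B_ge0.
have g2 : c q m x * n (iter m f x) (D m x a) <= C' * n x a.
  apply: le_trans h2 _; rewrite ler_wpM2r//; exact: ler_piMr.
have g3 : c q m x * n (iter m f x) (D m x u) <= B * (C * n x u).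
  apply: (@le_trans _ _ (B * c p m x * n (iter m f x) (D m x u))).
    by rewrite ler_wpM2r// (norm_ge0 N).
  rewrite -mulrA ler_wpM2l//; apply: le_trans h3 _.
  by rewrite ler_wpM2r//; exact: ler_piMr.
apply: le_trans h1 _; rewrite [leRHS]mulrAC ler_wpM2l//.
  by rewrite mulr_ge0// expR_ge0.
have := ler_wpM2l (ltW cq) h4; lra.
Qed.

Hypothesis D_inj : forall m x, Lam x -> lker (D m x) == 0%VS.
Hypothesis S_inv : forall m x, Lam x -> (D m x @: S x)%VS = S (iter m f x).
Hypothesis U_inv : forall m x, Lam x -> (D m x @: U x)%VS = U (iter m f x).
Hypothesis U'_inv : forall m x, Lam x -> (D m x @: U' x)%VS = U' (iter m f x).

(** At the m-th preimage, b and its U-component come from vectors of size at most a constant times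
    the product of the p. So does the S-component, and contraction over m steps then bounds it by a
    multiple of e^(- m alpha), for every m. *)
Lemma unstable_subspace_mono x : Lam x -> (S x + U x = fullv)%VS -> (U' x <= U x)%VS.
Proof.
move=> Lx SU; apply/subvP => b bU'.
have /memv_addP[a aS [b' bU bE]] : b \in (S x + U x)%VS by rewrite SU memvf.
suff /eqP : n x a = 0 by rewrite (norm_eq0 (n_norm x)) bE => /eqP ->; rewrite add0r.
apply: (@le_exp_decay_eq0 _ _ (C * (C' * (B * n x b) + C * n x b')) alpha) => //.
  exact: (norm_ge0 (n_norm x)).
move=> m; have [y Ly xE] := f_surj m Lx.
move: aS bU bU'; rewrite -xE -(S_inv m Ly) -(U_inv m Ly) -(U'_inv m Ly).
move=> /memv_imgP[a0 a0S aE] /memv_imgP[b0 b0U b'E] /memv_imgP[w0 w0U' wE].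
have w0E : w0 = a0 + b0.
  have Dinj : injective (D m y) by apply/lker0P; exact: D_inj.
  by apply: Dinj; rewrite linearD /= -aE -b'E -wE.
have [/(_ a0 a0S) h1 /(_ b0 b0U) h2] := p_hyp m Ly.
have [_ /(_ w0 w0U') h3] := q_hyp m Ly.
rewrite xE -aE in h1; rewrite xE -b'E in h2; rewrite xE -wE in h3.
rewrite xE.
have cq := scaling_prod_gt0 m q_gt0 Ly; have cp := scaling_prod_gt0 m p_gt0 Ly.
have cqp := q_le_p m Ly.
have nb := norm_ge0 (n_norm x) b; have nb' := norm_ge0 (n_norm x) b'.
have E1 := exp_le1 m alpha_gt0; have E2 := exp_le1 m alpha'_gt0.
have C0 := C_ge0; have C'0 := C'_ge0; have B0 := B_ge0.
have h4 : n y a0 <= n y w0 + n y b0.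
  by have := normB (n_norm y) w0 b0; rewrite w0E addrK.
have g2 : n y b0 <= c p m y * (C * n x b').
  apply: le_trans h2 _; rewrite mulrCA ler_pM2l//.
  by rewrite ler_wpM2r//; exact: ler_piMr.
have g3 : n y w0 <= c p m y * (C' * (B * n x b)).
  apply: le_trans h3 _.
  apply: (@le_trans _ _ (C' * (c q m y * n x b))).
    by rewrite ler_wpM2r ?mulr_ge0 ?(ltW cq)//; exact: ler_piMr.
  have := ler_wpM2l C'0 (ler_wpM2r nb cqp); lra.
rewrite -(ler_pM2l cp); apply: le_trans h1 _.
have CE : 0 <= C * expR (- (m%:R * alpha)) by rewrite mulr_ge0// expR_ge0.
have := ler_wpM2l CE (le_trans h4 (lerD g3 g2)); lra.
Qed.

End HyperbolicGrowth.

(** * Splittings obtained from nested complementary pairs *)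

Section NestedSplitting.
Context {R : realType} {V : vectType R}.
Variables (k : nat) (S U : nat -> {vspace V}) (ns : nat -> nat).
Hypothesis S0 : S 0 = 0%VS.
Hypothesis SU0 : forall s, (s <= k)%N -> (S s :&: U s = 0)%VS.
Hypothesis SU1 : forall s, (s <= k)%N -> (S s + U s = fullv)%VS.
Hypothesis S_mono : forall s, (s < k)%N -> (S s <= S s.+1)%VS.
Hypothesis S_dim : forall s, (s <= k)%N -> \dim (S s) = (\sum_(j < s) ns j)%N.

(** By the modular law, S_s + (S_(s+1) cap U_s) = S_(s+1) cap (S_s + U_s) = S_(s+1). *)
Lemma nested_sum s : (s <= k)%N -> (\sum_(i < s) (S i.+1 :&: U i) = S s)%VS.
Proof.
elim: s => [|s IH] sk; first by rewrite big_ord0 S0.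
rewrite big_ord_recr /= IH ?(ltnW sk)// capvC vspace_modl ?S_mono//.
by rewrite SU1 ?(ltnW sk)// capfv.
Qed.

Lemma nested_dim i : (i < k)%N -> \dim (S i.+1 :&: U i) = ns i.
Proof.
move=> ik.
have E : (S i + (S i.+1 :&: U i) = S i.+1)%VS.
  by rewrite capvC vspace_modl ?S_mono// SU1 ?(ltnW ik)// capfv.
have EI : (S i :&: (S i.+1 :&: U i) = 0)%VS.
  by apply/eqP; rewrite -subv0 -(SU0 (ltnW ik)) capvS// capvSr.
have := S_dim ik; rewrite -{1}E dimv_disjoint_sum//.
by rewrite (S_dim (ltnW ik)) big_ord_recr => /= /addnI.
Qed.

Lemma nested_directv : directv (\sum_(i < k) (S i.+1 :&: U i)).
Proof.
rewrite directvE /=; apply/eqP; rewrite nested_sum// S_dim//.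
by apply: eq_bigr => i _; rewrite nested_dim.
Qed.

End NestedSplitting.

(** * The tangent cocycle of a diffeomorphism *)

Lemma near_withinW (T : topologicalType) (A : set T) (x0 : T) (P : T -> Prop) :
  (\forall x \near x0, P x) -> \forall x \near within A (nbhs x0), P x.
Proof. exact: cvg_within. Qed.

Section TangentCocycle.
Context {R : realType} {d : nat} {M : closed_manifold R d}.
Variable g : continuous_inner_product M.

Local Notation V := ('rV[R]_d : vectType R).

(** All fibres are copies of one space; norm, derivative and transport are restated over [V], the
    form in which the abstract results apply. *)
Definition fiber_norm (x : M) (v : V) : R := @tnorm R d M g x v.
Definition tangent_map (phi : M -> M) (x : M) : 'End(V) := tanmap phi x.
Definition fiber_transport (x0 x : M) : 'End(V) := transport x0 x.

Lemma fiber_norm_is_norm x : is_norm (fiber_norm x).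
Proof.
split; [exact: tnorm_ge0|exact: tnormZ|exact: tnormD|exact: tnorm_eq0].
Qed.

Lemma fiber_transport_near x0 (e : R) : 0 < e -> \forall x \near x0, forall u,
  `|fiber_norm x (fiber_transport x0 x u) - fiber_norm x0 u| <= e * fiber_norm x0 u.
Proof. exact: transport_tnorm_near. Qed.

Lemma fiber_norm_bounded x y (S : 'End(V)) :
  exists2 c : R, 0 <= c & forall v, fiber_norm y (S v) <= c * fiber_norm x v.
Proof.
have [c c0 cN] := coord_le_inner_norm (@ip_linear _ _ _ g x)
  (@ip_sym _ _ _ g x) (@ip_pos _ _ _ g x).
have N := fiber_norm_is_norm y.
exists (\sum_a c * fiber_norm y (S (delta_mx 0 a))).
  by rewrite sumr_ge0// => a _; rewrite mulr_ge0 ?(ltW c0)// (norm_ge0 N).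
move=> v; rewrite {1}[v]row_sum_delta linear_sum mulr_suml.
apply: (@le_trans _ _ (\sum_i fiber_norm y (S (v 0 i *: delta_mx 0 i)))).
  elim/big_ind2 : _ => [|u p w q up wq|//]; first by rewrite (norm0 N).
  by apply: le_trans (normD N _ _) _; exact: lerD.
apply: ler_sum => a _; rewrite linearZ (normZ N) mulrAC.
by apply: ler_wpM2r; [exact: norm_ge0|exact: cN].
Qed.

Lemma differentiable_map_iter (phi : M -> M) m :
  differentiable_map phi -> differentiable_map (iter m phi).
Proof.
move=> dphi; elim: m => [|m IH].
  exact: C1_differentiable_map C1_map_id.
exact: differentiable_map_comp IH dphi.
Qed.

Lemma tangent_map_comp (phi psi : M -> M) x u :
  differentiable_map phi -> differentiable_map psi ->
  tangent_map (psi \o phi) x u = tangent_map psi (phi x) (tangent_map phi x u).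
Proof. exact: tanmap_comp. Qed.

Lemma tangent_map_id x u : tangent_map id x u = u.
Proof. exact: tanmap_id. Qed.

Lemma tangent_map_near (chi : M -> M) x0 (e : R) : C1_map chi -> 0 < e ->
  \forall x \near x0, forall u : V,
    fiber_norm (chi x) (tangent_map chi x (fiber_transport x0 x u) -
      fiber_transport (chi x0) (chi x) (tangent_map chi x0 u)) <= e * fiber_norm x0 u.
Proof. by move=> chi_C1 e0; exact: (transport_tanmap_near g x0 chi_C1 e0). Qed.

Local Opaque fiber_norm tangent_map fiber_transport.

Lemma tangent_map_iter_add (phi : M -> M) (a b : nat) x u :
  differentiable_map phi ->
  tangent_map (iter (a + b) phi) x u =
  tangent_map (iter a phi) (iter b phi x) (tangent_map (iter b phi) x u).
Proof.
move=> dphi.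
have -> : iter (a + b) phi = iter a phi \o iter b phi.
  by apply/funext => y; exact: iter_add.
by apply: tangent_map_comp; exact: differentiable_map_iter.
Qed.

Section C1Map.
Variables (phi psi : M -> M) (Lam : set M).
Hypothesis phi_C1 : C1_map phi.
Hypothesis psi_C1 : C1_map psi.
Hypothesis phiK : cancel phi psi.
Hypothesis phi_Lam : forall x, Lam x -> Lam (phi x).
Hypothesis psi_Lam : forall x, Lam x -> Lam (psi x).
Hypothesis Lam_compact : compact Lam.

Let dphi := C1_differentiable_map phi_C1.
Let dpsi := C1_differentiable_map psi_C1.

Lemma tangent_mapK x u : tangent_map psi (phi x) (tangent_map phi x u) = u.
Proof.
rewrite -tangent_map_comp// (_ : psi \o phi = id) ?tangent_map_id//.
by apply/funext => y; exact: phiK.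
Qed.

Lemma within_iter_cvg m x0 :
  iter m phi x @[x --> within Lam (nbhs x0)] --> iter m phi x0.
Proof.
apply: cvg_within_filter; exact: ((differentiable_map_iter m dphi).1 x0).
Qed.

Lemma tangent_map_cont (chi : M -> M) x0 : C1_map chi ->
  bundle_continuous_at Lam fiber_norm fiber_transport chi (tangent_map chi) x0.
Proof.
move=> chi_C1 e e0.
exact: (near_withinW _ (tangent_map_near x0 chi_C1 e0)).
Qed.

Lemma tangent_map_compact_bound (chi : M -> M) : C1_map chi ->
  exists2 c : R, 1 <= c & forall x, Lam x -> forall v,
    fiber_norm (chi x) (tangent_map chi x v) <= c * fiber_norm x v.
Proof.
move=> chi_C1.
apply: (bundle_continuous_compact_bounded fiber_norm_is_norm fiber_transport_near
  fiber_norm_bounded Lam_compact) => x0 _.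
  by apply: cvg_within_filter; exact: (C1_differentiable_map chi_C1).1.
exact: tangent_map_cont.
Qed.

(** Iterates are reached by composing continuous bundle maps, with the bound on the derivative over
    Lam supplied by compactness. *)
Lemma tangent_map_iter_cont m x0 : Lam x0 ->
  bundle_continuous_at Lam fiber_norm fiber_transport (iter m phi)
    (tangent_map (iter m phi)) x0.
Proof.
move=> Lx0; elim: m => [|m IH].
  by apply: tangent_map_cont; exact: C1_map_id.
have [c c1 cP] := tangent_map_compact_bound phi_C1.
have h := bundle_continuous_comp fiber_norm_is_norm fiber_norm_bounded
  (@within_iter_cvg m x0) IH (b := phi) (P := tangent_map phi).
have -> : tangent_map (iter m.+1 phi) =
    fun x => (tangent_map phi (iter m phi x) \o tangent_map (iter m phi) x)%VF.
  apply/funext => x; apply/lfunP => u; rewrite comp_lfunE.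
  by apply: (tangent_map_comp _ _ (differentiable_map_iter m dphi) dphi).
apply: h.
- by elim: m {IH} => //= m IH x /IH; exact: phi_Lam.
- by apply: cvg_within_filter; exact: dphi.1.
- exists c; first by apply: le_trans c1.
  by apply: filterS (withinT _ _) => y; exact: cP.
- exact: tangent_map_cont.
Qed.

Lemma tangent_map_cocycle : exists L : R,
  bounded_cocycle phi Lam fiber_norm (fun m => tangent_map (iter m phi)) L.
Proof.
have [c1 c1_ge1 c1P] := tangent_map_compact_bound phi_C1.
have [c2 c2_ge1 c2P] := tangent_map_compact_bound psi_C1.
(* The bound on the derivative of [psi] is the bound on the inverse of one step. *)
exists (c1 + c2); split => //.
- lra.
- exact: tangent_map_id.
- by move=> a b x v; exact: tangent_map_iter_add.
move=> x v Lx; split.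
  apply: le_trans (c1P x Lx v) _; rewrite ler_wpM2r ?(norm_ge0 (fiber_norm_is_norm _))//.
  by rewrite lerDl; lra.
have h := c2P (phi x) (phi_Lam Lx) (tangent_map phi x v).
apply: le_trans (le_trans _ h) _.
  have -> // : fiber_norm (psi (phi x)) (tangent_map psi (phi x) (tangent_map phi x v)) =
    fiber_norm x v by exact: f_equal2 (phiK x) (tangent_mapK x v).
rewrite ler_wpM2r ?(norm_ge0 (fiber_norm_is_norm _))//.
by rewrite lerDr; lra.
Qed.

End C1Map.
End TangentCocycle.

Lemma norm_lfun_sub_le (R : realType) (V : vectType R) (n : V -> R) (S : 'End(V))
    (a b t : V) (c e e1 e2 : R) : is_norm n -> 0 <= c ->
  n (S (a - b)) <= c * n (a - b) -> n (a - b) <= e1 -> n (S b - t) <= e2 ->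
  c * e1 <= e / 2 -> e2 <= e / 2 -> n (S a - t) <= e.
Proof.
move=> N c0 h1 h2 h3 p1 p2.
have -> : S a - t = S (a - b) + (S b - t) by rewrite linearB addrA subrK.
have := normD N (S (a - b)) (S b - t); have := ler_wpM2l c0 h2; lra.
Qed.

(** * Continuous subbundles from continuous projectors *)

Section Subbundle.
Context {R : realType} {d : nat} {M : closed_manifold R d}.
Variable g : continuous_inner_product M.

Local Notation V := ('rV[R]_d : vectType R).
Local Notation nrm := (@fiber_norm R d M g).
Local Notation tau := (@fiber_transport R d M).

Lemma frame_chart_diff i x1 x (u : 'rV[R]_d) : mdom i x -> mdom (mbase x1) x ->
  frame i x u = tau x1 x (chart_diff id i (mbase x1) x u).
Proof.
move=> ix bx; apply: etrans _ (esym (transportE _ _ _)).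
exact: (congr1 (fun h => h u) (chart_diff_comp (C1_differentiable_map C1_map_id)
  (C1_differentiable_map C1_map_id) ix bx (mdom_base x)).2).
Qed.

(** The transports from [x0] and from [x1] differ by a change of charts with continuous derivative.
    Hence transporting a fixed vector from [x0] gives a continuous section on the chart domain, not
    only at [x0]. *)
Lemma transport_section_near x0 x1 (b : 'rV[R]_d) (e : R) :
  mdom (mbase x0) x1 -> 0 < e ->
  \forall x \near x1, nrm x (tau x0 x b - tau x1 x (tau x0 x1 b)) <= e.
Proof.
move=> ix1 e0; set i := mbase x0.
pose e' := e / (2 * (nrm x1 b + 1)).
have nb : 0 <= nrm x1 b by exact: tnorm_ge0.
have nb1 : 0 < 2 * (nrm x1 b + 1) by rewrite mulr_gt0// ltr_wpDl.
have e'0 : 0 < e' by rewrite divr_gt0.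
have nl := @linear_family_near R d M g M (nbhs x1) _ (fun x => chart_diff id i (mbase x1) x)
  (chart_diff id i (mbase x1) x1) x1 x1 (fun x => @chart_diff_linear _ _ _ id i _ x)
  (@chart_diff_linear _ _ _ id i _ x1) (fun a k =>
    @chart_diff_coord_cvg R d M id i (mbase x1) x1 (delta_mx 0 a) k C1_map_id ix1 (mdom_base x1))
  _ e'0.
have nh := tau_half (@fiber_norm_is_norm R d M g) (@fiber_transport_near R d M g) x1.
have ni := near_mdom ix1.
have nx1 := near_mdom (mdom_base x1).
near=> x.
have ix : mdom i x by near: x.
have bx : mdom (mbase x1) x by near: x.
have E1 : tau x0 x b = tau x1 x (chart_diff id i (mbase x1) x b).
  apply: etrans (transportE _ _ _) _; exact: frame_chart_diff.
have E2 : tau x0 x1 b = chart_diff id i (mbase x1) x1 b.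
  exact: transportE.
apply: (comp_subr_le (n := nrm x) E1 E2); set w := _ - _.
have h1 : forall u, nrm x1 (chart_diff id i (mbase x1) x u - chart_diff id i (mbase x1) x1 u)
    <= e' * nrm x1 u by near: x; exact: nl.
have h2 : forall u, nrm x (tau x1 x u) <= 2 * nrm x1 u /\
    nrm x1 u <= 2 * nrm x (tau x1 x u) by near: x; exact: nh.
have [h3 _] := h2 w; apply: le_trans h3 _.
have h4 : nrm x1 w <= e' * nrm x1 b := h1 b.
have h5 : e' * nrm x1 b <= e / 2.
  rewrite /e' invfM mulrA -mulrA ler_piMr ?divr_ge0 ?(ltW e0)//.
  by rewrite mulrC ler_pdivrMr ?ltr_wpDl// mul1r lerDl.
by lra.
Unshelve. all: by end_near. Qed.

Lemma continuous_section_fiber (A : set M) (s : M -> V) :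
  (forall x0, A x0 -> forall e : R, 0 < e ->
    \forall x \near within A (nbhs x0), nrm x (s x - tau x0 x (s x0)) <= e) ->
  continuous_section A (s : forall x : M, tangent x).
Proof. exact: continuous_section_transport. Qed.

Lemma near_within_sub (T : topologicalType) (A B : set T) (x0 : T) (P : T -> Prop) :
  A `<=` B -> (\forall x \near within B (nbhs x0), P x) ->
  \forall x \near within A (nbhs x0), P x.
Proof.
move=> AB h; have h' : \forall x \near x0, B x -> P x := h.
by have : \forall x \near x0, A x -> P x by apply: filterS h' => x h' /AB.
Qed.

Lemma mktuple_map_nth (W : eqType) (S : V -> W) (b : seq V) (r : nat) : size b = r ->
  [tuple S (b`_l) | l < r] = [seq S v | v <- b] :> seq W.
Proof.
move=> sb; rewrite /= -[RHS](@map_id_in _ id) ?map_id//.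
rewrite -{2}(mkseq_nth 0 b) sb /mkseq -val_enum_ord -!map_comp.
by apply: eq_map.
Qed.

Local Opaque fiber_norm fiber_transport tangent_map.

(** A basis of [X x0], transported and then projected to [X x], is a local frame: near [x0] this map
    is injective on [X x0], and the dimension is constant. *)
Lemma continuous_subbundle_proj (Lam : set M) (X Y : M -> {vspace V}) (r : nat) :
  (forall x, Lam x -> (X x :&: Y x = 0)%VS) ->
  (forall x, Lam x -> \dim (X x) = r) ->
  (forall x0, Lam x0 ->
     bundle_continuous_at Lam nrm tau id (fun x => daddv_pi (X x) (Y x)) x0) ->
  continuous_subbundle Lam X.
Proof.
move=> XY0 dimX Q_cont x0 Lx0.
pose Q x := daddv_pi (X x) (Y x).
(* A vector w of [X x0] killed by the projection would have norm at most twice that of its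
   transport, hence at most half its own norm. *)
have q0 : 0 < 4^-1 :> R by rewrite invr_gt0.
have n1 := Q_cont x0 Lx0 _ q0.
have n2 : \forall x \near within Lam (nbhs x0), forall u,
    nrm x (tau x0 x u) <= 2 * nrm x0 u /\ nrm x0 u <= 2 * nrm x (tau x0 x u).
  apply: near_withinW; exact: (tau_half (@fiber_norm_is_norm R d M g)
    (@fiber_transport_near R d M g) x0).
pose b := vbasis (X x0).
have sb : size b = r by rewrite size_tuple dimX.
have n3 : \forall x \near within Lam (nbhs x0), basis_of (X x)
    [seq (Q x \o tau x0 x)%VF v | v <- b].
  apply: filterS3 (withinT Lam (nbhs_filter x0)) n1 n2 => x Lx h1 h2.
  have cap0 : (X x0 :&: lker (Q x \o tau x0 x) = 0)%VS.
    apply/eqP; rewrite -subv0; apply/subvP => w; rewrite memv_cap memv_ker.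
    rewrite comp_lfunE memv0 => /andP[wX /eqP Qw].
    have := h1 w; rewrite -/(Q x) Qw daddv_pi_id ?XY0//.
    rewrite sub0r (normN (@fiber_norm_is_norm R d M g x)) => h3.
    have [_ h4] := h2 w.
    have w0 := norm_ge0 (@fiber_norm_is_norm R d M g x0) w.
    by rewrite -(norm_eq0 (@fiber_norm_is_norm R d M g x0)) eq_le w0 andbT; lra.
  have -> : X x = ((Q x \o tau x0 x)%VF @: X x0)%VS.
    apply/eqP; rewrite eq_sym eqEdim limg_dim_eq// !dimX// leqnn andbT.
    by apply/subvP => _ /memv_imgP[w _ ->]; rewrite comp_lfunE; exact: memv_pi.
  by apply: limg_basis_of => //; exact: vbasisP.
(* The chart domain is included because the transport from [x0] must be a change of charts at each
   point of the neighbourhood. *)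
pose W := [set x | (Lam x -> basis_of (X x)
    [seq (Q x \o tau x0 x)%VF v | v <- b]) /\ mdom (mbase x0) x].
have n4 : nbhs x0 W.
  by apply: filterI; [exact: n3|exact: near_mdom (mdom_base x0)].
exists W°, r, (fun (l : 'I_r) (y : M) => Q y (tau x0 y b`_l) : tangent y); split.
- by split; [exact: open_interior|exact: n4].
- move=> l; apply: continuous_section_fiber => x1 [Lx1 Wx1] e e0.
  have AL : Lam `&` W° `<=` Lam by move=> x [].
  have [_ ix1] := interior_subset Wx1.
  have [c c0 n5] := bundle_continuous_bounded (@fiber_norm_is_norm R d M g)
    (@fiber_transport_near R d M g) (@fiber_norm_bounded R d M g)
    (cvg_within _ : id x @[x --> within Lam (nbhs x1)] --> id x1) (Q_cont x1 Lx1).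
  pose w := tau x0 x1 b`_l.
  have nw : 0 <= nrm x1 w := norm_ge0 (@fiber_norm_is_norm R d M g x1) w.
  have e1 : 0 < e / (2 * (c + 1)) by rewrite divr_gt0// mulr_gt0// ltr_wpDl.
  have e2 : 0 < e / (2 * (nrm x1 w + 1)) by rewrite divr_gt0// mulr_gt0// ltr_wpDl.
  have n6 : \forall x \near within Lam (nbhs x1),
      nrm x (tau x0 x b`_l - tau x1 x w) <= e / (2 * (c + 1)).
    by apply: near_withinW; exact: transport_section_near.
  apply: near_within_sub AL _.
  have p1 : c * (e / (2 * (c + 1))) <= e / 2.
    have -> : c * (e / (2 * (c + 1))) = e / 2 * (c / (c + 1)).
      by field; rewrite gt_eqF// ltr_wpDl.
    apply: ler_piMr; first by rewrite divr_ge0// ltW.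
    by rewrite ler_pdivrMr ?ltr_wpDl// mul1r lerDl.
  have p2 : e / (2 * (nrm x1 w + 1)) * nrm x1 w <= e / 2.
    have -> : e / (2 * (nrm x1 w + 1)) * nrm x1 w = e / 2 * (nrm x1 w / (nrm x1 w + 1)).
      by field; rewrite gt_eqF// ltr_wpDl.
    apply: ler_piMr; first by rewrite divr_ge0// ltW.
    by rewrite ler_pdivrMr ?ltr_wpDl// mul1r lerDl.
  apply: filterS3 n5 n6 (Q_cont x1 Lx1 _ e2) => x h1 h2 h3.
  exact: (norm_lfun_sub_le (@fiber_norm_is_norm R d M g x) c0 (h1 _) h2 (h3 w) p1 p2).
- move=> y [Ly /interior_subset [/(_ Ly) bX _]].
  rewrite -(@mktuple_map_nth _ (Q y \o tau x0 y)%VF _ _ sb) in bX.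
  have E : [tuple (Q y \o tau x0 y)%VF b`_l | l < r] =
      [tuple Q y (tau x0 y b`_l) | l < r] :> r.-tuple V.
    by apply: eq_mktuple => l; exact: comp_lfunE.
  rewrite E in bX; exact: bX.
Qed.

End Subbundle.

(* The name alone would refer to [derive.dinv]. *)
Local Notation dinv := Defs.dinv.

Lemma scale_lfun_scale (R : realType) (V : vectType R) (S : 'End(V)) (a c : R)
    (u w : V) : S u = w -> a *: S (c *: u) = (c * a) *: w.
Proof. by move=> <-; rewrite linearZ scalerA mulrC. Qed.

(** * Hyperbolicity in operator norm and growth of vectors *)

Section Hyperbolicity.
Context {R : realType} {d : nat} {M : closed_manifold R d}.
Variables (g : continuous_inner_product M) (f : diffeomorphism M) (Lam : set M).
Hypothesis Lam_compact : compact Lam.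
Hypothesis Lam_invariant : f @` Lam = Lam.

Local Notation V := ('rV[R]_d : vectType R).
Local Notation nrm := (@fiber_norm R d M g).
Local Notation tau := (@fiber_transport R d M).
Local Notation D := (fun m => @tangent_map R d M (iter m f)).
Local Notation N := (@fiber_norm_is_norm R d M g).

Lemma diffeo_in_Lam x : Lam x -> Lam (f x).
Proof. by move=> Lx; rewrite -Lam_invariant; exists x. Qed.

Lemma dinv_in_Lam x : Lam x -> Lam (dinv f x).
Proof. by rewrite -{1}Lam_invariant => -[y Ly <-]; rewrite dfunK. Qed.

Lemma iter_in_Lam m x : Lam x -> Lam (iter m f x).
Proof. by move=> Lx; elim: m => //= m; exact: diffeo_in_Lam. Qed.

Lemma iter_dinv_in_Lam m x : Lam x -> Lam (iter m (dinv f) x).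
Proof. by move=> Lx; elim: m => //= m; exact: dinv_in_Lam. Qed.

Lemma iter_dinvK m x : iter m f (iter m (dinv f) x) = x.
Proof. by elim: m => // m IH; rewrite iterSr /= dinvK. Qed.

Lemma iter_onto_Lam m x : Lam x -> exists2 y, Lam y & iter m f y = x.
Proof.
move=> Lx; exists (iter m (dinv f) x); [exact: iter_dinv_in_Lam|exact: iter_dinvK].
Qed.

Lemma cocycle_tangent_map p x (v : V) :
  cocycle f p x v = p x *: tangent_map f x v :> V.
Proof. exact: scale_lfunE. Qed.

Definition cocycle_power (p : M -> R) m x : 'End(V) := cocycle_iter f p m x.

Lemma cocycle_power0 p x v : cocycle_power p 0 x v = v.
Proof. exact: id_lfunE. Qed.

Lemma cocycle_powerS p m x v : cocycle_power p m.+1 x v =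
  p (iter m f x) *: tangent_map f (iter m f x) (cocycle_power p m x v).
Proof.
apply: etrans (comp_lfunE _ _ _) _; exact: cocycle_tangent_map.
Qed.

Definition scaled_image (p : M -> R) (x : M) (X : {vspace V}) : {vspace V} :=
  (cocycle f p x @: (X : {vspace tangent x}))%VS.

(** A nonzero factor preserves subspaces, so invariance under the cocycle [p Df] is invariance under
    Df. *)
Lemma scaled_imageE p x X : p x != 0 ->
  scaled_image p x X = (tangent_map f x @: X)%VS.
Proof.
move=> p0; apply/vspaceP => w; apply/idP/idP => /memv_imgP[v vX ->].
  have -> : (cocycle f p x : 'Hom(tangent x, tangent (f x))) v =
    p x *: tangent_map f x v by exact: cocycle_tangent_map.
  by rewrite memvZ// memv_img.
have uX : (p x)^-1 *: v \in X by exact: memvZ.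
have -> : tangent_map f x v = cocycle f p x ((p x)^-1 *: v) :> V.
  apply: esym; apply: etrans (cocycle_tangent_map _ _ _) _.
  by rewrite linearZ scalerA mulfV// scale1r.
exact: memv_img.
Qed.

Local Opaque fiber_norm fiber_transport tangent_map cocycle_power scaled_image.

Let df := C1_differentiable_map (dfun_C1 f).

Lemma cocycle_powerE p m x v :
  cocycle_power p m x v = (\prod_(l < m) p (iter l f x)) *: D m x v.
Proof.
elim: m => [|m IH].
  by rewrite cocycle_power0 big_ord0 scale1r (tangent_map_id x v).
have E : \prod_(l < m.+1) p (iter l f x) =
    (\prod_(l < m) p (iter l f x)) * p (iter m f x) by rewrite big_ord_recr.
have h := tangent_map_comp x v (differentiable_map_iter m df) df.
apply: etrans (cocycle_powerS _ _ _ _) _.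
apply: etrans (congr1 (fun w => p _ *: tangent_map f _ w) IH) _.
apply: etrans (scale_lfun_scale _ _ (esym h)) _.
exact: (congr1 (fun c => c *: tangent_map (iter m.+1 f) x v) (esym E)).
Qed.

Lemma diffeo_cocycle : exists L : R, bounded_cocycle f Lam nrm D L.
Proof.
exact: (tangent_map_cocycle g (dfun_C1 f) (dinv_C1 f) (dfunK f) diffeo_in_Lam Lam_compact).
Qed.

Lemma dinv_cocycle : exists L : R,
  bounded_cocycle (dinv f) Lam nrm (fun m => tangent_map (iter m (dinv f))) L.
Proof.
exact: (tangent_map_cocycle g (dinv_C1 f) (dfun_C1 f) (dinvK f) dinv_in_Lam Lam_compact).
Qed.

Lemma tangent_map_iter_inj m x : Lam x -> lker (D m x) == 0%VS.
Proof. by have [L Lc] := diffeo_cocycle; exact: (cocycle_inj N Lc). Qed.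

Lemma tangent_map_iter_invariant (X : M -> {vspace V}) m x :
  (forall x, Lam x -> (tangent_map f x @: X x)%VS = X (f x)) -> Lam x ->
  (D m x @: X x)%VS = X (iter m f x).
Proof.
move=> Xf Lx; elim: m => [|m IH].
  rewrite -[RHS](lim1g); apply: eq_in_limg => v _.
  by rewrite id_lfunE; exact: tangent_map_id.
apply: etrans _ (Xf _ (iter_in_Lam m Lx)).
apply: etrans _ (congr1 (fun W => tangent_map f _ @: W)%VS IH).
apply: etrans _ (limg_comp _ _ _); apply: eq_in_limg => v _.
apply: etrans _ (esym (comp_lfunE _ _ _)).
exact: (tangent_map_comp x v (differentiable_map_iter m df) df).
Qed.

Lemma hyperbolicity_growth p (Es Eu : M -> {vspace V}) :
  (forall x, Lam x -> 0 < p x) -> hyperbolicity g f Lam p Es Eu ->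
  [/\ forall x, Lam x -> (Es x :&: Eu x = 0)%VS,
     forall x, Lam x -> (Es x + Eu x = fullv)%VS,
     forall x, Lam x -> (tangent_map f x @: Es x)%VS = Es (f x),
     forall x, Lam x -> (tangent_map f x @: Eu x)%VS = Eu (f x) &
     exists C alpha : R, [/\ 0 <= C, 0 < alpha &
       hyperbolic_growth f Lam nrm D p C alpha Es Eu]].
Proof.
move=> p0 [_ _ EsEu inv [C [alpha [C1 a0 H]]]].
have E0 x : Lam x -> (Es x :&: Eu x = 0)%VS.
  by move=> /EsEu[/directv_addP].
split=> //.
- by move=> x /EsEu[].
- move=> x Lx; rewrite -(scaled_imageE (p := p)) ?gt_eqF ?p0//.
  by have [h _] := inv x Lx; exact: h.
- move=> x Lx; rewrite -(scaled_imageE (p := p)) ?gt_eqF ?p0//.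
  by have [_ h] := inv x Lx; exact: h.
have C0 : 0 <= C by lra.
exists C, alpha; split => // x m Lx.
have pm : 0 < \prod_(l < m) p (iter l f x).
  by apply: prodr_gt0 => l _; exact/p0/iter_in_Lam.
(* The estimates of [hyperbolicity] start at n = 1; for m = 0 they follow from C > 1. *)
have [->|m0] := posnP m.
  rewrite big_ord0 mul0r oppr0 expR0 mulr1.
  split=> v _; rewrite mul1r (tangent_map_id x v) ?mul1r ler_peMl ?(norm_ge0 (N _)) ?ltW//.
have [H1 H2] := H m m0 x Lx.
have A_inj : lker (cocycle_power p m x) == 0%VS.
  apply: lker_eq0 => v; rewrite cocycle_powerE => /eqP.
  rewrite scaler_eq0 gt_eqF//= => /eqP Dv0.
  by rewrite -(lker0_lfunK (tangent_map_iter_inj m Lx) v) Dv0 linear0.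
pose Q := daddv_pi (Es x) (Eu x).
have nA v : nrm (iter m f x) (cocycle_power p m x v) =
    \prod_(l < m) p (iter l f x) * nrm (iter m f x) (D m x v).
  by rewrite cocycle_powerE (normZ (N _)) gtr0_norm.
split=> v vE.
- have {}H1 : lfun_norm (nrm x) (nrm (iter m f x)) (cocycle_power p m x \o Q)%VF <=
      C * expR (- (m%:R * alpha)) by exact: H1.
  have h := le_lfun_norm (N x) (N (iter m f x)) (fiber_norm_bounded g x (iter m f x)
    (cocycle_power p m x \o Q)%VF) v.
  rewrite comp_lfunE /Q daddv_pi_id ?E0// nA in h.
  by apply: le_trans h _; rewrite ler_wpM2r ?(norm_ge0 (N _)).
(* On A^m v with v in [Eu x], the operator (I - Q) A^(-m) gives back v. *)
- pose B := ((\1 - Q) \o (cocycle_power p m x)^-1)%VF.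
  have {}H2 : lfun_norm (nrm (iter m f x)) (nrm x) B <=
      C * expR (- (m%:R * alpha)) by exact: H2.
  have h := le_lfun_norm (N (iter m f x)) (N x) (fiber_norm_bounded g (iter m f x) x B)
    (cocycle_power p m x v).
  have BE : B (cocycle_power p m x v) = v.
    rewrite /B comp_lfunE (lker0_lfunK A_inj) add_lfunE opp_lfunE id_lfunE.
    have := @daddv_pi_decomp _ _ (Es x) (Eu x) 0 v (E0 x Lx) (mem0v _) vE.
    by rewrite add0r -/Q => ->; rewrite subr0.
  rewrite BE nA in h.
  apply: le_trans h _; rewrite ler_wpM2r// mulr_ge0 ?(norm_ge0 (N _))// ltW//.
Qed.

(** The angle bounds the projector at [x] in the first estimate and, by invariance of both bundles,
    at the image point in the second. The [+ 2] makes the constant exceed 1. *)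
Lemma growth_hyperbolicity p (Es Eu : M -> {vspace V}) (C K alpha : R) :
  (forall x, Lam x -> 0 < p x) -> 0 <= C -> 0 <= K -> 0 < alpha ->
  (forall x, Lam x -> (Es x :&: Eu x = 0)%VS) ->
  (forall x, Lam x -> (Es x + Eu x = fullv)%VS) ->
  (forall x, Lam x -> (tangent_map f x @: Es x)%VS = Es (f x)) ->
  (forall x, Lam x -> (tangent_map f x @: Eu x)%VS = Eu (f x)) ->
  continuous_subbundle Lam Es -> continuous_subbundle Lam Eu ->
  angle_bounded Lam nrm K Es Eu ->
  hyperbolic_growth f Lam nrm D p C alpha Es Eu ->
  hyperbolicity g f Lam p Es Eu.
Proof.
move=> p0 C0 K0 a0 E0 E1 Esf Euf cEs cEu angle growth; split => //.
- by move=> x Lx; split; [apply/directv_addP; exact: E0|exact: E1].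
- move=> x Lx; split.
  + rewrite -Esf// -(scaled_imageE (p := p)) ?gt_eqF ?p0//.
  + rewrite -Euf// -(scaled_imageE (p := p)) ?gt_eqF ?p0//.
exists (C * K + 2), alpha; split => //.
  by have := mulr_ge0 C0 K0; lra.
move=> m m1 x Lx.
have [G1 G2] := growth x m Lx.
have pm : 0 < \prod_(l < m) p (iter l f x).
  by apply: prodr_gt0 => l _; exact/p0/iter_in_Lam.
have nA v : nrm (iter m f x) (cocycle_power p m x v) =
    \prod_(l < m) p (iter l f x) * nrm (iter m f x) (D m x v).
  by rewrite cocycle_powerE (normZ (N _)) gtr0_norm.
pose Q := daddv_pi (Es x) (Eu x).
have EE := expR_ge0 (- (m%:R * alpha)).
have B0 : 0 <= (C * K + 2) * expR (- (m%:R * alpha)).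
  by rewrite mulr_ge0// addr_ge0// mulr_ge0.
have KC t : 0 <= t -> C * expR (- (m%:R * alpha)) * (K * t) <=
    (C * K + 2) * expR (- (m%:R * alpha)) * t.
  by move=> t0; have := mulr_ge0 EE t0; lra.
have split v : daddv_pi (Es x) (Eu x) v + daddv_pi (Eu x) (Es x) v = v.
  by rewrite daddv_pi_split ?E0 ?E1.
split.
- suff h : lfun_norm (nrm x) (nrm (iter m f x)) (cocycle_power p m x \o Q)%VF <=
    (C * K + 2) * expR (- (m%:R * alpha)) by exact: h.
  apply: (lfun_norm_le (N x)) => // v; rewrite comp_lfunE nA.
  have h1 := G1 (Q v) (memv_pi _ _ _).
  have [h2 _] := angle x Lx _ _ (memv_pi (Es x) (Eu x) v) (memv_pi (Eu x) (Es x) v).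
  rewrite split in h2.
  apply: le_trans h1 _; apply: le_trans (KC _ (norm_ge0 (N x) v)).
  by rewrite ler_wpM2l// mulr_ge0.
- pose B := ((\1 - Q) \o (cocycle_power p m x)^-1)%VF.
  suff h : lfun_norm (nrm (iter m f x)) (nrm x) B <=
    (C * K + 2) * expR (- (m%:R * alpha)) by exact: h.
  have A_inj : lker (cocycle_power p m x) == 0%VS.
    apply: lker_eq0 => v; rewrite cocycle_powerE => /eqP.
    rewrite scaler_eq0 gt_eqF//= => /eqP Dv0.
    by rewrite -(lker0_lfunK (tangent_map_iter_inj m Lx) v) Dv0 linear0.
  apply: (lfun_norm_le (N (iter m f x))) => // w.
  have [z ->] := lfun_surj w A_inj.
  have -> : B (cocycle_power p m x z) = daddv_pi (Eu x) (Es x) z.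
    rewrite /B comp_lfunE (lker0_lfunK A_inj) add_lfunE opp_lfunE id_lfunE.
    by rewrite -{1}(split z) addrC addKr.
  set b := daddv_pi (Eu x) (Es x) z; set a := daddv_pi (Es x) (Eu x) z.
  have aE : a \in Es x by exact: memv_pi.
  have bE : b \in Eu x by exact: memv_pi.
  have h1 := G2 b bE.
  have DaE : D m x a \in Es (iter m f x).
    by rewrite -(tangent_map_iter_invariant m Esf Lx); exact: memv_img.
  have DbE : D m x b \in Eu (iter m f x).
    by rewrite -(tangent_map_iter_invariant m Euf Lx); exact: memv_img.
  have [_ h2] := angle _ (iter_in_Lam m Lx) _ _ DaE DbE.
  rewrite -linearD split in h2.
  apply: le_trans h1 _; apply: le_trans (KC _ (norm_ge0 (N _) _)).
  rewrite ler_wpM2l ?mulr_ge0//.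
  by rewrite nA mulrCA ler_pM2l.
Qed.

End Hyperbolicity.

(** * The two implications *)

Lemma dim_rV_fullv (R : realType) (d : nat) :
  \dim (fullv : {vspace ('rV[R]_d : vectType R)}) = d.
Proof. by rewrite dimvf dim_matrix; exact: mul1n. Qed.

(** * Two-sided iterates and the pairwise form of domination *)

Section Diter.
Context {R : realType} {d : nat} {M : closed_manifold R d}.
Variables (g : continuous_inner_product M) (f : diffeomorphism M) (Lam : set M).
Hypothesis Lam_invariant : f @` Lam = Lam.

Local Notation V := ('rV[R]_d : vectType R).
Local Notation nrm := (@fiber_norm R d M g).

Definition inverse_diffeomorphism : diffeomorphism M :=
  Diffeomorphism (dinvK f) (dfunK f) (dinv_C1 f) (dfun_C1 f).

Lemma inverse_invariant : inverse_diffeomorphism @` Lam = Lam.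
Proof.
apply/seteqP; split=> [_ [x Lx <-]|x Lx]; first exact: (dinv_in_Lam Lam_invariant).
by exists (f x); [exact: (diffeo_in_Lam Lam_invariant)|exact: dfunK].
Qed.

Lemma diterS (n : int) x : diter f (n + 1) x = f (diter f n x).
Proof.
case: n => [a|[|a]]; first by rewrite -PoszD addn1.
  by rewrite /= dinvK.
by rewrite (_ : Negz a.+1 + 1 = Negz a) /= ?dinvK// !NegzE -[a.+2]addn1 PoszD opprD subrK.
Qed.

Lemma diter_addn (n : int) (m : nat) x : diter f (n + m%:Z) x = iter m f (diter f n x).
Proof.
elim: m => [|m IH]; first by rewrite addr0.
by rewrite -addn1 PoszD addrA diterS IH addn1.
Qed.

Lemma diter_Lam n x : Lam x -> Lam (diter f n x).
Proof.
case: n => m Lx; first exact: (iter_in_Lam Lam_invariant).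
exact: (iter_dinv_in_Lam Lam_invariant m.+1).
Qed.

Local Opaque fiber_norm fiber_transport tangent_map.

Let df := C1_differentiable_map (dfun_C1 f).
Let dfi := C1_differentiable_map (dinv_C1 f).

Lemma differentiable_diter n : differentiable_map (diter f n).
Proof. by case: n => m; exact: differentiable_map_iter. Qed.

Lemma tangent_map_diter_addn n m x u :
  tangent_map (diter f (n + m%:Z)) x u =
  tangent_map (iter m f) (diter f n x) (tangent_map (diter f n) x u).
Proof.
have E : diter f (n + m%:Z) = iter m f \o diter f n.
  by apply/funext => y; exact: diter_addn.
apply: etrans (congr1 (fun phi => tangent_map phi x u) E) _.
apply: tangent_map_comp; first exact: differentiable_diter.
exact: differentiable_map_iter.
Qed.

Lemma tangent_map_dinv_invariant (X : M -> {vspace V}) :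
  (forall x, Lam x -> (tangent_map f x @: X x)%VS = X (f x)) ->
  forall x, Lam x -> (tangent_map (dinv f) x @: X x)%VS = X (dinv f x).
Proof.
move=> Xf x Lx; have Ly := dinv_in_Lam Lam_invariant Lx.
have h := Xf _ Ly; rewrite dinvK in h.
apply: etrans (congr1 (fun W => tangent_map (dinv f) x @: W)%VS (esym h)) _.
apply: etrans (esym (limg_comp _ _ _)) _.
apply: etrans _ (lim1g _); apply: eq_in_limg => v _.
apply: etrans (comp_lfunE _ _ _) _; apply: etrans _ (esym (id_lfunE _)).
have := tangent_mapK (dfun_C1 f) (dinv_C1 f) (dfunK f) (dinv f x) v.
by rewrite dinvK.
Qed.

Lemma diter_invariant (X : M -> {vspace V}) n x :
  (forall x, Lam x -> (tangent_map f x @: X x)%VS = X (f x)) -> Lam x ->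
  (tangent_map (diter f n) x @: X x)%VS = X (diter f n x).
Proof.
move=> Xf Lx; case: n => m; first exact: (tangent_map_iter_invariant Lam_invariant m Xf Lx).
exact: (@tangent_map_iter_invariant _ _ _ inverse_diffeomorphism Lam inverse_invariant X m.+1 x
  (tangent_map_dinv_invariant Xf) Lx).
Qed.

(** The starting time n, possibly negative, is absorbed by moving the base point to [diter f n x];
    invariance puts the images of the two vectors in the summands there. *)
Lemma dominated_splitting_of_pairs (k : nat) (E : 'I_k -> M -> {vspace V}) (C alpha : R) :
  invariant_splitting f Lam E -> 1 < C -> 0 < alpha ->
  (forall i x, Lam x -> (tangent_map f x @: E i x)%VS = E i (f x)) ->
  (forall i j : 'I_k, (i < j)%N -> dominated_pair f Lam nrm
     (fun m => tangent_map (iter m f)) C alpha (E i) (E j)) ->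
  dominated_splitting g f Lam E.
Proof.
move=> Esplit C1 a0 Ef Edom; split=> //.
exists C, alpha; split=> // i j ij x Lx u v n m.
pose Pu : V := oblique_proj E i x u; pose Pv : V := oblique_proj E j x v.
pose Dn (h : int) (w : V) := nrm (diter f h x) (tangent_map (diter f h) x w).
suff : Dn n Pu * Dn (n + m%:Z) Pv != 0 ->
  (Dn (n + m%:Z) Pu * Dn n Pv) / (Dn n Pu * Dn (n + m%:Z) Pv)
    <= C * expR (- (m%:R * alpha)) by move=> h; exact: h.
have Ly := diter_Lam n Lx; set y := diter f n x in Ly.
have DnE w : Dn (n + m%:Z) w =
    nrm (iter m f y) (tangent_map (iter m f) y (tangent_map (diter f n) x w)).
  exact: (f_equal2 nrm (diter_addn n m x) (tangent_map_diter_addn n m x w)).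
have uE : tangent_map (diter f n) x Pu \in E i y.
  rewrite -(diter_invariant n (Ef i) Lx); apply: memv_img; exact: memv_pi.
have vE : tangent_map (diter f n) x Pv \in E j y.
  rewrite -(diter_invariant n (Ef j) Lx); apply: memv_img; exact: memv_pi.
have h := Edom i j ij y Ly m _ _ uE vE.
rewrite !DnE => D0.
have N z := @fiber_norm_is_norm R d M g z.
have Dpos : 0 < Dn n Pu * nrm (iter m f y) (tangent_map (iter m f) y
    (tangent_map (diter f n) x Pv)).
  by rewrite lt_def D0 mulr_ge0 ?(norm_ge0 (N _)).
by rewrite ler_pdivrMr// mulrA.
Qed.

Hypothesis Lam_compact : compact Lam.

Lemma pairs_of_dominated_splitting (k : nat) (E : 'I_k -> M -> {vspace V}) :
  dominated_splitting g f Lam E ->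
  exists C alpha : R, [/\ 1 < C, 0 < alpha &
    forall i j : 'I_k, (i < j)%N -> dominated_pair f Lam nrm
     (fun m => tangent_map (iter m f)) C alpha (E i) (E j)].
Proof.
move=> [Esplit [C [alpha [C1 a0 H]]]]; exists C, alpha; split=> // i j ij x Lx m u v uE vE.
have N z := @fiber_norm_is_norm R d M g z.
have [dir _ _] := Esplit x Lx.
have PE l w : w \in E l x -> oblique_proj E l x w = w :> V.
  move=> wE; apply: daddv_pi_id => //.
  by move/directv_sumP: dir; exact.
have {}H := H i j ij x Lx u v 0 m.
pose Dn (h : int) (w : V) := nrm (diter f h x) (tangent_map (diter f h) x w).
have {}H : Dn 0 (oblique_proj E i x u) * Dn (0 + m%:Z) (oblique_proj E j x v) != 0 ->
  (Dn (0 + m%:Z) (oblique_proj E i x u) * Dn 0 (oblique_proj E j x v)) /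
  (Dn 0 (oblique_proj E i x u) * Dn (0 + m%:Z) (oblique_proj E j x v))
    <= C * expR (- (m%:R * alpha)) := H.
rewrite add0r (PE i u uE) (PE j v vE) in H.
have Dn0 w : Dn 0 w = nrm x w.
  exact: (congr1 (nrm x) (tangent_map_id x w)).
have Dnm w : Dn m%:Z w = nrm (iter m f x) (tangent_map (iter m f) x w) by [].
rewrite !Dn0 !Dnm in H.
(* If the denominator vanishes, injectivity forces u = 0 or v = 0, and both sides are 0. *)
have [D0|D0] := eqVneq (nrm x u * nrm (iter m f x) (tangent_map (iter m f) x v)) 0.
  move/eqP: D0; rewrite mulf_eq0 => /orP[|] /eqP D0.
    have -> : u = 0 by apply/eqP; rewrite -(norm_eq0 (N x)) D0.
    by rewrite linear0 !(norm0 (N _)) mul0r mulr0 mul0r.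
  have Dv0 : tangent_map (iter m f) x v = 0.
    by apply/eqP; rewrite -(norm_eq0 (N (iter m f x))) D0.
  have -> : v = 0.
    have Dinj := tangent_map_iter_inj g Lam_compact Lam_invariant m Lx.
    by rewrite -(lker0_lfunK Dinj v) Dv0 linear0.
  by rewrite linear0 !(norm0 (N _)) !mulr0.
have Dpos : 0 < nrm x u * nrm (iter m f x) (tangent_map (iter m f) x v).
  by rewrite lt_def D0 mulr_ge0 ?(norm_ge0 (N _)).
by have := H D0; rewrite ler_pdivrMr// mulrA.
Qed.

End Diter.

(** * From hyperbolicity to domination *)

Section DominatedOfHyperbolic.
Context {R : realType} {d : nat} {M : closed_manifold R d}.
Variables (g : continuous_inner_product M) (f : diffeomorphism M) (Lam : set M).
Hypothesis Lam_compact : compact Lam.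
Hypothesis Lam_invariant : f @` Lam = Lam.
Variables (k : nat) (ns : 'I_k -> nat).
Hypothesis k_gt0 : (0 < k)%N.
Hypothesis ns_sum : (\sum_(i < k) ns i)%N = d.

Local Notation V := ('rV[R]_d : vectType R).
Local Notation nrm := (@fiber_norm R d M g).
Local Notation D := (fun m => @tangent_map R d M (iter m f)).
Local Opaque fiber_norm fiber_transport tangent_map.

Variables (p : 'I_k -> M -> R) (Es Eu : 'I_k -> M -> {vspace V}).
Hypothesis p_gt0 : forall i x, Lam x -> 0 < p i x.
Hypothesis p_sep : summably_separated f Lam (fun i x => ln (p (rev_ord i) x)).
Hypothesis hyp : forall i, hyperbolicity g f Lam (p i) (Es i) (Eu i).
Hypothesis Es_dim : forall i x, Lam x ->
  \dim (Es i x) = (\sum_(j < k | (j <= i)%N) ns j)%N.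

Let i0 := Ordinal k_gt0.
(** Reads a natural number as an index, with the dummy value [i0] from k on. *)
Let o a : 'I_k := insubd i0 a.
(** Indices are shifted by one: stage 0 is the trivial pair of 0 and the whole space, so that the
    first summand obeys the same formula as the others. *)
Let S s x : {vspace V} := if s is a.+1 then Es (o a) x else 0%VS.
Let U s x : {vspace V} := if s is a.+1 then Eu (o a) x else fullv.
Let E (i : 'I_k) x : {vspace V} := (S i.+1 x :&: U i x)%VS.

Let oE a : (a < k)%N -> o a = a :> nat.
Proof. by move=> ak; rewrite /o val_insubd ak. Qed.

Let o_ord (i : 'I_k) : o i = i. Proof. exact: valKd. Qed.

(** Exponentiating the separation from time 0 and dropping the positive term in m gives the constant
    e^beta. The reversed order of the separated functions makes p_(i+1) the smaller one. *)
Lemma scaling_product_decr : exists2 B : R, 0 <= B & forall (i j : 'I_k), j = i.+1 :> nat ->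
  forall m x, Lam x ->
  \prod_(l < m) p j (iter l f x) <= B * \prod_(l < m) p i (iter l f x).
Proof.
have [_ [beta [gm [beta0 gm0 H]]]] := p_sep.
exists (expR beta) => [|i j ij m x Lx]; first exact: expR_ge0.
have [->|m0] := posnP m.
  by rewrite !big_ord0 mulr1 -expR0 ler_expR.
have prodE i' : \prod_(l < m) p i' (iter l f x) =
    expR (\sum_(l < m) ln (p i' (iter l f x))).
  rewrite expR_sum; apply: eq_bigr => l _; rewrite lnK// posrE.
  exact/p_gt0/(iter_in_Lam Lam_invariant).
rewrite !prodE -expRD ler_expR.
have rE : rev_ord i = (rev_ord j).+1 :> nat.
  by rewrite /= ij subnSK//; have := ltn_ord j; rewrite ij.
have := H (rev_ord j) (rev_ord i) rE 0%N m m0 x Lx.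
rewrite add0n big_mkord sumrB !rev_ordK.
have : 0 <= gm * m%:R by rewrite mulr_ge0// ltW.
lra.
Qed.

Lemma nested_cap0 s x : Lam x -> (S s x :&: U s x = 0)%VS.
Proof.
move=> Lx; case: s => [|a] /=; first by rewrite cap0v.
by have [h _ _ _ _] := hyperbolicity_growth Lam_compact Lam_invariant
  (@p_gt0 (o a)) (@hyp (o a)); exact: h.
Qed.

Lemma nested_add s x : Lam x -> (S s x + U s x = fullv)%VS.
Proof.
move=> Lx; case: s => [|a] /=; first by rewrite add0v.
by have [_ h _ _ _] := hyperbolicity_growth Lam_compact Lam_invariant
  (@p_gt0 (o a)) (@hyp (o a)); exact: h.
Qed.

Lemma nested_S_invariant s x : Lam x -> (tangent_map f x @: S s x)%VS = S s (f x).
Proof.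
move=> Lx; case: s => [|a] /=; first by rewrite limg0.
by have [_ _ h _ _] := hyperbolicity_growth Lam_compact Lam_invariant
  (@p_gt0 (o a)) (@hyp (o a)); exact: h.
Qed.

Lemma nested_U_invariant s x : Lam x -> (tangent_map f x @: U s x)%VS = U s (f x).
Proof.
move=> Lx; case: s => [|a] /=; last first.
  by have [_ _ _ h _] := hyperbolicity_growth Lam_compact Lam_invariant
    (@p_gt0 (o a)) (@hyp (o a)); exact: h.
exact: (lker0_limgf (tangent_map_iter_inj g Lam_compact Lam_invariant 1 Lx)).
Qed.

Lemma nested_mono s x : (s < k)%N -> Lam x ->
  (S s x <= S s.+1 x)%VS /\ (U s.+1 x <= U s x)%VS.
Proof.
case: s => [|a] ak Lx /=; first by rewrite sub0v subvf.
have [B B0 HB] := scaling_product_decr.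
have oo : o a.+1 = (o a).+1 :> nat by rewrite !oE// ltnW.
have [_ hp1 hp2 hp3 [C [al [C0 al0 hp]]]] := hyperbolicity_growth Lam_compact Lam_invariant
  (@p_gt0 (o a)) (@hyp (o a)).
have [_ hq1 _ hq3 [C' [al' [C'0 al'0 hq]]]] := hyperbolicity_growth Lam_compact Lam_invariant
  (@p_gt0 (o a.+1)) (@hyp (o a.+1)).
have N := @fiber_norm_is_norm R d M g.
have fL := @iter_in_Lam R d M f Lam Lam_invariant.
have fS := @iter_onto_Lam R d M f Lam Lam_invariant.
have Dinv X m y := @tangent_map_iter_invariant R d M f Lam Lam_invariant X m y.
split.
  exact: (stable_subspace_mono N fL (@p_gt0 (o a)) (@p_gt0 (o a.+1)) B0
    (HB _ _ oo) C0 C'0 al0 al'0 hp hq Lx (hq1 x Lx)).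
exact: (unstable_subspace_mono N fL fS (@p_gt0 (o a)) (@p_gt0 (o a.+1)) B0
    (HB _ _ oo) C0 C'0 al0 al'0 hp hq (tangent_map_iter_inj g Lam_compact Lam_invariant)
    (fun m y => Dinv _ m y hp2) (fun m y => Dinv _ m y hp3) (fun m y => Dinv _ m y hq3)
    Lx (hp1 x Lx)).
Qed.

Lemma nested_S_dim s x : (s <= k)%N -> Lam x ->
  \dim (S s x) = (\sum_(j < s) ns (o j))%N.
Proof.
case: s => [|a] ak Lx /=; first by rewrite big_ord0 dimv0.
rewrite Es_dim// oE// (big_ord_widen k (fun j => ns (o j)))//.
by apply: eq_big => [j|j _]; [rewrite ltnS|rewrite o_ord].
Qed.

Lemma U_mono a b x : (a <= b <= k)%N -> Lam x -> (U b x <= U a x)%VS.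
Proof.
move=> /andP[ab bk] Lx; elim: b ab bk => [|b IH] ab bk.
  by move: ab; rewrite leqn0 => /eqP ->; rewrite subvv.
move: ab; rewrite leq_eqVlt => /predU1P[->|ab]; first exact: subvv.
by apply: subv_trans (IH ab (ltnW bk)); have [] := nested_mono bk Lx.
Qed.

Lemma dominated_of_hyperbolic : dominated_of_type g f Lam ns E.
Proof.
have N := @fiber_norm_is_norm R d M g.
(* The last stable dimension is n_1 + ... + n_k = d. *)
have Sk x : Lam x -> S k x = fullv.
  move=> Lx; apply/eqP; rewrite eqEdim subvf dim_rV_fullv nested_S_dim//.
  by rewrite -{1}ns_sum leq_eqVlt; apply/orP; left; apply/eqP/eq_bigr => j _; rewrite o_ord.
have SU0 x s : Lam x -> (s <= k)%N -> (S s x :&: U s x = 0)%VS.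
  by move=> Lx _; exact: nested_cap0.
have SU1 x s : Lam x -> (s <= k)%N -> (S s x + U s x = fullv)%VS.
  by move=> Lx _; exact: nested_add.
have Sm x s : Lam x -> (s < k)%N -> (S s x <= S s.+1 x)%VS.
  by move=> Lx sk; have [] := nested_mono sk Lx.
have Sd x s : Lam x -> (s <= k)%N -> \dim (S s x) = (\sum_(j < s) ns (o j))%N.
  by move=> Lx sk; exact: nested_S_dim.
have Einv i x : Lam x -> (tangent_map f x @: E i x)%VS = E i (f x).
  move=> Lx; rewrite /E.
  rewrite (lker0_img_cap _ _ (tangent_map_iter_inj g Lam_compact Lam_invariant 1 Lx)).
  by rewrite -nested_S_invariant// -nested_U_invariant.
have Edim i x : Lam x -> \dim (E i x) = ns i.
  move=> Lx; have := @nested_dim R V k (S^~ x) (U^~ x) (ns \o o) (SU0 x ^~ Lx)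
    (SU1 x ^~ Lx) (Sm x ^~ Lx) (Sd x ^~ Lx) i (ltn_ord i).
  by move=> h; apply: etrans h _; rewrite /= o_ord.
have pair (i : 'I_k) : exists ca : R * R, [/\ 0 <= ca.1, 0 < ca.2 & forall j : 'I_k, (i < j)%N ->
    dominated_pair f Lam nrm D ca.1 ca.2 (E i) (E j)].
  have [_ _ _ _ [C [al [C0 al0 hp]]]] := hyperbolicity_growth Lam_compact Lam_invariant
    (@p_gt0 (o i)) (@hyp (o i)).
  exists (C ^+ 2, al); split; rewrite ?sqr_ge0//= => j ij x Lx m u v.
  rewrite !memv_cap => /andP[uS _] /andP[_ vU].
  (* As i < j, the unstable factor of the summand j lies in Eu_i, so the single scaling p_i governs
     both vectors. *)
  have ijk : (i.+1 <= j <= k)%N by rewrite ij ltnW.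
  have {}vU : v \in U i.+1 x by have /subvP := U_mono ijk Lx; exact.
  have [/(_ u uS) h1 /(_ v vU) h2] := hp x m Lx.
  set c := \prod_(l < m) _ in h1 h2.
  have c0 : 0 < c by apply: prodr_gt0 => l _; exact/p_gt0/(iter_in_Lam Lam_invariant).
  set e := expR _ in h1 h2 *.
  have e0 : 0 <= e by exact: expR_ge0.
  have e1 : e <= 1 by exact: exp_le1.
  set Du := nrm _ (D m x u) in h1 *; set Dv := nrm _ (D m x v) in h2 *.
  have nu : 0 <= nrm x u := norm_ge0 (N x) u.
  have nv : 0 <= nrm x v := norm_ge0 (N x) v.
  have nDu : 0 <= Du := norm_ge0 (N _) _.
  have nDv : 0 <= Dv := norm_ge0 (N _) _.
  (* The product carries two exponential factors; one of them is bounded by 1 and dropped. *)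
  have h3 := ler_pM (mulr_ge0 (ltW c0) nDu) nv h1 h2.
  have h4 : c * (Du * nrm x v) <= c * (e * (C ^+ 2 * e * nrm x u * Dv)).
    by apply: le_trans (le_trans _ h3) _; rewrite le_eqVlt; apply/orP; left; apply/eqP; ring.
  rewrite ler_pM2l// in h4; apply: le_trans h4 _; apply: ler_piMl => //.
  by rewrite !mulr_ge0// sqr_ge0.
have /choice[ca Hca] := pair.
(* The inverse of the sum of inverses is a positive rate below each of the k rates; the [+ 2]
   ensures C > 1. *)
pose C := \sum_i (ca i).1 + 2; pose al := (\sum_i (ca i).2^-1)^-1.
have ca1_ge0 i : 0 <= (ca i).1 by have [] := Hca i.
have ca2_gt0 i : 0 < (ca i).2 by have [] := Hca i.
have sum2 i : (ca i).2^-1 <= \sum_i (ca i).2^-1.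
  by rewrite (bigD1 i)//= lerDl sumr_ge0// => j _; rewrite invr_ge0 ltW.
have sum2_gt0 : 0 < \sum_i (ca i).2^-1.
  by apply: lt_le_trans (sum2 i0); rewrite invr_gt0.
have al0 : 0 < al by rewrite invr_gt0.
split; last by move=> x Lx i; exact: Edim.
apply: (dominated_splitting_of_pairs Lam_invariant (C := C) (alpha := al)) => //.
- move=> x Lx; split=> //; last by move=> i; exact: Einv.
    exact: (@nested_directv R V k (S^~ x) (U^~ x) (ns \o o) erefl (SU0 x ^~ Lx) (SU1 x ^~ Lx) (Sm x ^~ Lx) (Sd x ^~ Lx)).
  apply: etrans (Sk x Lx).
  exact: (@nested_sum R V k (S^~ x) (U^~ x) erefl (SU1 x ^~ Lx) (Sm x ^~ Lx) k (leqnn k)).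
- by rewrite /C ltr_wpDl ?sumr_ge0// ltr1n.
move=> i j ij x Lx m u v uE vE.
have [_ _ /(_ j ij x Lx m u v uE vE) h] := Hca i.
apply: le_trans h _.
apply: ler_wpM2r; first exact: (norm_ge0 (N _)).
apply: ler_wpM2r; first exact: (norm_ge0 (N _)).
apply: ler_pM => //.
  rewrite /C (bigD1 i)//= -addrA lerDl addr_ge0// sumr_ge0//.
rewrite ler_expR lerN2 ler_wpM2l//.
by rewrite /al -[leRHS]invrK lef_pV2 ?posrE ?invr_gt0.
Qed.

End DominatedOfHyperbolic.

(** * From domination to hyperbolicity *)

Section HyperbolicOfDominated.
Context {R : realType} {d : nat} {M : closed_manifold R d}.
Variables (g : continuous_inner_product M) (f : diffeomorphism M) (Lam : set M).
Hypothesis Lam_compact : compact Lam.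
Hypothesis Lam_invariant : f @` Lam = Lam.
Variables (k : nat) (ns : 'I_k -> nat).
Hypothesis k_gt0 : (0 < k)%N.
Hypothesis ns_sum : (\sum_(i < k) ns i)%N = d.

Local Notation V := ('rV[R]_d : vectType R).
Local Notation nrm := (@fiber_norm R d M g).
Local Notation tau := (@fiber_transport R d M).
Local Notation D := (fun m => @tangent_map R d M (iter m f)).
Local Notation Di := (fun m => @tangent_map R d M (iter m (dinv f))).
Local Opaque fiber_norm fiber_transport tangent_map.

Variable E : 'I_k -> M -> {vspace V}.
Hypothesis E_dom : dominated_of_type g f Lam ns E.

Let i0 := Ordinal k_gt0.
Let o a : 'I_k := insubd i0 a.
Let S lo hi x : {vspace V} := (\sum_(lo <= a < hi) E (o a) x)%VS.
Let X i x := S 0 i.+1 x.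
Let Y i x := S i.+1 k x.

Let oE a : (a < k)%N -> o a = a :> nat.
Proof. by move=> ak; rewrite /o val_insubd ak. Qed.

Let o_ord (i : 'I_k) : o i = i. Proof. exact: valKd. Qed.

Let N := @fiber_norm_is_norm R d M g.

Lemma summand_invariant i x : Lam x -> (tangent_map f x @: E i x)%VS = E i (f x).
Proof. by move=> Lx; have [[spl _] _] := E_dom; have [_ _ h] := spl x Lx; exact: h. Qed.

Lemma partial_sum_invariant lo hi x : Lam x -> (tangent_map f x @: S lo hi x)%VS = S lo hi (f x).
Proof.
move=> Lx; rewrite limg_sum; apply: eq_bigr => a _; exact: summand_invariant.
Qed.

Lemma partial_sum_forward lo hi : forward_invariant f Lam D (S lo hi).
Proof.
move=> x Lx m v vS.
rewrite -(tangent_map_iter_invariant Lam_invariant m (@partial_sum_invariant lo hi) Lx); exact: memv_img.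
Qed.

Lemma partial_sum_backward lo hi : forward_invariant (dinv f) Lam Di (S lo hi).
Proof.
move=> x Lx m v vS.
have h := tangent_map_dinv_invariant Lam_invariant (@partial_sum_invariant lo hi).
rewrite -(@tangent_map_iter_invariant _ _ _ (inverse_diffeomorphism f) Lam
  (inverse_invariant Lam_invariant) (S lo hi) m x h Lx); exact: memv_img.
Qed.

Lemma partial_sum_full x : Lam x -> S 0 k x = fullv.
Proof.
move=> Lx; have [[spl _] _] := E_dom; have [_ <- _] := spl x Lx.
by rewrite /S big_mkord; apply: eq_bigr => i _; rewrite o_ord.
Qed.

Lemma partial_sum_cat s x : (s <= k)%N -> Lam x -> (S 0 s x + S s k x = fullv)%VS.
Proof. by move=> sk Lx; rewrite -(partial_sum_full Lx) /S (big_cat_nat (leq0n s) sk). Qed.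

Lemma partial_sum_dim_le lo hi x : Lam x -> (\dim (S lo hi x) <= \sum_(lo <= a < hi) ns (o a))%N.
Proof.
move=> Lx; apply: leq_trans (dimv_leq_sum _ _ _) _.
by rewrite leq_eqVlt; apply/orP; left; apply/eqP/eq_bigr => a _; have [_ h] := E_dom; exact: h.
Qed.

Lemma sum_dims : (\sum_(0 <= a < k) ns (o a))%N = d.
Proof. by rewrite -[RHS]ns_sum big_mkord; apply: eq_bigr => i _; rewrite o_ord. Qed.

(** The two sums span the fibre, and their dimensions are at most sums of the n_a that add up to d.
    All inequalities are therefore equalities, and the intersection is 0. *)
Lemma partial_sum_dims s x : (s <= k)%N -> Lam x ->
  [/\ \dim (S 0 s x) = (\sum_(0 <= a < s) ns (o a))%N,
      \dim (S s k x) = (\sum_(s <= a < k) ns (o a))%N &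
      (S 0 s x :&: S s k x = 0)%VS].
Proof.
move=> sk Lx.
have h1 := @partial_sum_dim_le 0 s x Lx; have h2 := @partial_sum_dim_le s k x Lx.
have h3 : (\sum_(0 <= a < s) ns (o a) + \sum_(s <= a < k) ns (o a))%N = d.
  by rewrite -(big_cat_nat (leq0n s) sk)//= sum_dims.
have h4 := dimv_sum_cap (S 0 s x) (S s k x).
rewrite partial_sum_cat// dim_rV_fullv in h4.
have h5 : \dim (S 0 s x :&: S s k x) = 0%N by lia.
split; [lia|lia|by apply/eqP; rewrite -dimv_eq0 h5].
Qed.

Lemma partial_sum_mono i x : (X i x <= X i.+1 x)%VS.
Proof. by rewrite /X /S [(\sum_(0 <= a < i.+2) _)%VS]big_nat_recr// addvSl. Qed.

Lemma hyperbolic_of_dominated : exists p : 'I_k -> M -> R,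
  [/\ forall i, {within Lam, continuous (p i)},
      forall i x, Lam x -> 0 < p i x,
      summably_separated f Lam (fun i x => ln (p (rev_ord i) x)) &
      forall i : 'I_k, exists Es Eu : forall x : M, {vspace tangent x},
        hyperbolicity g f Lam (p i) Es Eu /\
        forall x, Lam x -> \dim (Es x) = (\sum_(j < k | (j <= i)%N) ns j)%N].
Proof.
have [L Lc] := diffeo_cocycle g Lam_compact Lam_invariant.
have [L' Lc'] := dinv_cocycle g Lam_compact Lam_invariant.
have [C0 [al [C0_gt1 al0 pairs]]] :=
  pairs_of_dominated_splitting Lam_invariant Lam_compact E_dom.1.
have C0_ge0 : 0 <= C0 by lra.
have Edom a b : (a < b < k)%N -> dominated_pair f Lam nrm D C0 al (E (o a)) (E (o b)).
  by move=> /andP[ab bk]; apply: pairs; rewrite !oE// (ltn_trans ab).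
have Einv a : forward_invariant f Lam D (E (o a)).
  move=> x Lx m v vE; rewrite -(tangent_map_iter_invariant Lam_invariant m (@summand_invariant (o a)) Lx).
  exact: memv_img.
have [C C_ge0 XYdom] := dominated_sums N Lc C0_ge0 al0 Einv Edom.
have XY0 i x : (i < k)%N -> Lam x -> (X i x :&: Y i x = 0)%VS.
  by move=> ik Lx; have [] := partial_sum_dims ik Lx.
have XY1 i x : (i < k)%N -> Lam x -> (X i x + Y i x = fullv)%VS.
  by move=> ik Lx; exact: partial_sum_cat.
have dimXY i x y : (i < k)%N -> Lam x -> Lam y ->
    (\dim (X i x) + \dim (Y i y) = \dim (fullv : {vspace V}))%N.
  move=> ik Lx Ly; have [-> _ _] := partial_sum_dims ik Lx; have [_ -> _] := partial_sum_dims ik Ly.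
  by rewrite -(big_cat_nat (leq0n i.+1) ik)//= sum_dims dim_rV_fullv.
have dom i : (i < k)%N -> dominated_pair f Lam nrm D C al (X i) (Y i).
  by move=> ik; exact: XYdom.
have [K K_ge1 angle] : exists2 K : R, 1 <= K &
    forall i, (i < k)%N -> angle_bounded Lam nrm K (X i) (Y i).
  have /choice[K_ HK] : forall i : 'I_k, exists K : R,
      0 < K /\ angle_bounded Lam nrm K (X i) (Y i).
    by move=> i; have [K] := dominated_pair_angle N Lc al0 (dom i (ltn_ord i)); exists K.
  have K_ge0 i : 0 <= K_ i by apply: ltW; have [] := HK i.
  exists (1 + \sum_i K_ i); first by rewrite lerDl sumr_ge0.
  move=> i ik x Lx u v uX vY; have [_ h] := HK (Ordinal ik).
  have [h1 h2] := h x Lx u v uX vY.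
  have KK t : 0 <= t -> K_ (Ordinal ik) * t <= (1 + \sum_i K_ i) * t.
    move=> t0; rewrite ler_wpM2r// (bigD1 (Ordinal ik))//= addrCA lerDl.
    by rewrite addr_ge0// sumr_ge0.
  have uv := norm_ge0 (N x) (u + v).
  by split; [apply: le_trans h1 (KK _ uv)|apply: le_trans h2 (KK _ uv)].
have K0 : 0 < K by lra.
have angleYX i : (i < k)%N -> angle_bounded Lam nrm K (Y i) (X i).
  by move=> ik x Lx u v uY vX; have [h1 h2] := angle i ik x Lx v u vX uY; rewrite addrC.
have tn := @fiber_transport_near R d M g.
have nb := @fiber_norm_bounded R d M g.
have compX i x0 : (i < k)%N -> Lam x0 -> forall e : R, 0 < e ->
    \forall x \near within Lam (nbhs x0), forall w u v,
    w \in X i x0 -> u \in X i x -> v \in Y i x -> tau x0 x w = u + v ->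
    nrm x v <= e * nrm x0 w.
  move=> ik Lx0.
  apply: (dominated_component_near N tn Lc _ _ _ _ _ _ C_ge0 al0 (dom i ik) (ltW K0)
    (angle i ik) Lx0).
  - by move=> m y _; exact: (within_iter_cvg Lam (dfun_C1 f)).
  - move=> m y Ly.
    exact: (tangent_map_iter_cont g (dfun_C1 f) (diffeo_in_Lam Lam_invariant) Lam_compact).
  - exact: partial_sum_forward.
  - exact: partial_sum_forward.
  - by move=> y Ly; exact: XY0.
  - by move=> y z Ly Lz; exact: dimXY.
have domYX i : (i < k)%N -> dominated_pair (dinv f) Lam nrm Di C al (Y i) (X i).
  move=> ik; apply: (dominated_pair_backward _ _ _ _ _ (dom i ik)).
  - exact: (dinv_in_Lam Lam_invariant).
  - exact: dinvK.
  - move=> m x v.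
    have dfi := C1_differentiable_map (dinv_C1 f).
    have df := C1_differentiable_map (dfun_C1 f).
    have h := tangent_map_comp x v (differentiable_map_iter m dfi) (differentiable_map_iter m df).
    apply: etrans (esym h) _.
    have E1 : iter m f \o iter m (dinv f) = id.
      by apply/funext => y; exact: iter_dinvK.
    apply: etrans (congr1 (fun phi => tangent_map phi x v) E1) _; exact: tangent_map_id.
  - exact: partial_sum_backward.
  - exact: partial_sum_backward.
have compY i x0 : (i < k)%N -> Lam x0 -> forall e : R, 0 < e ->
    \forall x \near within Lam (nbhs x0), forall w u v,
    w \in Y i x0 -> u \in Y i x -> v \in X i x -> tau x0 x w = u + v ->
    nrm x v <= e * nrm x0 w.
  move=> ik Lx0.
  apply: (dominated_component_near N tn Lc' _ _ _ _ _ _ C_ge0 al0 (domYX i ik) (ltW K0)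
    (angleYX i ik) Lx0).
  - by move=> m y _; exact: (within_iter_cvg Lam (dinv_C1 f)).
  - move=> m y Ly.
    exact: (tangent_map_iter_cont g (dinv_C1 f) (dinv_in_Lam Lam_invariant) Lam_compact).
  - exact: partial_sum_backward.
  - exact: partial_sum_backward.
  - by move=> y Ly; rewrite capvC; exact: XY0.
  - by move=> y z Ly Lz; rewrite addnC; exact: dimXY.
have QX i x0 : (i < k)%N -> Lam x0 ->
    bundle_continuous_at Lam nrm tau id (fun x => daddv_pi (X i x) (Y i x)) x0.
  move=> ik Lx0; apply: (bundle_continuous_proj N (fun x => XY0 i x ik)
    (fun x => XY1 i x ik) K0 (angle i ik) Lx0 (compX i x0 ik Lx0)) => e e0.
  apply: filterS (compY i x0 ik Lx0 e e0) => x h w u v wY uX vY wE.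
  by apply: (h w v u wY vY uX); rewrite wE addrC.
have QY i x0 : (i < k)%N -> Lam x0 ->
    bundle_continuous_at Lam nrm tau id (fun x => daddv_pi (Y i x) (X i x)) x0.
  move=> ik Lx0; apply: (bundle_continuous_proj N _ _ K0 (angleYX i ik) Lx0
    (compY i x0 ik Lx0)) => [x Lx|x Lx|e e0].
  - by rewrite capvC; exact: XY0.
  - by rewrite addvC; exact: XY1.
  apply: filterS (compX i x0 ik Lx0 e e0) => x h w u v wY uX vY wE.
  by apply: (h w v u wY vY uX); rewrite wE addrC.
have [p [C' [dl [gm [dl0 gm0 p0 p_cvg [C'0 p_sep pX pY]]]]]] := separated_scalings
  N tn nb Lc (fun m x0 _ => @within_iter_cvg R d M f Lam (dfun_C1 f) m x0)
  (fun m x0 => @tangent_map_iter_cont R d M g f Lam (dfun_C1 f) (diffeo_in_Lam Lam_invariant)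
     Lam_compact m x0)
  XY0 XY1 QX (fun i => @partial_sum_forward 0 i.+1) (fun i => @partial_sum_forward i.+1 k) angle dom
  (fun i x (ik : (i.+1 < k)%N) (Lx : Lam x) => partial_sum_mono i x) C_ge0 K_ge1 al0.
exists (fun i => p i); split.
- by move=> i; apply/subspace_continuousP => x0 Lx0; exact: p_cvg.
- by move=> i x _; exact: p0.
- split.
    move=> i; apply/subspace_continuousP => x0 Lx0.
    exact: (cvg_comp _ _ (p_cvg _ _ (ltn_ord (rev_ord i)) Lx0)
      (continuous_ln (p0 (rev_ord i) x0))).
  (* The gap holds at every point, so the sum is bounded term by term and beta = 0. *)
  exists 0, gm; split=> // i j ij n m m1 x Lx.
  rewrite oppr0 add0r -[X in _ * X%:R](addKn n m) mulr_natr -sumr_const_nat.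
  apply: ler_sum => l _.
  (* For j = i + 1, the reversed index of i is the successor of the reversed index of j. *)
  have jk : (k - j.+1).+1 = (k - i.+1)%N by rewrite ij subnSK// -ij.
  have ik : ((k - j.+1).+1 < k)%N by rewrite jk ltn_subrL k_gt0.
  have := p_sep _ _ ik (iter_in_Lam Lam_invariant l Lx).
  by rewrite jk.
move=> i; exists (X i), (Y i); split; last first.
  move=> x Lx; have [-> _ _] := partial_sum_dims (ltn_ord i) Lx.
  rewrite big_mkord (big_ord_widen k (fun j => ns (o j)))//.
  by apply: eq_big => [j|j _]; [rewrite ltnS|rewrite o_ord].
have ik := ltn_ord i.
apply: (growth_hyperbolicity Lam_compact Lam_invariant _ C'0 (ltW K0) dl0
  (fun x => XY0 i x ik) (fun x => XY1 i x ik) _ _ _ _ (angle i ik)).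
- by move=> x _; exact: p0.
- by move=> x; exact: partial_sum_invariant.
- by move=> x; exact: partial_sum_invariant.
- apply: (continuous_subbundle_proj (fun x => XY0 i x ik) _ (fun x0 => QX i x0 ik)).
  by move=> x Lx; have [h _ _] := partial_sum_dims ik Lx; exact: h.
- apply: (continuous_subbundle_proj _ _ (fun x0 => QY i x0 ik)).
    by move=> x Lx; rewrite capvC; exact: XY0.
  by move=> x Lx; have [_ h _] := partial_sum_dims ik Lx; exact: h.
move=> x m Lx; split=> v vE; [exact: pX|exact: pY].
Qed.

End HyperbolicOfDominated.

(* E_1 is the most contracted summand, so the stable dimension n_1 + ... + n_i
   grows with i exactly when p_i decreases with i; hence the separation is
   required of log p_k, ..., log p_1, in this order. *)
Theorem theorem4p1 (R : realType) (d : nat) (M : closed_manifold R d)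
    (g : continuous_inner_product M) (f : diffeomorphism M)
    (Lam : set M) (Lam_compact : compact Lam) (Lam_invariant : f @` Lam = Lam)
    (k : nat) (k_ge2 : (2 <= k)%N)
    (ns : 'I_k -> nat) (ns_sum : (\sum_(i < k) ns i)%N = d) :
  (exists E : 'I_k -> forall x : M, {vspace tangent x},
     dominated_of_type g f Lam ns E)
  <->
  (exists p : 'I_k -> M -> R,
    [/\ forall i, {within Lam, continuous (p i)},
        forall i x, Lam x -> 0 < p i x,
        summably_separated f Lam (fun i x => ln (p (rev_ord i) x)) &
        forall i : 'I_k, exists Es Eu : forall x : M, {vspace tangent x},
          hyperbolicity g f Lam (p i) Es Eu /\
          forall x, Lam x ->
            \dim (Es x) = (\sum_(j < k | (j <= i)%N) ns j)%N ]).
Proof.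
have k_gt0 : (0 < k)%N by exact: leq_trans k_ge2.
split=> [[E E_dom]|[p [_ p_gt0 p_sep hyp]]].
  exact: (hyperbolic_of_dominated Lam_compact Lam_invariant k_gt0 ns_sum E_dom).
have /choice[Es /choice[Eu H]] := hyp.
have h i := (H i).1; have dimE i := (H i).2.
eexists; exact: (dominated_of_hyperbolic Lam_compact Lam_invariant k_gt0 ns_sum
  p_gt0 p_sep h dimE).
Qed.
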